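(* For real $R>1$, let $P(R)$ denote the number of prime elements $x+y\sqrt{-2}$ of $\mathbb{Z}[\sqrt{-2}]$ (with $x,y\in\mathbb{Z}$) such that $x>0$, $y\ge 0$ and $N(x+y\sqrt{-2})=x^2+2y^2\le R^2$, and let $A(R)$ denote the area of the planar region $\{(x,y)\in\mathbb{R}^2: x>0,\ y\ge 0,\ x^2+2y^2\le R^2\}$. Then the density of these primes satisfies $$\frac{P(R)}{A(R)}\sim\frac{\sqrt{2}}{\pi\log R}\qquad\text{as } R\to\infty .$$
   Context: $N$ is the norm $N(\alpha)=\alpha\bar\alpha$, so $N(x+y\sqrt{-2})=x^2+2y^2$. The density of primes in a region means the number of primes $x+y\sqrt{-2}$ with $(x,y)$ in the region divided by the area of the region in the $(x,y)$-coordinate plane. The notation $f(R)\sim g(R)$ as $R\to\infty$ means $f(R)/g(R)\to 1$. $\log$ is the natural logarithm. *)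

(* Defs.v *)
From HB Require Import structures.
From mathcomp Require Import all_boot all_order all_algebra finmap.
From mathcomp Require Import all_classical all_reals all_analysis.
From mathcomp Require Import ring lra zify.
Set Implicit Arguments.
Unset Strict Implicit.
Unset Printing Implicit Defensive.
Import Order.TTheory GRing.Theory Num.Theory.
Import numFieldNormedType.Exports.
Local Open Scope classical_set_scope.
Local Open Scope ring_scope.

(* [ZSqrtm2 x y] stands for x + y sqrt(-2); see [zsqrtm2E] and [sqrtm2_sqr]. *)
Record zsqrtm2 := ZSqrtm2 { xpart : int; ypart : int }.

Definition zsqrtm2_pair (a : zsqrtm2) : int * int := (xpart a, ypart a).
Definition pair_zsqrtm2 (p : int * int) : zsqrtm2 := ZSqrtm2 p.1 p.2.

Lemma zsqrtm2_pairK : cancel zsqrtm2_pair pair_zsqrtm2.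
Proof. by case. Qed.

HB.instance Definition _ := Countable.copy zsqrtm2 (can_type zsqrtm2_pairK).

Definition zsqrtm2_zero := ZSqrtm2 0 0.
Definition zsqrtm2_one := ZSqrtm2 1 0.
Definition zsqrtm2_opp (a : zsqrtm2) := ZSqrtm2 (- xpart a) (- ypart a).
Definition zsqrtm2_add (a b : zsqrtm2) :=
  ZSqrtm2 (xpart a + xpart b) (ypart a + ypart b).
Definition zsqrtm2_mul (a b : zsqrtm2) :=
  ZSqrtm2 (xpart a * xpart b - 2 * (ypart a * ypart b))
          (xpart a * ypart b + ypart a * xpart b).

Fact zsqrtm2_addA : associative zsqrtm2_add.
Proof. by move=> [a b] [c d] [e f]; congr ZSqrtm2 => /=; ring. Qed.
Fact zsqrtm2_addC : commutative zsqrtm2_add.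
Proof. by move=> [a b] [c d]; congr ZSqrtm2 => /=; ring. Qed.
Fact zsqrtm2_add0 : left_id zsqrtm2_zero zsqrtm2_add.
Proof. by move=> [a b]; congr ZSqrtm2 => /=; ring. Qed.
Fact zsqrtm2_addN : left_inverse zsqrtm2_zero zsqrtm2_opp zsqrtm2_add.
Proof. by move=> [a b]; congr ZSqrtm2 => /=; ring. Qed.

HB.instance Definition _ := GRing.isZmodule.Build zsqrtm2
  zsqrtm2_addA zsqrtm2_addC zsqrtm2_add0 zsqrtm2_addN.

Fact zsqrtm2_mulA : associative zsqrtm2_mul.
Proof. by move=> [a b] [c d] [e f]; congr ZSqrtm2 => /=; ring. Qed.
Fact zsqrtm2_mulC : commutative zsqrtm2_mul.
Proof. by move=> [a b] [c d]; congr ZSqrtm2 => /=; ring. Qed.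
Fact zsqrtm2_mul1 : left_id zsqrtm2_one zsqrtm2_mul.
Proof. by move=> [a b]; congr ZSqrtm2 => /=; ring. Qed.
Fact zsqrtm2_mulD : left_distributive zsqrtm2_mul +%R.
Proof. by move=> [a b] [c d] [e f]; congr ZSqrtm2 => /=; ring. Qed.
Fact zsqrtm2_1neq0 : zsqrtm2_one != 0.
Proof. by []. Qed.

HB.instance Definition _ := GRing.Zmodule_isComNzRing.Build zsqrtm2
  zsqrtm2_mulA zsqrtm2_mulC zsqrtm2_mul1 zsqrtm2_mulD zsqrtm2_1neq0.

Definition sqrtm2 : zsqrtm2 := ZSqrtm2 0 1.

Lemma sqrtm2_sqr : sqrtm2 ^+ 2 = - 2%:R.
Proof. by []. Qed.

Lemma zsqrtm2_intr (n : int) : n%:~R = ZSqrtm2 n 0.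
Proof.
have nat_case (m : nat) : (m%:R : zsqrtm2) = ZSqrtm2 m%:Z 0.
  elim: m => [|m IHm] //; rewrite mulrSr IHm.
  by congr ZSqrtm2 => /=; lia.
by case: n => m; rewrite ?NegzE ?mulrNz -pmulrn nat_case.
Qed.

Lemma zsqrtm2E (a : zsqrtm2) : a = (xpart a)%:~R + (ypart a)%:~R * sqrtm2.
Proof. by rewrite !zsqrtm2_intr; case: a => x y; congr ZSqrtm2 => /=; ring. Qed.

Definition zconj (a : zsqrtm2) : zsqrtm2 := ZSqrtm2 (xpart a) (- ypart a).

(* N(a) = a * conj a, which lies in Z (lemma [mul_zconj]), read as an integer. *)
Definition znorm (a : zsqrtm2) : int := xpart (a * zconj a).

Lemma znormE (a : zsqrtm2) : znorm a = xpart a ^+ 2 + 2 * ypart a ^+ 2.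
Proof. by rewrite /znorm; case: a => x y /=; ring. Qed.

Lemma mul_zconj (a : zsqrtm2) : a * zconj a = (znorm a)%:~R.
Proof. by rewrite zsqrtm2_intr znormE; case: a => x y; congr ZSqrtm2 => /=; ring. Qed.

Lemma znormM (a b : zsqrtm2) : znorm (a * b) = znorm a * znorm b.
Proof. by rewrite !znormE; case: a b => [x y] [z t] /=; ring. Qed.

Lemma znorm_ge0 (a : zsqrtm2) : 0 <= znorm a.
Proof. by rewrite znormE addr_ge0 ?sqr_ge0 // mulr_ge0 ?sqr_ge0. Qed.

Lemma znorm_eq0 (a : zsqrtm2) : (znorm a == 0) = (a == 0).
Proof.
apply/eqP/eqP => [|-> //]; rewrite znormE; case: a => x y /= h.
have [-> ->] // : x = 0 /\ y = 0 by split; apply/eqP; rewrite -sqrf_eq0; nia.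
Qed.

Definition zunit (a : zsqrtm2) : bool := znorm a == 1.
Definition zinv (a : zsqrtm2) : zsqrtm2 := if zunit a then zconj a else a.

Fact zsqrtm2_mulVr : {in zunit, left_inverse 1 zinv *%R}.
Proof.
move=> a ua; have na : znorm a = 1 by apply/eqP.
by rewrite /zinv /zunit na eqxx mulrC mul_zconj na.
Qed.
Fact zsqrtm2_unitP (a b : zsqrtm2) : b * a = 1 -> zunit a.
Proof.
move=> /(congr1 znorm); rewrite znormM (_ : znorm 1 = 1) // => h.
have /eqP : (`|znorm b| * `|znorm a|)%N = 1%N by rewrite -abszM h.
by rewrite muln_eq1 => /andP[_ /eqP na]; rewrite /zunit -(gez0_abs (znorm_ge0 a)) na.
Qed.
Fact zsqrtm2_inv_out : {in [predC zunit], zinv =1 id}.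
Proof. by move=> a; rewrite inE /= /zinv => /negbTE; rewrite -topredE /= => ->. Qed.

HB.instance Definition _ := GRing.ComNzRing_hasMulInverse.Build zsqrtm2
  zsqrtm2_mulVr zsqrtm2_unitP zsqrtm2_inv_out.

Fact zsqrtm2_idomain (a b : zsqrtm2) : a * b = 0 -> (a == 0) || (b == 0).
Proof. by move/eqP; rewrite -!znorm_eq0 znormM mulf_eq0. Qed.

HB.instance Definition _ :=
  GRing.ComUnitRing_isIntegral.Build zsqrtm2 zsqrtm2_idomain.

Definition rdivides (A : comNzRingType) (a b : A) : Prop := exists c, b = c * a.

Definition prime_element (A : idomainType) (p : A) : Prop :=
  [/\ p != 0, p \isn't a GRing.unit &
      forall a b : A, rdivides p (a * b) -> rdivides p a \/ rdivides p b].

Section Density.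
Context {R : realType}.
Implicit Type r : R.

Definition quadrant_primes r : set zsqrtm2 :=
  [set a | prime_element a /\
     [/\ 0 < xpart a, 0 <= ypart a & (znorm a)%:~R <= r ^+ 2]].

Lemma finite_quadrant_primes r : finite_set (quadrant_primes r).
Proof.
pose n := Num.truncn (r ^+ 2).
apply: (@sub_finite_set _ _ ((fun ij : nat * nat => ZSqrtm2 ij.1 ij.2) @`
          (`I_n.+1 `*` `I_n.+1))); last first.
  by apply: finite_image; apply: finite_setX; exact: finite_II.
move=> [x y] [_ [/= x0 y0 le_r]].
have le_n : znorm (ZSqrtm2 x y) <= n%:Z.
  case: (znorm _) (znorm_ge0 (ZSqrtm2 x y)) le_r => // m _ le_r.
  by rewrite lez_nat /n truncn_ge_nat ?sqr_ge0.
move: le_n; rewrite znormE /= => le_n.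
exists (`|x|%N, `|y|%N); first by split => /=; nia.
by congr ZSqrtm2 => /=; lia.
Qed.

(* [fset_set] is the underlying finite set, meaningful here by
   [finite_quadrant_primes]. *)
Definition prime_count r : nat := #|` fset_set (quadrant_primes r)|.

Definition quadrant_region r : set (R * R) :=
  [set p | [/\ 0 < p.1, 0 <= p.2 & p.1 ^+ 2 + 2 * p.2 ^+ 2 <= r ^+ 2]].

Definition quadrant_area r : R :=
  fine ((lebesgue_measure \x lebesgue_measure)%E (quadrant_region r)).

Definition asymp_equiv_pinfty (f g : R -> R) : Prop :=
  f r / g r @[r --> +oo] --> (1 : R).

End Density.

(* Main.v *)
(* The quadratic field Q(sqrt(-2)) has residue character chi modulo 8, with
   chi(1) = chi(3) = 1 and chi(5) = chi(7) = -1.  Put r = chi * 1 (Dirichlet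
   convolution), the number of ideals of given norm.  Its partial sums are
   c x + O(sqrt x) with c > 0, its Dirichlet inverse b satisfies |b| <= r, and
   Lam = b * (r ln) is (1 + chi) times the von Mangoldt function.  These facts
   are all that Selberg's elementary method needs: the Tatuzawa-Iseki identity
   turns them into R(x) ln x + sum_(n <= x) Lam(n) R(x / n) = O(x) for
   R(x) = sum_(n <= x) Lam(n) - x, hence into an upper bound for |R| by its own
   logarithmic average.  Since the sum of R(n) / n^2 is bounded, R must be small
   on some part of every long interval, and iterating the upper bound gives
   R(x) = o(x).  So the primes p with chi(p) = 1 up to x number x / (2 ln x)
   asymptotically.  Up to O(sqrt x) elements with y = 0, the prime elements
   with x > 0 and y >= 0 correspond to these primes p = x^2 + 2 y^2: -2 is a
   square modulo p by Gauss's lemma, Thue's pigeonhole argument produces the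
   representation, and it is unique.  The region is a quarter of an ellipse, of
   area pi R^2 / (4 sqrt 2). *)
Require Import Defs.
From mathcomp Require Import all_boot all_order all_algebra finmap.
From mathcomp Require Import fingroup cyclic finfield.
From mathcomp Require Import all_classical all_reals all_analysis measurable_realfun.
From mathcomp Require Import ring lra zify.
Set Implicit Arguments.
Unset Strict Implicit.
Unset Printing Implicit Defensive.
Import Order.TTheory GRing.Theory Num.Theory.
Import numFieldNormedType.Exports.
Local Open Scope classical_set_scope.
Local Open Scope ring_scope.

(** * Partial sums *)

(** Counting all norms through [r], instead of separating residue classes modulo 8, keeps Selberg's
    method close to the rational case: [r] is nonnegative, its mean value c is L(1, chi), and the
    positivity of c, usually a delicate point, is a numerical check on eight terms of the series.
    The square-root error in the sums of [r] matters: it leaves room to absorb squared logarithms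
    when the right side of the Tatuzawa-Iseki identity is bounded termwise, with |b| <= r, by O((x /
    n)^(3/4)). Chebyshev and Mertens bounds are by-products, not inputs: the identity is applied to
    psi - id + s, where the shift s cancels the secondary main term, and the resulting bound on psi
    is what allows the shift to be removed. In the endgame the gain per iteration must not depend on
    the current bound, or the iteration could stall above the target. As for the final constant,
    there are about R^2 / (2 ln R^2) = R^2 / (4 ln R) prime elements, and dividing by pi R^2 / (4
    sqrt 2) gives sqrt 2 / (pi ln R). *)

Section SumTo.
Context {R : realType}.
Implicit Types (x y : R) (a f g : nat -> R).

(** [Num.truncn] is 0 on negative reals, so the sum is empty whenever x < 1. The index starts at 1,
    where reciprocals and logarithms make sense. *)
Definition sumto x f : R := \sum_(1 <= n < (Num.truncn x).+1) f n.

Lemma sumto_nat (N : nat) f : sumto N%:R f = \sum_(1 <= n < N.+1) f n.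
Proof. by rewrite /sumto natrK. Qed.

Lemma mem_sumto x n : 0 <= x -> (n < (Num.truncn x).+1)%N = (n%:R <= x).
Proof. by move=> x0; rewrite ltnS truncn_ge_nat. Qed.

Lemma le_sumto x f g :
  (forall n, (0 < n)%N -> n%:R <= x -> f n <= g n) -> sumto x f <= sumto x g.
Proof.
move=> h; rewrite /sumto !big_nat; apply: ler_sum => n /andP[n0 nx].
have [x0|x0] := leP 0 x; first by apply: h => //; rewrite -mem_sumto.
by move: nx; rewrite truncn_floor leNgt x0 /=; lia.
Qed.

Lemma eq_sumto x f g :
  (forall n, (0 < n)%N -> n%:R <= x -> f n = g n) -> sumto x f = sumto x g.
Proof. by move=> h; apply/le_anti/andP; split; apply: le_sumto => n n0 nx; rewrite h. Qed.

Lemma sumtoD x f g : sumto x (fun n => f n + g n) = sumto x f + sumto x g.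
Proof. exact: big_split. Qed.

Lemma sumtoN x f : sumto x (fun n => - f n) = - sumto x f.
Proof. exact: sumrN. Qed.

Lemma sumtoB x f g : sumto x (fun n => f n - g n) = sumto x f - sumto x g.
Proof. by rewrite sumtoD sumtoN. Qed.

Lemma sumtoZ x (k : R) f : sumto x (fun n => k * f n) = k * sumto x f.
Proof. by rewrite /sumto mulr_sumr. Qed.

Lemma ler_norm_sumto x f : `|sumto x f| <= sumto x (fun n => `|f n|).
Proof. exact: ler_norm_sum. Qed.

Lemma sumto_ge0 x f : (forall n, (0 < n)%N -> n%:R <= x -> 0 <= f n) -> 0 <= sumto x f.
Proof.
move=> h; rewrite (_ : 0 = sumto x (fun=> 0)); first exact: le_sumto.
by rewrite /sumto big1.
Qed.

Lemma sumto_mono x y f : (forall n, (0 < n)%N -> 0 <= f n) -> x <= y ->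
  sumto x f <= sumto y f.
Proof.
move=> h xy; rewrite /sumto (@big_cat_nat _ _ _ (Num.truncn x).+1 1 (Num.truncn y).+1) //=.
  by rewrite lerDl big_nat; apply: sumr_ge0 => n /andP[n0 _]; apply: h; lia.
by rewrite ltnS le_truncn.
Qed.

Lemma sumto_divisors (M k : nat) f : (0 < k <= M)%N ->
  \sum_(d <- divisors k) f d = \sum_(1 <= d < M.+1 | (d %| k)%N) f d.
Proof.
move=> /andP[k0 kM]; rewrite -[RHS]big_filter; apply: perm_big; apply: uniq_perm.
- exact: divisors_uniq.
- by apply: filter_uniq; apply: iota_uniq.
move=> d; rewrite -dvdn_divisors // mem_filter mem_index_iota.
case dk : (d %| k)%N => //=; have := dvdn_leq k0 dk; have := dvdn_gt0 k0 dk; lia.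
Qed.

(** Both sides run over the pairs (d, m) with d m <= x, grouped by d on the left and by k = d m on
    the right. The partial-sum identities for Dirichlet convolution come from this exchange. *)
Lemma sumto_sumto x (G : nat -> nat -> R) :
  sumto x (fun n => sumto (x / n%:R) (G n)) =
  sumto x (fun k => \sum_(d <- divisors k) G d (k %/ d)%N).
Proof.
rewrite /sumto; set M := Num.truncn x.
(* A triple sum over one fixed box, with k = m d as indicator, makes the ranges independent, so that
   the sums can be exchanged. *)
transitivity (\sum_(1 <= d < M.+1) \sum_(1 <= m < M.+1) \sum_(1 <= k < M.+1) if k == (m * d)%N then G d m else 0).
  apply: eq_big_nat => d /andP[d0 dM].
  have x0 : 0 <= x.
    by rewrite leNgt; apply/negP => x0; move: dM; rewrite /M truncn_floor leNgt x0 /=; lia.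
  have dx : d%:R <= x by rewrite -mem_sumto.
  have d0' : (0 : R) < d%:R by rewrite ltr0n.
  have xd0 : 0 <= x / d%:R by rewrite divr_ge0.
  have le_md (m : nat) : (m <= Num.truncn (x / d%:R))%N = (m * d <= M)%N.
    by rewrite !truncn_ge_nat // natrM ler_pdivlMr.
  have tM : (Num.truncn (x / d%:R) <= M)%N.
    apply: leq_trans (leq_pmulr _ d0) _; rewrite -le_md leqnn //.
  rewrite (big_nat_widen 1 _ M.+1) //= big_mkcond /=.
  apply: eq_big_nat => m /andP[m0 mM]; rewrite -big_mkcond big_nat1_eq.
  by rewrite ltnS le_md ltnS muln_gt0 m0 d0.
under eq_bigr => d _ do rewrite exchange_big /=.
rewrite exchange_big /=; apply: eq_big_nat => k /andP[k0 kM].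
rewrite (@sumto_divisors M) ?k0 // [RHS]big_mkcond /=.
apply: eq_big_nat => d /andP[d0 dM].
case: ifPn => [/dvdnP[q kE]|ndk]; last first.
  by rewrite big1 // => m _; case: eqP => // e; case/negP: ndk; rewrite e dvdn_mull.
rewrite kE mulnK // (eq_bigr (fun m => if m == q then G d m else 0)); last first.
  by move=> m _; rewrite eqn_pmul2r // eq_sym.
rewrite -big_mkcond big_nat1_eq ifT //; move: k0 kM; rewrite kE muln_gt0 => /andP[-> _] /=.
by move=> h; apply: leq_ltn_trans h; rewrite leq_pmulr.
Qed.

Lemma sumto_mulr x f (k : R) : sumto x (fun n => f n * k) = sumto x f * k.
Proof. by rewrite /sumto mulr_suml. Qed.

Lemma abel_sum a f (N : nat) :
  \sum_(1 <= n < N.+1) a n * f n =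
  (\sum_(1 <= k < N.+1) a k) * f N.+1 +
  \sum_(1 <= n < N.+1) (\sum_(1 <= k < n.+1) a k) * (f n - f n.+1).
Proof.
elim: N => [|N IH]; first by rewrite !big_geq // mul0r addr0.
by rewrite !(big_nat_recr N.+1) //= IH; ring.
Qed.

Lemma abel_sum_itv a f (m N : nat) : (m <= N)%N ->
  \sum_(m.+1 <= n < N.+1) a n * f n =
  (\sum_(1 <= k < N.+1) a k) * f N.+1 - (\sum_(1 <= k < m.+1) a k) * f m.+1 +
  \sum_(m.+1 <= n < N.+1) (\sum_(1 <= k < n.+1) a k) * (f n - f n.+1).
Proof.
move=> mN.
have h1 (F : nat -> R) : \sum_(m.+1 <= n < N.+1) F n =
    \sum_(1 <= n < N.+1) F n - \sum_(1 <= n < m.+1) F n.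
  by rewrite (@big_cat_nat _ _ _ m.+1 1 N.+1) //= [RHS]addrC addKr.
rewrite [LHS]h1 [X in _ = _ + X]h1 (abel_sum _ _ N) (abel_sum _ _ m).
by rewrite opprD addrACA.
Qed.

(* Summation by parts: a decreasing [f] only sees the partial sums of [a], which
   are dominated by those of the constant [k]. *)
Lemma sum_mul_le_of_partial_sums (k : R) a f (N : nat) :
  (forall n, \sum_(1 <= i < n.+1) a i <= k * n%:R) ->
  (forall n, (0 < n)%N -> 0 <= f n) ->
  (forall n, (0 < n < N)%N -> f n.+1 <= f n) ->
  \sum_(1 <= n < N.+1) a n * f n <= k * \sum_(1 <= n < N.+1) f n.
Proof.
move=> ha f0 fdec.
suff : \sum_(1 <= n < N.+1) a n * f n +
  (k * N%:R - \sum_(1 <= i < N.+1) a i) * f N <= k * \sum_(1 <= n < N.+1) f n.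
  case: N {fdec} => [|N]; first by rewrite !big_geq // mulr0.
  by apply: le_trans; rewrite lerDl mulr_ge0 ?f0 // subr_ge0.
elim: N fdec => [|N IH] fdec.
  by rewrite !big_geq // mulr0n !mulr0 subrr mul0r addr0.
case: N IH fdec => [|N] IH fdec.
  by rewrite !big_nat1 mulr1 mulrBl addrC subrK.
have /IH{}IH : forall n, (0 < n < N.+1)%N -> f n.+1 <= f n by move=> n h; apply: fdec; lia.
rewrite -(natr1 N.+1) !(big_nat_recr N.+2) //= (mulrDr k _ 1).
have d := fdec N.+1 ltac:(lia).
set A := \sum_(1 <= i < N.+2) a i; set B := \sum_(1 <= i < N.+2) _ in IH *.
have hA : A <= k * N.+1%:R by exact: ha.
have h1 : (k * N.+1%:R - A) * f N.+2 <= (k * N.+1%:R - A) * f N.+1.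
  by rewrite ler_wpM2l // subr_ge0.
move: IH; rewrite -/A; set D := \sum_(1 <= i < N.+2) f i; lra.
Qed.

Lemma sumto_mul_le (k : R) a f x : 0 <= x ->
  (forall y, 1 <= y -> sumto y a <= k * y) -> 0 <= k ->
  (forall n, (0 < n)%N -> n%:R <= x -> 0 <= f n) ->
  (forall n, (0 < n)%N -> n.+1%:R <= x -> f n.+1 <= f n) ->
  sumto x (fun n => a n * f n) <= k * sumto x f.
Proof.
move=> x0 ha k0 f0 fdec.
(* Nonnegativity of [f] is known only up to x, so [f] is cut off to 0 beyond; the sums do not
   change. *)
pose g n := if n%:R <= x then f n else 0.
have E (h : R -> R -> R) : sumto x (fun n => h (a n) (f n)) = sumto x (fun n => h (a n) (g n)).
  by apply: eq_sumto => n n0 nx; rewrite /g nx.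
rewrite (E *%R) (E (fun _ y => y)); apply: sum_mul_le_of_partial_sums.
- case=> [|n]; first by rewrite big_geq // mulr0.
  by rewrite -sumto_nat ha // ler1n.
- by move=> n n0; rewrite /g; case: ifP => // h; apply: f0.
- move=> n /andP[n0 nN]; have h : n.+1%:R <= x by rewrite -mem_sumto // ltnS.
  by rewrite /g h (le_trans _ h) ?ler_nat // fdec.
Qed.

(** Quantitative Dirichlet test. The differences of [f] telescope, so the three Abel terms are at
    most B f(N+1), B f(m+1) and B (f(m+1) - f(N+1)), and N disappears from their total. *)
Lemma abel_bound (B : R) a f (m N : nat) :
  (forall n, `|\sum_(1 <= i < n.+1) a i| <= B) ->
  (forall n, (m < n)%N -> 0 <= f n) ->
  (forall n, (m < n)%N -> f n.+1 <= f n) ->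
  `|\sum_(m.+1 <= n < N.+1) a n * f n| <= 2 * B * f m.+1.
Proof.
move=> hB f0 fdec; have B0 : 0 <= B by apply: le_trans (hB 0%N).
have [mN|Nm] := leqP m N; last first.
  by rewrite big_geq ?normr0 ?mulr_ge0 ?f0 //; lia.
rewrite abel_sum_itv // .
have tele : \sum_(m.+1 <= n < N.+1) (f n - f n.+1) = f m.+1 - f N.+1.
  rewrite -[LHS]opprK -sumrN -[RHS]opprK opprB; congr (- _).
  rewrite -(telescope_sumr f) //; apply: eq_bigr => i _; lra.
have h3 : `|\sum_(m.+1 <= n < N.+1) (\sum_(1 <= k < n.+1) a k) * (f n - f n.+1)|
    <= B * (f m.+1 - f N.+1).
  rewrite -tele mulr_sumr; apply: le_trans (ler_norm_sum _ _ _) _.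
  rewrite !big_nat; apply: ler_sum => n /andP[n0 _]; rewrite normrM ler_pM //.
  by rewrite ger0_norm // subr_ge0 fdec.
have h1 : `|(\sum_(1 <= k < N.+1) a k) * f N.+1| <= B * f N.+1.
  by rewrite normrM (ger0_norm (f0 _ _)) ?ler_wpM2r ?f0 //; lia.
have h2 : `|(\sum_(1 <= k < m.+1) a k) * f m.+1| <= B * f m.+1.
  by rewrite normrM (ger0_norm (f0 _ _)) ?ler_wpM2r ?f0.
move: h1 h2 h3; rewrite !ler_norml; lra.
Qed.

End SumTo.

(** * Elementary estimates for sums of logarithms, reciprocals and roots *)

Section ElementarySums.
Context {R : realType}.
Implicit Types (x y : R) (f F : nat -> R).

(** Replaces the integral test: [F] plays the primitive, and each use compares one term with one
    increment. *)
Lemma sum_le_telescope f F m N : (m <= N)%N ->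
  (forall n, (m <= n < N)%N -> f n <= F n.+1 - F n) ->
  \sum_(m <= n < N) f n <= F N - F m.
Proof.
move=> mN h; rewrite -telescope_sumr // !big_nat; apply: ler_sum => n; exact: h.
Qed.

Lemma telescope_le_sum f F m N : (m <= N)%N ->
  (forall n, (m <= n < N)%N -> F n.+1 - F n <= f n) ->
  F N - F m <= \sum_(m <= n < N) f n.
Proof.
move=> mN h; rewrite -telescope_sumr // !big_nat; apply: ler_sum => n; exact: h.
Qed.

Lemma ln_sub_le x y : 0 < x -> 0 < y -> ln y - ln x <= (y - x) / x.
Proof.
move=> x0 y0; rewrite -ln_div ?posrE //.
have -> : y / x = 1 + (y - x) / x by field; rewrite gt_eqF.
apply: le_ln1Dx; rewrite ltr_pdivlMr //; lra.
Qed.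

Lemma ln_sub_ge x y : 0 < x -> 0 < y -> (y - x) / y <= ln y - ln x.
Proof.
move=> x0 y0; have := ln_sub_le y0 x0.
have -> : (x - y) / y = - ((y - x) / y) by ring.
lra.
Qed.

Lemma lnS_sub_le n : (0 < n)%N -> ln n.+1%:R - ln n%:R <= n%:R^-1 :> R.
Proof.
move=> n0; have := @ln_sub_le n%:R n.+1%:R _ _; rewrite !ltr0n => /(_ n0 isT).
by rewrite -natr1 addrAC subrr add0r div1r.
Qed.

Lemma lnS_sub_ge n : (0 < n)%N -> n.+1%:R^-1 <= ln n.+1%:R - ln n%:R :> R.
Proof.
move=> n0; have := @ln_sub_ge n%:R n.+1%:R _ _; rewrite !ltr0n => /(_ n0 isT).
by rewrite -[in X in X / _]natr1 addrAC subrr add0r div1r.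
Qed.

Lemma natr_truncn x : 1 <= x ->
  [/\ (0 < Num.truncn x)%N, (Num.truncn x)%:R <= x, x < (Num.truncn x)%:R + 1
    & x <= 2 * (Num.truncn x)%:R].
Proof.
move=> x1; have x0 : 0 <= x by lra.
have n0 : (0 < Num.truncn x)%N by rewrite truncn_gt0.
have /andP[h1 h2] := truncn_itv x0; rewrite -natr1 in h2; split => //.
have : (1 : R) <= (Num.truncn x)%:R by rewrite ler1n.
lra.
Qed.

Lemma harmonic_le x : 1 <= x -> sumto x (fun n => n%:R^-1) <= 1 + ln x.
Proof.
move=> x1; have [n0 nx _ _] := natr_truncn x1.
rewrite /sumto big_ltn // invr1 lerD2l.
have h : \sum_(2 <= n < (Num.truncn x).+1) n%:R^-1 <= ln (Num.truncn x).+1.-1%:R - ln 2.-1%:R :> R.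
  apply: (@sum_le_telescope _ (fun n => ln n.-1%:R)) => // n /andP[n2 _].
  by have := @lnS_sub_ge n.-1; rewrite prednK; [apply|]; lia.
apply: le_trans h _; rewrite /= ln1 subr0 ler_ln ?posrE ?ltr0n //; lra.
Qed.

Lemma harmonic_ge x : 1 <= x -> ln x <= sumto x (fun n => n%:R^-1).
Proof.
move=> x1; have [n0 _ nx _] := natr_truncn x1.
have h : ln (Num.truncn x).+1%:R - ln 1%:R <= \sum_(1 <= n < (Num.truncn x).+1) n%:R^-1 :> R.
  apply: (@telescope_le_sum _ (fun n => ln n%:R)) => // n /andP[n1 _].
  exact: lnS_sub_le.
rewrite natr1 in nx; apply: le_trans h.
by rewrite ln1 subr0 ler_ln ?posrE ?ltr0n ?ltW //; lra.
Qed.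

Lemma ln_le_sub1 x : 0 < x -> ln x <= x - 1.
Proof. by move=> x0; have := @ln_sub_le 1 x ltr01 x0; rewrite ln1 subr0 divr1. Qed.

Lemma sum_ln_itv x : 1 <= x ->
  x * ln x - x - (1 + ln x) <= sumto x (fun n => ln n%:R) <= x * ln x - x + (1 + ln x).
Proof.
move=> x1; have [n0 nx nx1 _] := natr_truncn x1; set N := Num.truncn x in n0 nx nx1 *.
have N0 : (0 : R) < N%:R by rewrite ltr0n.
have N1 : (1 : R) <= N%:R by rewrite ler1n.
have lN : ln N%:R <= ln x by rewrite ler_ln ?posrE //; lra.
have lN0 : 0 <= ln N%:R :> R by rewrite ln_ge0.
have d1 : ln x - ln N%:R <= (x - N%:R) / N%:R by apply: ln_sub_le; lra.
have d2 : N%:R * (ln x - ln N%:R) <= x - N%:R.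
  by rewrite mulrC -ler_pdivlMr.
have d5 : x - N%:R <= (ln x - ln N%:R) * x by rewrite -ler_pdivrMr; [apply: ln_sub_ge|]; lra.
have d6 : 0 <= (x - N%:R) * ln N%:R by rewrite mulr_ge0 //; lra.
have d3 : (x - N%:R) * ln x <= ln x by rewrite ler_piMl ?ln_ge0 //; lra.
(* This is t ln t - t at t = n - 1. It bounds the sum from below as it stands; from above it needs
   the extra ln(n - 1), whose telescoped total is the ln x of the error term. *)
pose F (n : nat) : R := n.-1%:R * ln n.-1%:R - n.-1%:R.
have up : \sum_(2 <= n < N.+1) ln n%:R <= (F N.+1 + ln N.+1.-1%:R) - (F 2%N + ln 2.-1%:R).
  apply: (@sum_le_telescope _ (fun n => F n + ln n.-1%:R)) => // n /andP[n2 nN].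
  rewrite /F; case: n n2 nN => [|[|n]] //= _ _.
  have := @lnS_sub_ge n.+1 isT; have n1 : (0 : R) < n.+2%:R by rewrite ltr0n.
  rewrite -div1r ler_pdivrMr // -(natr1 n.+1); lra.
have lo : F N.+1 - F 2%N <= \sum_(2 <= n < N.+1) ln n%:R.
  apply: telescope_le_sum => // n /andP[n2 nN].
  rewrite /F; case: n n2 nN => [|[|n]] //= _ _.
  have := @lnS_sub_le n.+1 isT; have n1 : (0 : R) < n.+1%:R by rewrite ltr0n.
  rewrite -div1r ler_pdivlMr // -(natr1 n.+1); lra.
move: up lo; rewrite /F /= ln1 /sumto -/N (@big_ltn _ _ _ 1) // ln1 mulr0 => up lo.
apply/andP; split; lra.
Qed.

Lemma sum_ln_div_le x : 1 <= x -> sumto x (fun n => ln (x / n%:R)) <= 2 * x.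
Proof.
move=> x1; have [n0 nx nx1 _] := natr_truncn x1.
have /andP[h _] := sum_ln_itv x1.
rewrite (@eq_sumto _ _ _ (fun n => ln x - ln n%:R)); last first.
  by move=> n n1 _; rewrite ln_div ?posrE ?ltr0n //; lra.
rewrite sumtoB {1}/sumto big_const_nat subn1 /= iter_addr_0 -mulr_natl.
have d4 : 0 <= (x - (Num.truncn x)%:R) * ln x by rewrite mulr_ge0 ?ln_ge0 //; lra.
have := @ln_le_sub1 x; lra.
Qed.

Lemma sqrt_ge1 x : 1 <= x -> 1 <= Num.sqrt x.
Proof. by move=> x1; rewrite -{1}(@sqrtr1 R) ler_wsqrtr. Qed.

Lemma sum_inv_sqrt_le (N : nat) :
  \sum_(1 <= n < N.+1) (Num.sqrt n%:R)^-1 <= 2 * Num.sqrt N%:R :> R.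
Proof.
have -> : 2 * Num.sqrt N%:R = 2 * Num.sqrt N.+1.-1%:R - 2 * Num.sqrt 1.-1%:R :> R.
  by rewrite /= mulr0n sqrtr0; ring.
apply: (@sum_le_telescope _ (fun n => 2 * Num.sqrt n.-1%:R)) => // n /andP[n1 _] /=.
case: n n1 => // n _ /=.
have a0 := sqrtr_ge0 (n%:R : R); have b0 : 0 < Num.sqrt (n.+1%:R : R) by rewrite sqrtr_gt0.
have a2 : Num.sqrt n%:R ^+ 2 = n%:R :> R by rewrite sqr_sqrtr.
have b2 : Num.sqrt n.+1%:R ^+ 2 = n%:R + 1 :> R by rewrite sqr_sqrtr ?natr1.
rewrite -div1r ler_pdivrMr //; nra.
Qed.

(** x^(3/4). The exponent lies strictly between 1/2 and 1: it must beat x^(1/2) times squared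
    logarithms, and the sum of (x / n)^(3/4) must still be O(x). *)
Definition pow34 x : R := Num.sqrt x * Num.sqrt (Num.sqrt x).

Lemma sum_inv_pow34_le (N : nat) :
  \sum_(1 <= n < N.+1) (pow34 n%:R)^-1 <= 4 * Num.sqrt (Num.sqrt N%:R) :> R.
Proof.
have -> : 4 * Num.sqrt (Num.sqrt N%:R) =
    4 * Num.sqrt (Num.sqrt N.+1.-1%:R) - 4 * Num.sqrt (Num.sqrt 1.-1%:R) :> R.
  by rewrite /= mulr0n !sqrtr0; ring.
apply: (@sum_le_telescope _ (fun n => 4 * Num.sqrt (Num.sqrt n.-1%:R))) => // n /andP[n1 _] /=.
case: n n1 => // n _ /=; rewrite /pow34.
set a := Num.sqrt (Num.sqrt n%:R) : R; set b := Num.sqrt (Num.sqrt n.+1%:R) : R.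
have a0 : 0 <= a by exact: sqrtr_ge0.
have b0 : 0 < b by rewrite !sqrtr_gt0.
have a2 : Num.sqrt n%:R = a ^+ 2 by rewrite sqr_sqrtr.
have b2 : Num.sqrt n.+1%:R = b ^+ 2 by rewrite sqr_sqrtr.
have a4 : n%:R = (a ^+ 2) ^+ 2 :> R by rewrite -a2 sqr_sqrtr.
have b4 : n%:R + 1 = (b ^+ 2) ^+ 2 :> R by rewrite -b2 sqr_sqrtr ?natr1.
have ab : a <= b by rewrite /a /b; do 2 apply: ler_wsqrtr; rewrite ler_nat.
have b3 : 0 < b ^+ 3 by rewrite exprn_gt0.
rewrite b2 -(exprSr b 2) -div1r ler_pdivrMr //.
have e : b ^+ 4 - a ^+ 4 = 1 by rewrite (exprM b 2 2) (exprM a 2 2) -a4 -b4; ring.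
have e1 : (b - a) * (b ^+ 3 + b ^+ 2 * a + b * a ^+ 2 + a ^+ 3) = 1 by rewrite -e; ring.
have h : b ^+ 3 + b ^+ 2 * a + b * a ^+ 2 + a ^+ 3 <= 4 * b ^+ 3.
  have h1 : b ^+ 2 * a <= b ^+ 3 by rewrite [leRHS]exprSr ler_wpM2l // exprn_ge0 // ltW.
  have h2 : b * a ^+ 2 <= b ^+ 3 by rewrite [leRHS]exprS ler_wpM2l ?(ltW b0) // ler_pXn2r ?nnegrE // ltW.
  have h3 : a ^+ 3 <= b ^+ 3 by rewrite ler_pXn2r ?nnegrE // ltW.
  lra.
have := ler_wpM2l (_ : 0 <= b - a) h; rewrite subr_ge0 => /(_ ab); rewrite e1; lra.
Qed.

Lemma sumto_sqrt_le x : 0 <= x -> sumto x (fun n => Num.sqrt (x / n%:R)) <= 2 * x.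
Proof.
move=> x0; rewrite (@eq_sumto _ _ _ (fun n => Num.sqrt x * (Num.sqrt n%:R)^-1)); last first.
  by move=> n n0 _; rewrite sqrtrM // sqrtrV.
rewrite sumtoZ; apply: le_trans (ler_wpM2l (sqrtr_ge0 x) (sum_inv_sqrt_le _)) _.
rewrite mulrCA ler_pM2l // -[leRHS](sqr_sqrtr x0) expr2 ler_wpM2l ?sqrtr_ge0 //.
by rewrite ler_wsqrtr // truncn_le.
Qed.

Lemma sumto_pow34_le x : 0 <= x -> sumto x (fun n => pow34 (x / n%:R)) <= 4 * x.
Proof.
move=> x0; rewrite (@eq_sumto _ _ _ (fun n => pow34 x * (pow34 n%:R)^-1)); last first.
  move=> n n0 _; rewrite /pow34 sqrtrM // sqrtrV // sqrtrM ?sqrtr_ge0 //.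
  by rewrite sqrtrV ?sqrtr_ge0 // invfM mulrACA.
have q0 : 0 <= pow34 x by rewrite mulr_ge0 ?sqrtr_ge0.
rewrite sumtoZ; apply: le_trans (ler_wpM2l q0 (sum_inv_pow34_le _)) _.
rewrite mulrCA ler_pM2l // -[leRHS](sqr_sqrtr x0) expr2 /pow34 -mulrA.
rewrite ler_wpM2l ?sqrtr_ge0 // -[leRHS](sqr_sqrtr (sqrtr_ge0 x)) expr2.
by rewrite ler_wpM2l ?sqrtr_ge0 // !ler_wsqrtr // truncn_le.
Qed.

(** With s = x^(1/8), ln x = 8 ln s <= 8 (s - 1), so (1 + ln x)^2 <= 64 s^2 = 64 x^(1/4). *)
Lemma log_sqr_le_pow34 x : 1 <= x ->
  Num.sqrt x * (1 + ln x) ^+ 2 <= 64 * pow34 x.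
Proof.
move=> x1; set s := Num.sqrt (Num.sqrt (Num.sqrt x)).
have s1 : 1 <= s by rewrite !sqrt_ge1.
have s0 : 0 < s by lra.
have e4 : Num.sqrt (Num.sqrt x) = s ^+ 2 by rewrite sqr_sqrtr // sqrtr_ge0.
have xE : x = s ^+ 8.
  rewrite (exprM s 2 4) -e4 (exprM _ 2 2) sqr_sqrtr ?sqrtr_ge0 //.
  by rewrite sqr_sqrtr //; lra.
have l8 : 1 + ln x <= 8 * s.
  rewrite {1}xE lnXn // -mulr_natl; have := @ln_le_sub1 s s0; lra.
have l0 : 0 <= ln x by exact: ln_ge0.
rewrite /pow34 [leRHS]mulrCA ler_wpM2l ?sqrtr_ge0 // e4.
have -> : 64 * s ^+ 2 = (8 * s) ^+ 2 by ring.
by rewrite ler_pXn2r ?nnegrE //; lra.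
Qed.

(** The leading constant 1/2 has to be exact: it cancels the factor 2 in the logarithmic average of
    the error, so that any saving in the average becomes a saving in the bound. *)
Lemma sum_ln_over_n_le x : 1 <= x ->
  sumto x (fun n => ln n%:R / n%:R) <= ln x ^+ 2 / 2 + 1.
Proof.
move=> x1; have [n0 nx _ _] := natr_truncn x1; set N := Num.truncn x in n0 nx *.
have N0 : (0 : R) < N%:R by rewrite ltr0n.
have N1 : (1 : R) <= N%:R by rewrite ler1n.
have lN : ln N%:R <= ln x by rewrite ler_ln ?posrE //; lra.
have lN0 : 0 <= ln N%:R :> R by rewrite ln_ge0.
rewrite /sumto -/N big_ltn // ln1 mul0r add0r.
(* The increments of ln^2 / 2 produce the mean of two consecutive logarithms; the term -1/(n - 1)
   makes up for replacing that mean by the larger of the two. *)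
pose F (n : nat) : R := ln n.-1%:R ^+ 2 / 2 - n.-1%:R^-1.
have h : \sum_(2 <= n < N.+1) ln n%:R / n%:R <= F N.+1 - F 2%N.
  apply: sum_le_telescope => // n /andP[n2 _].
  rewrite /F; case: n n2 => [|[|n]] //= _.
  have u := @lnS_sub_ge n.+1 isT; have v := @lnS_sub_le n.+1 isT.
  set a : R := ln n.+1%:R in u v *; set b : R := ln n.+2%:R in u v *.
  have a0 : 0 <= a by rewrite ln_ge0 // ler1n.
  set p : R := n.+1%:R^-1 in u v *; set q : R := n.+2%:R^-1 in u v *.
  have pq : p - q = p * q.
    rewrite /p /q -(natr1 n.+1); have : (0 : R) < n.+1%:R by rewrite ltr0n.
    by move: (n.+1%:R : R) => t t0; field; rewrite !gt_eqF //; lra.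
  have p0 : 0 < p by rewrite invr_gt0 ltr0n.
  have q0 : 0 < q by rewrite invr_gt0 ltr0n.
  have w1 : (b - a - q) * (a + b) >= 0 by rewrite mulr_ge0 //; lra.
  have w2 : q * (b - a) <= q * p by rewrite ler_pM2l.
  nra.
apply: le_trans h _; rewrite /F /= ln1 expr0n /= mul0r sub0r opprK invr1.
have i0 : 0 < (N%:R^-1 : R) by rewrite invr_gt0.
have : ln N%:R ^+ 2 <= ln x ^+ 2 by rewrite ler_pXn2r ?nnegrE // ln_ge0.
lra.
Qed.

(* The limit is found as the supremum of the lower bounds [u m - e m]. *)
Lemma cauchy_rate (u e : nat -> R) :
  (forall m n, (0 < m <= n)%N -> `|u n - u m| <= e m) ->
  exists l, forall m, (0 < m)%N -> `|u m - l| <= e m.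
Proof.
move=> h; have e0 m : (0 < m)%N -> 0 <= e m.
  by move=> m0; apply: le_trans (h m m _); rewrite ?m0 ?leqnn.
have cmp m n : (0 < m)%N -> (0 < n)%N -> u m - e m <= u n + e n.
  move=> m0 n0; have [mn|nm] := leqP m n.
    by have := h m n; rewrite m0 mn => /(_ isT); rewrite ler_norml; have := e0 n n0; lra.
  have := h n m; rewrite n0 (ltnW nm) => /(_ isT); rewrite ler_norml.
  have := e0 m m0; lra.
pose A := [set u m - e m | m in [set m | (0 < m)%N]].
have A0 : A !=set0 by exists (u 1%N - e 1%N); exists 1%N.
have ubA n : (0 < n)%N -> ubound A (u n + e n) by move=> n0 _ [m m0 <-]; exact: cmp.
have hs : has_sup A by split => //; exists (u 1%N + e 1%N); apply: ubA.
exists (sup A) => m m0.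
have h1 : u m - e m <= sup A by apply: sup_upper_bound => //; exists m.
have h2 : sup A <= u m + e m by apply: ge_sup => //; apply: ubA.
rewrite ler_norml; lra.
Qed.

End ElementarySums.

(** * Dirichlet convolution *)

Section DirichletConvolution.
Context {R : realType}.
Implicit Types (f g h : nat -> R) (x : R).

Definition dconv f g (n : nat) : R := \sum_(d <- divisors n) f d * g (n %/ d)%N.

Lemma sumto_dconv x f g :
  sumto x (dconv f g) = sumto x (fun n => f n * sumto (x / n%:R) g).
Proof.
under [RHS]eq_sumto => n n0 nx do rewrite -sumtoZ.
by rewrite sumto_sumto.
Qed.

(** Sending F to the function x -> sum of g(m) F(x / m) is an action of the convolution algebra. *)
Lemma sumto_dconv_scaled x f g (F : R -> R) :
  sumto x (fun n => f n * sumto (x / n%:R) (fun m => g m * F (x / n%:R / m%:R))) =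
  sumto x (fun k => dconv f g k * F (x / k%:R)).
Proof.
under [LHS]eq_sumto => n n0 nx do rewrite -sumtoZ.
rewrite sumto_sumto; apply: eq_sumto => k k0 _; rewrite /dconv mulr_suml.
rewrite !big_seq; apply: eq_bigr => d; rewrite -dvdn_divisors // => dk.
rewrite mulrA -[in x / _ / _]mulrA -invfM -natrM mulnC divnK //.
Qed.

Lemma sumto_inj f g : (forall x, sumto x f = sumto x g) ->
  forall n, (0 < n)%N -> f n = g n.
Proof.
move=> h [|n] // _; have := h n.+1%:R; have := h n%:R.
rewrite !sumto_nat !(big_nat_recr n.+1) //= => ->; exact: addrI.
Qed.

(** Compared through partial sums, where associativity is an exchange of summations; [sumto_inj]
    recovers the values. *)
Lemma dconvA f g h n : (0 < n)%N -> dconv (dconv f g) h n = dconv f (dconv g h) n.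
Proof.
apply: sumto_inj => x; rewrite !sumto_dconv.
rewrite -(sumto_dconv_scaled x f g (fun y => sumto y h)).
by apply: eq_sumto => m m0 _; rewrite sumto_dconv.
Qed.

Lemma divn_divn_dvd d n : (0 < n)%N -> (d %| n)%N -> (n %/ (n %/ d))%N = d.
Proof. by move=> n0 dn; rewrite divnA // mulKn. Qed.

Lemma perm_divisors n : (0 < n)%N ->
  perm_eq (divisors n) [seq (n %/ d)%N | d <- divisors n].
Proof.
move=> n0; apply: uniq_perm; first exact: divisors_uniq.
  rewrite map_inj_in_uniq ?divisors_uniq // => d e; rewrite -!dvdn_divisors // => dn en E.
  by rewrite -(divn_divn_dvd n0 dn) E divn_divn_dvd.
move=> d; apply/idP/mapP => [|[e]]; rewrite -!dvdn_divisors //.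
  by move=> dn; exists (n %/ d)%N; rewrite -?dvdn_divisors ?dvdn_div // divn_divn_dvd.
by move=> en ->; rewrite dvdn_div.
Qed.

Lemma dconvC f g n : (0 < n)%N -> dconv f g n = dconv g f n.
Proof.
move=> n0; rewrite /dconv (perm_big _ (perm_divisors n0)) big_map !big_seq.
apply: eq_bigr => d; rewrite -dvdn_divisors // => dn.
by rewrite mulrC divn_divn_dvd.
Qed.

Lemma eq_dconv f f' g g' n : (0 < n)%N ->
  (forall d, (0 < d)%N -> f d = f' d) -> (forall d, (0 < d)%N -> g d = g' d) ->
  dconv f g n = dconv f' g' n.
Proof.
move=> n0 hf hg; rewrite /dconv !big_seq; apply: eq_bigr => d.
rewrite -dvdn_divisors // => dn; have d0 := dvdn_gt0 n0 dn.
by rewrite hf // hg // divn_gt0 // dvdn_leq.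
Qed.

Definition delta1 (n : nat) : R := (n == 1%N)%:R.

Lemma sumto_delta1 x (F : nat -> R) : 1 <= x -> sumto x (fun n => delta1 n * F n) = F 1%N.
Proof.
move=> x1; have [n0 _ _ _] := natr_truncn x1.
rewrite /sumto big_ltn // big_nat big1 ?addr0 ?mul1r // => n /andP[n2 _].
by rewrite /delta1 (_ : (n == 1%N) = false) ?mul0r //; lia.
Qed.

Lemma dconv_delta1 g n : (0 < n)%N -> dconv delta1 g n = g n.
Proof.
move=> n0; rewrite /dconv (@sumto_divisors _ n) ?n0 ?leqnn // big_ltn_cond //.
rewrite dvd1n /delta1 eqxx mul1r divn1 big_nat_cond big1 ?addr0 // => d /andP[/andP[d2 _] _].
by rewrite (_ : (d == 1%N) = false) ?mul0r //; lia.
Qed.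

Lemma sum_divisors_coprime (G : nat -> R) m n : (0 < m)%N -> (0 < n)%N -> coprime m n ->
  \sum_(d <- divisors (m * n)) G d =
  \sum_(d <- divisors m) \sum_(e <- divisors n) G (d * e)%N.
Proof.
move=> m0 n0 mn; rewrite -big_allpairs_dep /=; apply: perm_big; apply: uniq_perm.
- exact: divisors_uniq.
- apply: allpairs_uniq; rewrite ?divisors_uniq //.
  move=> [d e] [d' e'] /allpairsP[[a b]] /= [da eb [-> ->]] /allpairsP[[a' b']] /= [da' eb' [-> ->]] E.
  move: da eb da' eb'; rewrite -!dvdn_divisors // => da eb da' eb'.
  have gm u v : (u %| m)%N -> (v %| n)%N -> gcdn (u * v) m = u.
    move=> um vn; rewrite gcdnC Gauss_gcdl; first by apply/gcdn_idPr.
    exact: coprime_dvdr vn mn.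
  have aa : a = a' by rewrite -(gm a b) // E gm.
  move: E; rewrite aa => /eqP; rewrite eqn_pmul2l ?(dvdn_gt0 m0) //.
  by move/eqP ->.
move=> d; apply/idP/allpairsP => [|[[a b] /= []]]; rewrite -!dvdn_divisors ?muln_gt0 ?m0 //.
  move=> dmn; have d0 : (0 < d)%N by apply: dvdn_gt0 dmn; rewrite muln_gt0 m0.
  (* A divisor d of m n is the product of gcd(d, m) and d / gcd(d, m); the second factor is coprime
     to m / gcd(d, m), hence divides n. *)
  exists (gcdn d m, d %/ gcdn d m)%N; split => /=.
  - by rewrite -dvdn_divisors // dvdn_gcdr.
  - have g0 : (0 < gcdn d m)%N by rewrite gcdn_gt0 d0.
    rewrite -dvdn_divisors // -(@Gauss_dvdr _ (m %/ gcdn d m)).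
      rewrite -(@dvdn_pmul2l (gcdn d m)) // mulnA !(mulnC (gcdn d m)).
      by rewrite !divnK ?dvdn_gcdl ?dvdn_gcdr.
    rewrite /coprime -(@eqn_pmul2l (gcdn d m)) // muln_gcdr !(mulnC (gcdn d m)).
    by rewrite !divnK ?dvdn_gcdl ?dvdn_gcdr ?mul1n.
  - by rewrite mulnC divnK ?dvdn_gcdl.
by move=> am bn ->; rewrite dvdn_mul.
Qed.

Lemma sum_divisors_prime_power (G : nat -> R) p k : prime p ->
  \sum_(d <- divisors (p ^ k)) G d = \sum_(i < k.+1) G (p ^ i)%N.
Proof.
move=> pp; rewrite -(big_mkord xpredT (fun i => G (p ^ i)%N)) -(big_map (expn p) xpredT G).
apply: perm_big; apply: uniq_perm; first exact: divisors_uniq.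
  rewrite map_inj_uniq ?iota_uniq // => i j /eqP; rewrite eqn_exp2l ?prime_gt1 // => /eqP //.
have pk0 : (0 < p ^ k)%N by rewrite expn_gt0 prime_gt0.
move=> d; rewrite -dvdn_divisors //; apply/(dvdn_pfactor d k pp)/mapP => [[i ik ->]|[i]].
  by exists i; rewrite // mem_index_iota; lia.
by rewrite mem_index_iota => ik ->; exists i => //; lia.
Qed.

Definition multiplicative f := f 1%N = 1 /\
  forall m n, (0 < m)%N -> (0 < n)%N -> coprime m n -> f (m * n)%N = f m * f n.

(** Splits off the full power of the least prime factor. The last case serves multiplicative
    functions as well as functions such as [ideal_mangoldt], which vanish on these products. *)
Lemma coprime_ind (P : nat -> Prop) : P 1%N ->
  (forall p k, prime p -> (0 < k)%N -> P (p ^ k)%N) ->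
  (forall m n, (1 < m)%N -> (1 < n)%N -> coprime m n -> P m -> P n -> P (m * n)%N) ->
  forall n, (0 < n)%N -> P n.
Proof.
move=> P1 Pp Pm; apply: ltn_ind => n IH n0.
have [->//|n1] : n = 1%N \/ (1 < n)%N by lia.
have pp := pdiv_prime n1; set p := pdiv n in pp.
have k0 : (0 < logn p n)%N by rewrite logn_gt0 mem_primes pp n0 pdiv_dvd.
have [m pm nE] := pfactor_coprime pp n0.
have m0 : (0 < m)%N by move: n0; rewrite nE muln_gt0 => /andP[].
have pk1 : (1 < p ^ logn p n)%N by rewrite -(expn0 p) ltn_exp2l ?prime_gt1.
have [m1|m1] : m = 1%N \/ (1 < m)%N by lia.
  by rewrite nE m1 mul1n; apply: Pp.
rewrite nE; apply: Pm => //; first by rewrite coprime_sym coprimeXl.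
  by apply: IH => //; rewrite [ltnRHS]nE -[ltnLHS]muln1 ltn_pmul2l.
exact: Pp.
Qed.

Lemma dconv_multiplicative f g : multiplicative f -> multiplicative g ->
  multiplicative (dconv f g).
Proof.
move=> [f1 fM] [g1 gM]; split; first by rewrite /dconv big_seq1 divn1 f1 g1 mulr1.
move=> m n m0 n0 mn; rewrite /dconv sum_divisors_coprime // mulr_suml.
rewrite big_seq [RHS]big_seq; apply: eq_bigr => d; rewrite -dvdn_divisors // => dm.
rewrite mulr_sumr big_seq [RHS]big_seq; apply: eq_bigr => e; rewrite -dvdn_divisors // => en.
have d0 := dvdn_gt0 m0 dm; have e0 := dvdn_gt0 n0 en.
have md0 : (0 < m %/ d)%N by rewrite divn_gt0 // dvdn_leq.
have ne0 : (0 < n %/ e)%N by rewrite divn_gt0 // dvdn_leq.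
rewrite fM //; last by apply: (coprime_dvdl dm); apply: (coprime_dvdr en).
have -> : (m * n %/ (d * e) = (m %/ d) * (n %/ e))%N.
  by rewrite -{1}(divnK dm) -{1}(divnK en) mulnACA mulnK // muln_gt0 d0.
rewrite gM //; last first.
  by apply: (coprime_dvdl (dvdn_div dm)); apply: (coprime_dvdr (dvdn_div en)).
by rewrite mulrACA.
Qed.

Lemma multiplicative_eq f g : multiplicative f -> multiplicative g ->
  (forall p k, prime p -> (0 < k)%N -> f (p ^ k)%N = g (p ^ k)%N) ->
  forall n, (0 < n)%N -> f n = g n.
Proof.
move=> [f1 fM] [g1 gM] h; apply: coprime_ind; rewrite ?f1 ?g1 // => m n m1 n1 mn hm hn.
by rewrite fM ?gM ?hm ?hn //; lia.
Qed.

Lemma multiplicative_le f g : multiplicative f -> multiplicative g ->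
  (forall p k, prime p -> (0 < k)%N -> `|f (p ^ k)%N| <= g (p ^ k)%N) ->
  forall n, (0 < n)%N -> `|f n| <= g n.
Proof.
move=> [f1 fM] [g1 gM] h; apply: coprime_ind; rewrite ?f1 ?g1 ?normr1 // => m n m1 n1 mn hm hn.
by rewrite fM ?gM ?normrM ?ler_pM //; lia.
Qed.

(** The multiplicative function with prescribed value [B p k] at p^k; it lets an Euler factor serve
    as a definition. *)
Definition eulerprod (B : nat -> nat -> R) (n : nat) : R :=
  \prod_(p <- primes n) B p (logn p n).

Lemma eulerprod_multiplicative B : multiplicative (eulerprod B).
Proof.
split=> [|m n m0 n0 mn]; first by rewrite /eulerprod big_nil.
have E : perm_eq (primes (m * n)) (primes m ++ primes n).
  apply: uniq_perm; rewrite ?primes_uniq //.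
    by rewrite cat_uniq !primes_uniq -coprime_has_primes // mn.
  by move=> p; rewrite mem_cat primesM.
rewrite /eulerprod (perm_big _ E) big_cat /= !big_seq; congr (_ * _).
  apply: eq_bigr => p; rewrite mem_primes => /and3P[pp _ pm].
  by rewrite lognM // (@logn_coprime p n) ?addn0 // (coprime_dvdl pm).
apply: eq_bigr => p; rewrite mem_primes => /and3P[pp _ pm].
by rewrite lognM // (@logn_coprime p m) // (coprime_dvdl pm) // coprime_sym.
Qed.

Lemma eulerprod_prime_power B p k : prime p -> (0 < k)%N -> eulerprod B (p ^ k)%N = B p k.
Proof.
move=> pp k0; rewrite /eulerprod primesX // primes_prime // big_seq1.
by rewrite pfactorK.
Qed.

(* [g |-> g * ln] is a derivation for [dconv], so the derivation cancels on a
   product of two coprime factors larger than 1. *)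
Lemma dconv_mul_ln_coprime f g m n : multiplicative f -> multiplicative g ->
  (forall k, (0 < k)%N -> dconv f g k = delta1 k) ->
  (1 < m)%N -> (1 < n)%N -> coprime m n ->
  dconv f (fun k => g k * ln k%:R) (m * n)%N = 0.
Proof.
move=> fmul gmul fg m1 n1 mn; have m0 : (0 < m)%N by lia.
have n0 : (0 < n)%N by lia.
have [f1 fM] := fmul; have [g1 gM] := gmul.
have d1 k : (1 < k)%N -> delta1 k = 0.
  by move=> k1; rewrite /delta1 (_ : (k == 1%N) = false) //; lia.
transitivity (dconv f (fun k => g k * ln k%:R) m * dconv f g n +
              dconv f g m * dconv f (fun k => g k * ln k%:R) n); last first.
  by rewrite !fg // !d1 // mulr0 mul0r addr0.
rewrite /dconv sum_divisors_coprime // !mulr_suml -big_split /=.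
rewrite big_seq [RHS]big_seq; apply: eq_bigr => d; rewrite -dvdn_divisors // => dm.
rewrite !mulr_sumr -big_split /=.
rewrite big_seq [RHS]big_seq; apply: eq_bigr => e; rewrite -dvdn_divisors // => en.
have d0 := dvdn_gt0 m0 dm; have e0 := dvdn_gt0 n0 en.
have md0 : (0 < m %/ d)%N by rewrite divn_gt0 // dvdn_leq.
have ne0 : (0 < n %/ e)%N by rewrite divn_gt0 // dvdn_leq.
rewrite fM //; last by apply: (coprime_dvdl dm); apply: (coprime_dvdr en).
have -> : (m * n %/ (d * e) = (m %/ d) * (n %/ e))%N.
  by rewrite -{1}(divnK dm) -{1}(divnK en) mulnACA mulnK // muln_gt0 d0.
rewrite gM //; last first.
  by apply: (coprime_dvdl (dvdn_div dm)); apply: (coprime_dvdr (dvdn_div en)).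
by rewrite natrM lnM ?posrE ?ltr0n //; ring.
Qed.

End DirichletConvolution.

(** * The quadratic character of discriminant -8 *)

(** The Kronecker symbol (-8 / n), given as an integer table so that statements about residues
    modulo 8 are settled by computation. *)
Definition chi8 (n : nat) : int := nth 0 [:: 0; 1; 0; 1; 0; -1; 0; -1] (n %% 8).

Lemma chi8M m n : chi8 (m * n) = chi8 m * chi8 n.
Proof.
have chk : all (fun a => all (fun b => chi8 (a * b) == chi8 a * chi8 b) (iota 0 8)) (iota 0 8).
  by [].
have mi a : (a %% 8)%N \in iota 0 8 by rewrite mem_iota ltn_mod.
have E a : chi8 (a %% 8) = chi8 a by rewrite /chi8 modn_mod.
rewrite -(E m) -(E n) -(eqP (allP (allP chk _ (mi m)) _ (mi n))).
by rewrite /chi8 modnMm.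
Qed.

Lemma chi8_cases n : [\/ chi8 n = 0, chi8 n = 1 | chi8 n = -1].
Proof.
have chk : all (fun a => [|| chi8 a == 0, chi8 a == 1 | chi8 a == -1]) (iota 0 8) by [].
have mi : (n %% 8)%N \in iota 0 8 by rewrite mem_iota ltn_mod.
have := allP chk _ mi; rewrite /chi8 modn_mod.
by case/or3P => /eqP ->; [constructor 1|constructor 2|constructor 3].
Qed.

Lemma chi8_partial_sum N :
  \sum_(1 <= n < N.+1) chi8 n = nth 0 [:: 0; 1; 1; 2; 2; 1; 1; 0] (N %% 8).
Proof.
elim: N => [|N IH]; first by rewrite big_geq.
rewrite big_nat_recr //= IH.
have chk : all (fun a => nth 0 [:: 0; 1; 1; 2; 2; 1; 1; 0] a + chi8 a.+1 ==
  nth 0 [:: 0; 1; 1; 2; 2; 1; 1; 0] (a.+1 %% 8)%N :> int) (iota 0 8) by [].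
have mi : (N %% 8)%N \in iota 0 8 by rewrite mem_iota ltn_mod.
have E : (N.+1 %% 8 = (N %% 8).+1 %% 8)%N by rewrite -[N.+1]addn1 -[(N %% 8).+1]addn1 modnDml.
by rewrite E -(eqP (allP chk _ mi)) /chi8 E.
Qed.

Section QuadraticCharacter.
Context {R : realType}.
Implicit Types x : R.

Definition chi (n : nat) : R := (chi8 n)%:~R.

Lemma chiM m n : chi (m * n) = chi m * chi n.
Proof. by rewrite /chi chi8M intrM. Qed.

Lemma chiX p k : chi (p ^ k) = chi p ^+ k.
Proof. by elim: k => // k IH; rewrite expnS chiM IH exprS. Qed.

Lemma chi_cases n : [\/ chi n = 0, chi n = 1 | chi n = -1].
Proof.
by rewrite /chi; case: (chi8_cases n) => ->; [constructor 1|constructor 2|constructor 3].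
Qed.

Lemma chi_norm_le1 n : `|chi n| <= 1.
Proof. by case: (chi_cases n) => ->; rewrite ?normrN ?normr0 ?normr1. Qed.

Lemma chi_partial_sum N : `|\sum_(1 <= n < N.+1) chi n| <= 2.
Proof.
rewrite /chi -rmorph_sum /= chi8_partial_sum.
have chk : all (fun a => `|nth 0 [:: 0; 1; 1; 2; 2; 1; 1; 0] a| <= 2 :> int) (iota 0 8) by [].
have mi : (N %% 8)%N \in iota 0 8 by rewrite mem_iota ltn_mod.
by have /= := allP chk _ mi; rewrite -(ler_int R) intr_norm.
Qed.

(** * Ideal counts, their Dirichlet inverse and the von Mangoldt weight *)

Definition ideal_count : nat -> R := dconv chi (fun=> 1).

(** Coefficients of the inverse Euler factor (1 - X) (1 - chi(p) X) = 1 - (1 + chi(p)) X + chi(p)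
    X^2. *)
Definition ideal_mobius : nat -> R :=
  eulerprod (fun p k => if k == 1%N then - (1 + chi p) else if k == 2%N then chi p else 0).

Definition ideal_mangoldt : nat -> R := dconv ideal_mobius (fun n => ideal_count n * ln n%:R).

Local Notation r := ideal_count.
Local Notation b := ideal_mobius.
Local Notation Lam := ideal_mangoldt.

Definition geom (c : R) k : R := \sum_(i < k.+1) c ^+ i.

Lemma geomS c k : geom c k.+1 = 1 + c * geom c k.
Proof.
rewrite /geom big_ord_recl expr0 mulr_sumr; congr (_ + _).
by apply: eq_bigr => i _; rewrite exprS.
Qed.

Lemma geomSr c k : geom c k.+1 = geom c k + c ^+ k.+1.
Proof. by rewrite /geom big_ord_recr. Qed.

Lemma geom_ge0 c k : [\/ c = 0, c = 1 | c = -1] -> 0 <= geom c k.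
Proof.
case=> ->.
- by apply: sumr_ge0 => i _; rewrite exprn_ge0.
- by apply: sumr_ge0 => i _; rewrite exprn_ge0.
(* For c = -1 the sums alternate between 1 and 0; the upper bound keeps the recursion g -> 1 - g
   nonnegative. *)
suff /andP[] : 0 <= geom (-1) k <= 1 by [].
elim: k => [|k /andP[h1 h2]]; first by rewrite /geom big_ord1 expr0 ler01 lexx.
rewrite geomS; apply/andP; split; lra.
Qed.

Lemma ideal_count_multiplicative : multiplicative r.
Proof.
apply: dconv_multiplicative; split=> [|m n _ _ _]; rewrite ?mulr1 ?chiM //.
Qed.

Lemma ideal_count_prime_power p k : prime p -> r (p ^ k)%N = geom (chi p) k.
Proof.
move=> pp; rewrite /r /dconv sum_divisors_prime_power //.
by apply: eq_bigr => i _; rewrite chiX mulr1.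
Qed.

Lemma ideal_mobius_multiplicative : multiplicative b.
Proof. exact: eulerprod_multiplicative. Qed.

Lemma ideal_mobius_prime_power p k : prime p -> (0 < k)%N ->
  b (p ^ k)%N = if k == 1%N then - (1 + chi p) else if k == 2%N then chi p else 0.
Proof. by move=> pp k0; rewrite /b eulerprod_prime_power. Qed.

Lemma dconv_ideal_mobius_prime_power (G : nat -> R) p k : prime p ->
  dconv b G (p ^ k.+2)%N =
  G (p ^ k.+2)%N - (1 + chi p) * G (p ^ k.+1)%N + chi p * G (p ^ k)%N.
Proof.
move=> pp; have [b1 _] := ideal_mobius_multiplicative.
have E i : (i <= k.+2)%N -> (p ^ k.+2 %/ p ^ i = p ^ (k.+2 - i))%N.
  by move=> ik; rewrite expnB ?prime_gt0.
rewrite /dconv sum_divisors_prime_power // !big_ord_recl big1 /=; last first.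
  move=> i _; rewrite ideal_mobius_prime_power //= mul0r //.
rewrite !E // /bump /= !addn0 expn0 b1 !ideal_mobius_prime_power //= mul1r.
by rewrite subn0 subn1 subn2 /= addr0; ring.
Qed.

Lemma dconv_ideal_mobius_prime (G : nat -> R) p : prime p ->
  dconv b G p = G p - (1 + chi p) * G 1%N.
Proof.
move=> pp; have [b1 _] := ideal_mobius_multiplicative.
rewrite -{1}(expn1 p) /dconv sum_divisors_prime_power // !big_ord_recl big_ord0 /=.
rewrite /bump /= expn0 b1 addn0 ideal_mobius_prime_power //= !expn1 divn1 divnn prime_gt0 //=.
ring.
Qed.

Lemma dconv_mobius_count n : (0 < n)%N -> dconv b r n = delta1 n.
Proof.
apply: multiplicative_eq.
- exact: dconv_multiplicative ideal_mobius_multiplicative ideal_count_multiplicative.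
- split=> [//|m k m0 k0 _]; rewrite /delta1 muln_eq1.
  by case: eqP => _; case: eqP => _; rewrite ?mulr0 ?mulr1 ?mul0r.
move=> p k pp k0.
have -> : delta1 (p ^ k)%N = 0 :> R.
  by rewrite /delta1 -(expn0 p) eqn_exp2l ?prime_gt1 // eqn0Ngt k0.
case: k k0 => // -[|k] _.
  rewrite dconv_ideal_mobius_prime // -{1}(expn1 p) ideal_count_prime_power //.
  by rewrite (proj1 ideal_count_multiplicative) /geom !big_ord_recl big_ord0 /=; ring.
rewrite dconv_ideal_mobius_prime_power // !ideal_count_prime_power //.
have h1 := geomS (chi p) k.+1; have h2 := geomS (chi p) k.
rewrite h1 h2; ring.
Qed.

(** On prime powers only p and p^2 matter: 1 + chi(p) is r(p), and |chi(p)| <= 1 + chi(p) +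
    chi(p)^2. Sums weighted by [b] are thereby controlled by averages of [r]. *)
Lemma norm_ideal_mobius_le n : (0 < n)%N -> `|b n| <= r n.
Proof.
apply: multiplicative_le.
- exact: ideal_mobius_multiplicative.
- exact: ideal_count_multiplicative.
move=> p k pp k0; rewrite ideal_mobius_prime_power // ideal_count_prime_power //.
case: k k0 => // -[|[|k]] _ /=; last by rewrite normr0 geom_ge0 //; exact: chi_cases.
- rewrite normrN /geom !big_ord_recl big_ord0 /= expr0 expr1 addr0.
  by case: (chi_cases p) => ->; rewrite ger0_norm //; lra.
- rewrite /geom !big_ord_recl big_ord0 /= expr0 expr1 addr0.
  by case: (chi_cases p) => ->; rewrite ?normrN ?normr1 ?normr0; lra.
Qed.

Lemma ideal_count_ge0 n : (0 < n)%N -> 0 <= r n.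
Proof. by move=> n0; apply: le_trans (norm_ideal_mobius_le n0). Qed.

Lemma mangoldt_prime_power p k : prime p -> (0 < k)%N ->
  Lam (p ^ k)%N = (1 + chi p ^+ k) * ln p%:R.
Proof.
move=> pp; have p0 : (0 : R) < p%:R by rewrite ltr0n prime_gt0.
case: k => // -[|k] _.
  rewrite expn1 expr1 /Lam dconv_ideal_mobius_prime // ln1.
  rewrite -[X in r X](expn1 p) ideal_count_prime_power //.
  by rewrite /geom !big_ord_recl big_ord0 /=; ring.
rewrite /Lam dconv_ideal_mobius_prime_power // !ideal_count_prime_power //.
rewrite !natrX !lnXn // -![ln _ *+ _]mulr_natl -(natr1 k.+1) -(natr1 k).
have h1 := geomS (chi p) k.+1; have h2 := geomS (chi p) k.
have h3 := geomSr (chi p) k; rewrite exprS -[chi p ^+ k.+1](addrK (geom (chi p) k)).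
rewrite [chi p ^+ k.+1 + _]addrC -h3 h1.
set l := ln _; set g := geom _ k in h2 h3 *; rewrite h2; ring.
Qed.

Lemma mangoldt_coprime m n : (1 < m)%N -> (1 < n)%N -> coprime m n -> Lam (m * n)%N = 0.
Proof.
apply: dconv_mul_ln_coprime; last exact: dconv_mobius_count.
- exact: ideal_mobius_multiplicative.
- exact: ideal_count_multiplicative.
Qed.

Lemma mangoldt1 : Lam 1%N = 0.
Proof. by rewrite /Lam /dconv big_seq1 divn1 ln1 !mulr0. Qed.

Lemma mangoldt_ge0 n : (0 < n)%N -> 0 <= Lam n.
Proof.
move: n; apply: coprime_ind; first by rewrite mangoldt1.
- move=> p k pp k0; rewrite mangoldt_prime_power // mulr_ge0 ?ln_ge0 ?ler1n ?prime_gt0 //.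
  have : `|chi p ^+ k| <= 1 by rewrite normrX exprn_ile1 ?chi_norm_le1.
  rewrite ler_norml; lra.
- by move=> m n m1 n1 mn _ _; rewrite mangoldt_coprime.
Qed.

Lemma dconv_mangoldt_count n : (0 < n)%N -> dconv Lam r n = r n * ln n%:R.
Proof.
move=> n0; rewrite dconvC // /Lam -dconvA // (@eq_dconv _ _ delta1 _ (fun n => r n * ln n%:R)) //.
  by rewrite dconv_delta1.
by move=> d d0; rewrite dconvC // dconv_mobius_count.
Qed.

(** Here c = L(1, chi). The sum over n is cut at sqrt x. Rounding x / n costs at most 1 for each
    smaller n, hence sqrt x; the larger n cost 4 sqrt x by the Dirichlet test, because the floor of
    x / n decreases in n; the tail of the series for c costs another 4 sqrt x. *)
Lemma ideal_count_sum : exists2 c : R, 0 < c &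
  forall x, 1 <= x -> `|sumto x r - c * x| <= 9 * Num.sqrt x.
Proof.
pose u m : R := \sum_(1 <= n < m.+1) chi n * n%:R^-1.
have ab (m N : nat) (f : nat -> R) : (forall n, (m < n)%N -> 0 <= f n) ->
   (forall n, (m < n)%N -> f n.+1 <= f n) -> `|\sum_(m.+1 <= n < N.+1) chi n * f n| <= 4 * f m.+1.
  move=> f0 fd; have := @abel_bound R 2 chi f m N chi_partial_sum f0 fd.
  by rewrite -natrM.
have [c hc] : exists c, forall m, (0 < m)%N -> `|u m - c| <= 4 * m.+1%:R^-1.
  apply: cauchy_rate => m n /andP[m0 mn].
  have -> : u n - u m = \sum_(m.+1 <= k < n.+1) chi k * k%:R^-1.
    by rewrite /u (@big_cat_nat _ _ _ m.+1 1 n.+1) //= [LHS]addrC addKr.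
  apply: (ab m n (fun k => k%:R^-1)) => k mk; first by rewrite invr_ge0.
  by rewrite lef_pV2 ?posrE ?ltr0n ?ler_nat //; lia.
exists c.
  (* At m = 8 the partial sum 1 + 1/3 - 1/5 - 1/7 exceeds the tail bound 4/9, which proves c > 0. *)
  have := hc 8%N isT; rewrite /u unlock /= /chi /chi8 /= !mulrNz !mulr0z !mulr1z.
  rewrite ler_norml; lra.
move=> x x1; have x0 : 0 <= x by lra.
rewrite sumto_dconv; set s := Num.sqrt x.
have s1 : 1 <= s by exact: sqrt_ge1.
have s2 : s * s = x by rewrite -expr2 sqr_sqrtr.
set Y := Num.truncn s; have [Y0 Ys Ys1 _] := natr_truncn s1; rewrite -/Y in Y0 Ys Ys1.
have YN : (Y <= Num.truncn x)%N by apply: le_truncn; nra.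
pose f n : R := sumto (x / n%:R) (fun=> 1).
have fE n : f n = (Num.truncn (x / n%:R))%:R by rewrite /f /sumto big_const_nat subn1 /= iter_addr_0.
have fx n : (0 < n)%N -> f n <= x / n%:R < f n + 1.
  by move=> n0; rewrite fE natr1 truncn_itv // divr_ge0.
rewrite /sumto (@big_cat_nat _ _ _ Y.+1) //=.
have t2 : `|\sum_(Y.+1 <= n < (Num.truncn x).+1) chi n * f n| <= 4 * s.
  apply: le_trans (ab Y _ f _ _) _.
  - by move=> n _; rewrite fE.
  - move=> n Yn; rewrite !fE ler_nat; apply: le_truncn.
    by rewrite ler_wpM2l // lef_pV2 ?posrE ?ltr0n ?ler_nat //; lia.
  rewrite ler_pM2l //; have /andP[h _] := fx Y.+1 isT; apply: le_trans h _.
  rewrite ler_pdivrMr ?ltr0n // -s2 ler_wpM2l -?natr1; lra.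
have t1 : `|\sum_(1 <= n < Y.+1) chi n * f n - x * u Y| <= s.
  rewrite /u mulr_sumr -sumrB; apply: le_trans (ler_norm_sum _ _ _) _.
  apply: le_trans (_ : \sum_(1 <= n < Y.+1) 1 <= s); last first.
    by rewrite big_const_nat subn1 /= iter_addr_0.
  rewrite !big_nat; apply: ler_sum => n /andP[n0 _].
  have -> : chi n * f n - x * (chi n * n%:R^-1) = chi n * (f n - x / n%:R) by ring.
  rewrite normrM mulr_ile1 ?chi_norm_le1 // ler_norml.
  by have := fx n n0; lra.
have t3 : `|x * u Y - x * c| <= 4 * s.
  rewrite -mulrBr normrM ger0_norm //; have := hc Y Y0 => h.
  apply: le_trans (ler_wpM2l x0 h) _; rewrite mulrCA ler_pM2l // ler_pdivrMr ?ltr0n // -s2.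
  by rewrite ler_wpM2l -?natr1; lra.
move: t1 t2 t3; rewrite !ler_norml; set A := \sum_(1 <= n < Y.+1) chi n * f n.
set B := \sum_(Y.+1 <= n < _) chi n * f n.
lra.
Qed.

End QuadraticCharacter.

(** * The Selberg symmetry formula *)

Section SelbergFormula.
Context {R : realType}.
Implicit Types x y : R.
Context (r b Lam : nat -> R) (c C0 : R).
Context (r1 : r 1%N = 1) (r_ge0 : forall n, (0 < n)%N -> 0 <= r n)
  (b_le : forall n, (0 < n)%N -> `|b n| <= r n)
  (conv_br : forall n, (0 < n)%N -> dconv b r n = delta1 n)
  (conv_brln : forall n, (0 < n)%N -> dconv b (fun k => r k * ln k%:R) n = Lam n)
  (Lam_ge0 : forall n, (0 < n)%N -> 0 <= Lam n)
  (conv_Lamr : forall n, (0 < n)%N -> dconv Lam r n = r n * ln n%:R)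
  (c_gt0 : 0 < c) (C0_ge0 : 0 <= C0)
  (sum_r : forall x, 1 <= x -> `|sumto x r - c * x| <= C0 * Num.sqrt x).

Lemma sqrt_le_self x : 1 <= x -> Num.sqrt x <= x.
Proof.
move=> x1; have s1 := sqrt_ge1 x1; have x0 : 0 <= x by lra.
have := sqr_sqrtr x0; nra.
Qed.

Lemma log_le_sqrt x : 1 <= x -> 1 + ln x <= 2 * Num.sqrt x.
Proof.
move=> x1; have s1 := sqrt_ge1 x1; have x0 : 0 <= x by lra.
rewrite -{1}(sqr_sqrtr x0) lnXn; last by lra.
rewrite -mulr_natl; have := @ln_le_sub1 _ (Num.sqrt x); lra.
Qed.

Lemma sum_r_le x : 1 <= x -> sumto x r <= (c + C0) * x.
Proof.
move=> x1; have := sum_r x1; have := ler_wpM2l C0_ge0 (sqrt_le_self x1).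
rewrite ler_norml; lra.
Qed.

(** Beyond [Y] one has sqrt x >= 2 C0 / c, so the error is at most half the main term; up to [Y] the
    single term r(1) = 1 suffices. *)
Lemma sum_r_ge : exists2 k : R, 0 < k & forall x, 1 <= x -> k * x <= sumto x r.
Proof.
pose Y := (2 * C0 / c) ^+ 2 + 1.
have Y1 : 1 <= Y by rewrite lerDr sqr_ge0.
exists (Num.min (c / 2) Y^-1); first by rewrite lt_min divr_gt0 // invr_gt0; lra.
move=> x x1; have [n0 _ _ _] := natr_truncn x1.
have N1 : 1 <= sumto x r.
  rewrite /sumto big_ltn // r1 lerDl big_nat; apply: sumr_ge0 => n /andP[n2 _].
  by apply: r_ge0; lia.
have [xY|Yx] := leP x Y.
  apply: le_trans N1; apply: le_trans (_ : Y^-1 * x <= 1).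
    by rewrite ler_wpM2r ?ge_min ?lexx ?orbT //; lra.
  rewrite mulrC ler_pdivrMr; lra.
apply: le_trans (_ : c / 2 * x <= _).
  by rewrite ler_wpM2r ?ge_min ?lexx //; lra.
have := sum_r x1; have x0 : 0 <= x by lra.
have s0 := sqrtr_ge0 x; have s2 := sqr_sqrtr x0.
have : 2 * C0 / c <= Num.sqrt x.
  rewrite -(@ler_pXn2r _ 2) ?nnegrE // ?s2; first by move: Yx; rewrite /Y; lra.
  by rewrite divr_ge0 ?mulr_ge0 // ltW.
rewrite ler_pdivrMr // => h; rewrite ler_norml => /andP[+ _].
have : C0 * Num.sqrt x <= c / 2 * x by rewrite -[X in _ <= _ * X]s2; have := ler_wpM2r s0 h; lra.
lra.
Qed.

Lemma abs_partial_sum_r n : `|\sum_(1 <= k < n.+1) (r k - c)| <= C0 * Num.sqrt n%:R.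
Proof.
case: n => [|n]; first by rewrite big_geq // normr0 mulr_ge0 ?sqrtr_ge0.
have := @sum_r n.+1%:R; rewrite sumto_nat ler1n => /(_ isT).
by rewrite sumrB big_const_nat subn1 iter_addr_0 mulr_natr.
Qed.

Lemma sqrt_inv_mul (t : R) : 0 < t -> Num.sqrt t / t = (Num.sqrt t)^-1.
Proof.
move=> t0; rewrite -[X in _ / X](sqr_sqrtr (ltW t0)) expr2 invfM mulrA mulfV ?mul1r //.
by rewrite gt_eqF // sqrtr_gt0.
Qed.

Lemma sum_ln_div x : 1 <= x -> `|sumto x (fun n => ln (x / n%:R)) - x| <= 4 * Num.sqrt x.
Proof.
move=> x1; have [n0 nx nx1 _] := natr_truncn x1.
have h := sum_ln_itv x1; have l := log_le_sqrt x1.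
rewrite (@eq_sumto _ _ _ (fun n => ln x - ln n%:R)); last first.
  by move=> n n1 _; rewrite ln_div ?posrE ?ltr0n //; lra.
rewrite sumtoB {1}/sumto big_const_nat subn1 /= iter_addr_0 -mulr_natl.
have l0 := ln_ge0 x1.
have d3 : (x - (Num.truncn x)%:R) * ln x <= ln x by rewrite ler_piMl //; lra.
have d4 : 0 <= (x - (Num.truncn x)%:R) * ln x by rewrite mulr_ge0 //; lra.
rewrite ler_norml; move: h => /andP[h1 h2]; apply/andP; split; lra.
Qed.

(** Write r = c + (r - c). The constant part is a sum of ln(x / n); the rest is summed by parts,
    with logarithmic increments at most 1/n and partial sums at most C0 sqrt n. *)
Lemma sum_r_ln_div : exists2 K : R, 0 <= K &
  forall x, 1 <= x -> `|sumto x (fun n => r n * ln (x / n%:R)) - c * x| <= K * Num.sqrt x.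
Proof.
exists (4 * c + 3 * C0); first by have := ltW c_gt0; have := C0_ge0; lra.
move=> x x1; have [n0 nx nx1 nx2] := natr_truncn x1; set N := Num.truncn x in n0 nx nx1 nx2 *.
have x0 : 0 < x by lra.
have N0 : (0 : R) < N%:R by rewrite ltr0n.
have s1 := sqrt_ge1 x1; have sN : Num.sqrt N%:R <= Num.sqrt x by rewrite ler_wsqrtr.
have e1 : sumto x (fun n => r n * ln (x / n%:R)) = c * sumto x (fun n => ln (x / n%:R)) +
   \sum_(1 <= n < N.+1) (r n - c) * ln (x / n%:R).
  by rewrite -sumtoZ -sumtoD; apply: eq_bigr => n _; ring.
have h1 : `|c * sumto x (fun n => ln (x / n%:R)) - c * x| <= 4 * c * Num.sqrt x.
  rewrite -mulrBr normrM (gtr0_norm c_gt0) (mulrC 4) -mulrA ler_pM2l //.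
  exact: sum_ln_div.
have h2 : `|\sum_(1 <= n < N.+1) (r n - c) * ln (x / n%:R)| <= 3 * C0 * Num.sqrt x.
  rewrite abel_sum; apply: le_trans (ler_normD _ _) _.
  have a1 : `|(\sum_(1 <= k < N.+1) (r k - c)) * ln (x / N.+1%:R)| <= C0 * Num.sqrt x.
    rewrite normrM -[leRHS]mulr1 ler_pM //.
      by apply: le_trans (abs_partial_sum_r N) _; rewrite ler_wpM2l.
    rewrite ln_div ?posrE // -natr1; set t := N%:R + 1.
    have t0 : 0 < t by rewrite /t; lra.
    have u1 := ln_sub_le x0 t0; have u2 : (t - x) / x <= 1 by rewrite ler_pdivrMr // /t; lra.
    have u3 : ln x <= ln t by rewrite ler_ln ?posrE // /t; lra.
    rewrite ler_norml; lra.
  have a2 : `|\sum_(1 <= n < N.+1) (\sum_(1 <= k < n.+1) (r k - c)) *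
       (ln (x / n%:R) - ln (x / n.+1%:R))| <= 2 * C0 * Num.sqrt x.
    apply: le_trans (ler_norm_sum _ _ _) _.
    apply: le_trans (_ : C0 * \sum_(1 <= n < N.+1) (Num.sqrt n%:R)^-1 <= _); last first.
      rewrite (mulrC 2) -mulrA ler_wpM2l //; apply: le_trans (sum_inv_sqrt_le N) _.
      by rewrite ler_pM2l.
    rewrite mulr_sumr !big_nat; apply: ler_sum => n /andP[n1 _].
    have n0' : (0 : R) < n%:R by rewrite ltr0n.
    rewrite -(sqrt_inv_mul n0') mulrA normrM ler_pM // ?abs_partial_sum_r //.
    rewrite !ln_div ?posrE ?ltr0n //.
    have := @lnS_sub_le R n n1; have := @lnS_sub_ge R n n1.
    have : 0 < (n.+1%:R^-1 : R) by rewrite invr_gt0 ltr0n.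
    move: (ln x) (ln n%:R) (ln n.+1%:R) (n%:R^-1) (n.+1%:R^-1) => lx l1 l2 i1 i2.
    rewrite ler_norml; lra.
  lra.
rewrite e1; move: h1 h2; rewrite !ler_norml; lra.
Qed.

Lemma sum_r_inv : exists c1 : R, exists2 K : R, 0 <= K &
  forall x, 1 <= x ->
  `|sumto x (fun n => r n / n%:R) - c * ln x - c1| <= K / Num.sqrt x.
Proof.
pose u N := \sum_(1 <= n < N.+1) r n / n%:R - c * ln N%:R.
pose K := 4 * C0 + c.
have K0 : 0 <= K by rewrite /K; have := ltW c_gt0; have := C0_ge0; lra.
have [c1 hc1] : exists l, forall m, (0 < m)%N -> `|u m - l| <= K / Num.sqrt m%:R.
  apply: cauchy_rate => m n /andP[m0 mn].
  have n0 : (0 < n)%N by lia.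
  have m0' : (0 : R) < m%:R by rewrite ltr0n.
  have n0' : (0 : R) < n%:R by rewrite ltr0n.
  have sm : 1 <= Num.sqrt m%:R :> R by rewrite sqrt_ge1 // ler1n.
  have e1 : u n - u m = \sum_(m.+1 <= k < n.+1) (r k - c) * k%:R^-1 +
      c * (\sum_(m.+1 <= k < n.+1) k%:R^-1 - (ln n%:R - ln m%:R)).
    have -> : \sum_(m.+1 <= k < n.+1) (r k - c) * k%:R^-1 =
      \sum_(m.+1 <= k < n.+1) r k / k%:R - c * \sum_(m.+1 <= k < n.+1) k%:R^-1.
      by rewrite mulr_sumr -sumrB; apply: eq_bigr => k _; ring.
    rewrite /u (@big_cat_nat _ _ _ m.+1 1 n.+1) //=.
    set A := \sum_(1 <= _ < _) _; set B := \sum_(_ <= _ < _) _ / _.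
    set D := \sum_(_ <= _ < _) _^-1; ring.
  have h2 : `|c * (\sum_(m.+1 <= k < n.+1) k%:R^-1 - (ln n%:R - ln m%:R))| <= c / Num.sqrt m%:R.
    rewrite normrM (gtr0_norm c_gt0) ler_pM2l //.
    have up : \sum_(m.+1 <= k < n.+1) k%:R^-1 <= ln n.+1.-1%:R - ln m.+1.-1%:R :> R.
      apply: (@sum_le_telescope _ _ (fun k => ln k.-1%:R)) => // k /andP[mk _].
      by have := @lnS_sub_ge R k.-1; rewrite prednK; [apply|]; lia.
    have lo : ln n.+1%:R - ln m.+1%:R <= \sum_(m.+1 <= k < n.+1) k%:R^-1 :> R.
      apply: (@telescope_le_sum _ _ (fun k => ln k%:R)) => // k /andP[mk _].
      by apply: lnS_sub_le; lia.
    have l1 := @lnS_sub_le R m m0.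
    have l2 : ln n%:R <= ln n.+1%:R :> R by rewrite ler_ln ?posrE ?ltr0n // ler_nat.
    have l3 : m%:R^-1 <= (Num.sqrt m%:R)^-1 :> R.
      by rewrite lef_pV2 ?posrE //; [apply: sqrt_le_self; rewrite ler1n|lra].
    move: up lo => /=; rewrite ler_norml; lra.
  have h1 : `|\sum_(m.+1 <= k < n.+1) (r k - c) * k%:R^-1| <= 4 * C0 / Num.sqrt m%:R.
    rewrite abel_sum_itv //.
    have as1 k : (m <= k)%N -> `|(\sum_(1 <= i < k.+1) (r i - c)) * k.+1%:R^-1| <= C0 / Num.sqrt m%:R.
      move=> mk; have k0' : (0 : R) < k%:R by rewrite ltr0n; lia.
      rewrite normrM; apply: le_trans (_ : C0 * Num.sqrt k%:R * k%:R^-1 <= _).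
        rewrite ler_pM ?abs_partial_sum_r // ger0_norm ?invr_ge0 //.
        by rewrite lef_pV2 ?posrE // ler_nat.
      rewrite -mulrA sqrt_inv_mul // ler_wpM2l // lef_pV2 ?posrE ?sqrtr_gt0 //.
      by rewrite ler_wsqrtr // ler_nat.
    have as3 : `|\sum_(m.+1 <= k < n.+1) (\sum_(1 <= i < k.+1) (r i - c)) *
        (k%:R^-1 - k.+1%:R^-1)| <= 2 * C0 / Num.sqrt m%:R.
      apply: le_trans (ler_norm_sum _ _ _) _.
      (* sqrt k (1/k - 1/(k+1)) <= 2 (1/sqrt k - 1/sqrt(k+1)), so the increments of [G] dominate the
         terms, and they telescope. *)
      pose G k : R := - (2 * C0) / Num.sqrt k%:R.
      apply: le_trans (_ : G n.+1 - G m.+1 <= _); last first.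
        rewrite /G !mulNr opprK.
        have q1 : 0 <= 2 * C0 / Num.sqrt n.+1%:R by rewrite divr_ge0 ?mulr_ge0 ?sqrtr_ge0.
        have q2 : 2 * C0 / Num.sqrt m.+1%:R <= 2 * C0 / Num.sqrt m%:R.
          rewrite ler_wpM2l ?mulr_ge0 // lef_pV2 ?posrE ?sqrtr_gt0 ?ltr0n //.
          by rewrite ler_wsqrtr // ler_nat.
        lra.
      apply: sum_le_telescope => // k /andP[mk _].
      have k0' : (0 : R) < k%:R by rewrite ltr0n; lia.
      have kV : (k.+1%:R^-1 : R) <= k%:R^-1 by rewrite lef_pV2 ?posrE // ler_nat.
      rewrite normrM [X in _ * X]ger0_norm ?subr_ge0 //.
      apply: le_trans (ler_wpM2r _ (abs_partial_sum_r k)) _; first by rewrite subr_ge0.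
      have -> : G k.+1 - G k = C0 * (2 * ((Num.sqrt k%:R)^-1 - (Num.sqrt k.+1%:R)^-1)).
        by rewrite /G; ring.
      rewrite -mulrA ler_wpM2l //.
      set s := Num.sqrt k%:R; set t := Num.sqrt k.+1%:R.
      have s0 : 0 < s by rewrite sqrtr_gt0.
      have t0 : 0 < t by rewrite sqrtr_gt0.
      have s2 : s ^+ 2 = k%:R by rewrite sqr_sqrtr // ltW.
      have t2 : t ^+ 2 = k.+1%:R by rewrite sqr_sqrtr.
      have st : t ^+ 2 = s ^+ 2 + 1 by rewrite s2 t2 natr1.
      rewrite -s2 -t2.
      have -> : s * ((s ^+ 2)^-1 - (t ^+ 2)^-1) = s^-1 * (t ^+ 2)^-1 * (t ^+ 2 - s ^+ 2).
        by field; rewrite !gt_eqF.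
      have -> : 2 * (s^-1 - t^-1) = s^-1 * (t ^+ 2)^-1 * (2 * t * (t - s)).
        by field; rewrite !gt_eqF.
      rewrite ler_pM2l; last by rewrite mulr_gt0 ?invr_gt0 // exprn_gt0.
      have : s <= t by rewrite /s /t ler_wsqrtr // ler_nat.
      nra.
    have tri (A B D e : R) : `|A| <= e -> `|B| <= e -> `|D| <= 2 * e -> `|A - B + D| <= 4 * e.
      by rewrite !ler_norml; lra.
    rewrite -!mulrA in as3 *; exact: tri (as1 n mn) (as1 m (leqnn m)) as3.
  rewrite e1; apply: le_trans (ler_normD _ _) _; rewrite /K mulrDl; lra.
(* Passing from N = floor x to x: sqrt x <= 2 sqrt N doubles the error, and the change of c ln costs
   2 c / sqrt x. *)
exists c1, (2 * K + 2 * c); first by have := ltW c_gt0; have := C0_ge0; lra.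
move=> x x1; have [n0 nx nx1 nx2] := natr_truncn x1; set N := Num.truncn x in n0 nx nx1 nx2 *.
have N0 : (0 : R) < N%:R by rewrite ltr0n.
have s1 := sqrt_ge1 x1; have x0 : 0 < x by lra.
have sN0 : 0 < Num.sqrt N%:R :> R by rewrite sqrtr_gt0.
have sxN : Num.sqrt x <= 2 * Num.sqrt N%:R.
  rewrite -(@ler_pXn2r _ 2) ?nnegrE ?mulr_ge0 ?sqrtr_ge0 //.
  by rewrite exprMn !sqr_sqrtr ?ltW //; lra.
have iN : (Num.sqrt N%:R)^-1 <= 2 / Num.sqrt x.
  by rewrite ler_pdivlMr ?sqrtr_gt0 // mulrC ler_pdivrMr.
have h1 := hc1 N n0.
have h2 : `|c * (ln x - ln N%:R)| <= 2 * c / Num.sqrt x.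
  rewrite normrM (gtr0_norm c_gt0) (mulrC 2) -mulrA ler_pM2l // ger0_norm; last first.
    by rewrite subr_ge0 ler_ln ?posrE.
  apply: le_trans (ln_sub_le N0 x0) _.
  apply: le_trans (_ : N%:R^-1 <= _).
    by rewrite ler_pdivrMr // mulVf ?gt_eqF //; lra.
  apply: le_trans iN; rewrite lef_pV2 ?posrE //; apply: sqrt_le_self; rewrite ler1n //.
have h3 : K / Num.sqrt N%:R <= 2 * K / Num.sqrt x.
  by rewrite (mulrC 2) -mulrA ler_wpM2l.
have -> : sumto x (fun n => r n / n%:R) - c * ln x - c1 = (u N - c1) - c * (ln x - ln N%:R).
  by rewrite /u /sumto -/N; ring.
by apply: le_trans (ler_normB _ _) _; rewrite mulrDl lerD // (le_trans h1).
Qed.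

(** * The weighted prime count, the symmetry formula and its first consequences *)

Definition psi (x : R) : R := sumto x Lam.

Lemma psi_ge0 x : 0 <= psi x.
Proof. by apply: sumto_ge0 => n n0 _; apply: Lam_ge0. Qed.

Lemma le_psi x y : x <= y -> psi x <= psi y.
Proof. by move=> xy; apply: sumto_mono => // n n0; apply: Lam_ge0. Qed.

Lemma ge1_div x n : (0 < n)%N -> n%:R <= x -> 1 <= x / n%:R.
Proof. by move=> n0 nx; rewrite ler_pdivlMr ?ltr0n // mul1r. Qed.

Lemma sum_r_psi x : 1 <= x ->
  sumto x (fun n => r n * psi (x / n%:R)) =
  sumto x r * ln x - sumto x (fun n => r n * ln (x / n%:R)).
Proof.
move=> x1; rewrite -sumto_dconv -sumto_mulr -sumtoB.
apply: eq_sumto => n n0 nx; rewrite dconvC // conv_Lamr // ln_div ?posrE ?ltr0n //; last by lra.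
ring.
Qed.

(* The constant [s] is chosen so that the main terms of the [r]-average of
   [psi y - y + s] cancel. *)
Lemma smoothed_error_small : exists s, exists2 K : R, 0 <= K & forall x, 1 <= x ->
  `|sumto x (fun n => r n * (psi (x / n%:R) - x / n%:R + s))| <= K * (Num.sqrt x * (1 + ln x)).
Proof.
have [K2 K20 h2] := sum_r_ln_div; have [c1 [K3 K30 h3]] := sum_r_inv.
pose s := 1 + c1 / c; have c0 := c_gt0; have C00 := C0_ge0.
have cs : c * s = c + c1 by rewrite /s mulrDr mulr1 mulrCA mulfV ?mulr1 // gt_eqF.
exists s, (C0 + K2 + K3 + `|s| * C0); first by rewrite !addr_ge0 ?mulr_ge0.
move=> x x1; have x0 : 0 < x by lra.
have s1 := sqrt_ge1 x1; have l0 := ln_ge0 x1.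
have -> : sumto x (fun n => r n * (psi (x / n%:R) - x / n%:R + s)) =
   (sumto x r - c * x) * ln x - (sumto x (fun n => r n * ln (x / n%:R)) - c * x)
   - x * (sumto x (fun n => r n / n%:R) - c * ln x - c1) + s * (sumto x r - c * x).
  have -> : sumto x (fun n => r n * (psi (x / n%:R) - x / n%:R + s)) =
    sumto x (fun n => r n * psi (x / n%:R)) - x * sumto x (fun n => r n / n%:R) + s * sumto x r.
    rewrite -!sumtoZ -sumtoB -sumtoD; apply: eq_bigr => n _; ring.
  rewrite sum_r_psi //.
  have -> : (s * (sumto x r - c * x) = s * sumto x r - (c + c1) * x) by rewrite -cs; ring.
  ring.
have sx : x / Num.sqrt x = Num.sqrt x.
  rewrite -{1}(sqr_sqrtr (ltW x0)) expr2 mulfK // gt_eqF //; lra.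
have q0 : 0 <= Num.sqrt x * ln x by rewrite mulr_ge0 //; lra.
have t1 : `|(sumto x r - c * x) * ln x| <= C0 * (Num.sqrt x * (1 + ln x)).
  rewrite normrM (ger0_norm l0); apply: le_trans (ler_wpM2r l0 (sum_r x1)) _.
  by rewrite -mulrA ler_wpM2l //; lra.
have t2 : `|sumto x (fun n => r n * ln (x / n%:R)) - c * x| <= K2 * (Num.sqrt x * (1 + ln x)).
  by apply: le_trans (h2 x x1) _; rewrite ler_wpM2l //; lra.
have t3 : `|x * (sumto x (fun n => r n / n%:R) - c * ln x - c1)| <= K3 * (Num.sqrt x * (1 + ln x)).
  rewrite normrM gtr0_norm //; apply: le_trans (ler_wpM2l (ltW x0) (h3 x x1)) _.
  by rewrite mulrCA sx ler_wpM2l //; lra.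
have t4 : `|s * (sumto x r - c * x)| <= `|s| * C0 * (Num.sqrt x * (1 + ln x)).
  rewrite normrM -mulrA ler_wpM2l //; apply: le_trans (sum_r x1) _.
  by rewrite ler_wpM2l //; lra.
rewrite [leRHS]mulrDl [X in _ <= X + _]mulrDl [X in _ <= X + _ + _]mulrDl.
apply: le_trans (ler_normD _ _) _; rewrite lerD //.
apply: le_trans (ler_normB _ _) _; rewrite lerD //.
by apply: le_trans (ler_normB _ _) _; rewrite lerD.
Qed.

(** Split ln(x / n) = ln(x / (n m)) + ln m on the right. Grouped by k = n m, the first part has
    weight b * r = delta, which leaves F(x) ln x, and the second has weight b * (r ln) = Lam. *)
Lemma tatuzawa_iseki (F : R -> R) x : 1 <= x ->
  F x * ln x + sumto x (fun n => Lam n * F (x / n%:R)) =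
  sumto x (fun n => b n * (sumto (x / n%:R) (fun m => r m * F (x / n%:R / m%:R))
                           * ln (x / n%:R))).
Proof.
move=> x1; have x0 : 0 < x by lra.
have -> : F x * ln x = sumto x (fun k => dconv b r k * (F (x / k%:R) * ln (x / k%:R))).
  rewrite (@eq_sumto _ _ _ (fun k => delta1 k * (F (x / k%:R) * ln (x / k%:R)))).
    by rewrite sumto_delta1 // divr1.
  by move=> n n0 _; rewrite conv_br.
have -> : sumto x (fun n => Lam n * F (x / n%:R)) =
    sumto x (fun n => dconv b (fun k => r k * ln k%:R) n * F (x / n%:R)).
  by apply: eq_sumto => n n0 _; rewrite conv_brln.
rewrite -(sumto_dconv_scaled x b r (fun y => F y * ln y)) -sumto_dconv_scaled -sumtoD.
apply: eq_sumto => n n0 nx; rewrite -mulrDr -sumtoD -sumto_mulr; congr (_ * _).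
apply: eq_sumto => m m0 mx.
have n0' : (0 : R) < n%:R by rewrite ltr0n.
rewrite [ln (_ / m%:R)]ln_div ?posrE ?ltr0n // ?divr_gt0 //; ring.
Qed.

Lemma sum_r_pow34 x : 1 <= x ->
  sumto x (fun n => r n * pow34 (x / n%:R)) <= 4 * (c + C0) * x.
Proof.
move=> x1; have x0 : 0 <= x by lra. have c0 := c_gt0; have C00 := C0_ge0.
have cC : 0 <= c + C0 by lra.
apply: le_trans (_ : (c + C0) * sumto x (fun n => pow34 (x / n%:R)) <= _).
  apply: sumto_mul_le => //; first exact: sum_r_le.
  - by move=> n n0 nx; rewrite mulr_ge0 ?sqrtr_ge0.
  - move=> n n0 nx; have h : x / n.+1%:R <= x / n%:R.
      by rewrite ler_wpM2l // lef_pV2 ?posrE ?ltr0n // ler_nat.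
    by rewrite ler_pM ?sqrtr_ge0 // !ler_wsqrtr.
by rewrite (mulrC 4) -mulrA ler_wpM2l // sumto_pow34_le.
Qed.

(** For F = psi - id + s the inner sums at y = x / n are O(sqrt y (1 + ln y)); times ln y they are
    O(y^(3/4)), and |b| <= r together with the average of [r] gives O(x). *)
Lemma selberg_shifted : exists s, exists2 K : R, 0 <= K & forall x, 1 <= x ->
  `|(psi x - x + s) * ln x + sumto x (fun n => Lam n * (psi (x / n%:R) - x / n%:R + s))| <= K * x.
Proof.
have [s [K K0 hK]] := smoothed_error_small.
have c0 := c_gt0; have C00 := C0_ge0.
exists s, (64 * K * (4 * (c + C0))); first by rewrite !mulr_ge0 // addr_ge0 // ltW.
move=> x x1; rewrite (tatuzawa_iseki (fun y => psi y - y + s)) //.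
apply: le_trans (ler_norm_sumto _ _) _.
rewrite -mulrA; apply: le_trans (ler_wpM2l _ (sum_r_pow34 x1)); last by rewrite mulr_ge0.
rewrite -sumtoZ; apply: le_sumto => n n0 nx.
have y1 := ge1_div n0 nx; have l0 := ln_ge0 y1.
set y := x / n%:R in y1 l0 *.
rewrite normrM mulrCA ler_pM ?b_le //.
rewrite normrM [X in _ * X]ger0_norm //.
apply: le_trans (ler_wpM2r l0 (hK y y1)) _.
rewrite mulrAC -mulrA (mulrC 64) -mulrA ler_wpM2l //.
apply: le_trans (log_sqr_le_pow34 y1); rewrite mulrCA ler_wpM2l ?sqrtr_ge0 //.
rewrite mulrC expr2 ler_wpM2l //; lra.
Qed.

(** The sum of Lam * r is at least k x times the sum of Lam(n) / n, and it equals the sum of r ln,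
    which is at most (c + C0) x ln x. *)
Lemma sum_Lam_inv_le : exists2 K : R, 0 <= K & forall x, 1 <= x ->
  sumto x (fun n => Lam n / n%:R) <= K * ln x.
Proof.
have [k k0 hk] := sum_r_ge; have c0 := c_gt0; have C00 := C0_ge0.
exists ((c + C0) / k); first by rewrite divr_ge0 ?addr_ge0 // ltW.
move=> x x1; have x0 : 0 < x by lra. have l0 := ln_ge0 x1.
rewrite mulrAC ler_pdivlMr // -(ler_pM2l x0).
have h1 : x * (sumto x (fun n => Lam n / n%:R) * k) <= sumto x (dconv Lam r).
  rewrite sumto_dconv -sumto_mulr -sumtoZ; apply: le_sumto => n n0 nx.
  have := ler_wpM2l (Lam_ge0 n0) (hk _ (ge1_div n0 nx)).
  by apply: le_trans; rewrite le_eqVlt; apply/orP; left; apply/eqP; ring.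
apply: le_trans h1 _; apply: le_trans (_ : sumto x r * ln x <= _).
  rewrite -sumto_mulr; apply: le_sumto => n n0 nx; rewrite conv_Lamr //.
  by rewrite ler_wpM2l ?r_ge0 // ler_ln ?posrE ?ltr0n.
by apply: le_trans (ler_wpM2r l0 (sum_r_le x1)) _; rewrite mulrAC mulrC.
Qed.

Lemma psi_le : exists2 K : R, 0 <= K & forall x, 1 <= x -> psi x <= K * x.
Proof.
have [s [K K0 hK]] := selberg_shifted; have [M M0 hM] := sum_Lam_inv_le.
(* Beyond [X0] one has |s| <= ln x / 2, so ln x - |s| keeps half the size of ln x; up to [X0]
   monotonicity of [psi] gives the bound. *)
pose X0 := expR (2 * `|s| + 1).
have X01 : 1 <= X0 by rewrite /X0 -[leLHS]expR0 ler_expR addr_ge0 // mulr_ge0.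
exists (Num.max (psi X0) (2 * (1 + M + K + `|s|))).
  by rewrite le_max psi_ge0.
move=> x x1; have x0 : 0 < x by lra. have l0 := ln_ge0 x1.
have [xX|Xx] := leP x X0.
  apply: le_trans (_ : psi X0 * x <= _).
    by apply: le_trans (le_psi xX) _; rewrite ler_peMr ?psi_ge0.
  by rewrite ler_wpM2r ?le_max ?lexx // ltW.
apply: le_trans (_ : 2 * (1 + M + K + `|s|) * x <= _); last first.
  by rewrite ler_wpM2r ?le_max ?lexx ?orbT // ltW.
have lX : 2 * `|s| + 1 <= ln x by rewrite -[leLHS]expRK ler_ln ?posrE ?expR_gt0 // ltW.
have := hK x x1; rewrite ler_norml => /andP[_ h].
have e : sumto x (fun n => Lam n * (psi (x / n%:R) - x / n%:R + s)) =
  sumto x (fun n => Lam n * psi (x / n%:R)) - x * sumto x (fun n => Lam n / n%:R) + s * psi x.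
  by rewrite /psi -!sumtoZ -sumtoB -sumtoD; apply: eq_bigr => n _; ring.
have p0 : 0 <= sumto x (fun n => Lam n * psi (x / n%:R)).
  by apply: sumto_ge0 => n n0 _; rewrite mulr_ge0 ?psi_ge0 ?Lam_ge0.
have q := psi_ge0 x; have h3 := ler_wpM2l (ltW x0) (hM x x1).
have s2 : - `|s| * psi x <= s * psi x by rewrite ler_wpM2r // lerNl -normrN ler_norm.
have s3 : - `|s| * ln x <= s * ln x by rewrite ler_wpM2r // lerNl -normrN ler_norm.
have s4 : 0 <= `|s| by [].
have main : psi x * (ln x - `|s|) <= x * ln x * (1 + M + `|s|) + K * x.
  have : `|s| * ln x <= `|s| * (x * ln x) by rewrite ler_wpM2l // ler_peMl.
  rewrite e in h; lra.
have m2 : psi x * (ln x / 2) <= psi x * (ln x - `|s|) by rewrite ler_wpM2l //; lra.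
have m3 : K * x <= K * (x * ln x) by rewrite ler_wpM2l // ler_peMr //; lra.
have l1 : 0 < ln x by lra.
rewrite -(ler_pM2r l1); lra.
Qed.

(** Removing the shift costs s (ln x + psi x), which is O(x) by Chebyshev's bound. *)
Lemma selberg : exists2 K : R, 0 <= K & forall x, 1 <= x ->
  `|(psi x - x) * ln x + sumto x (fun n => Lam n * (psi (x / n%:R) - x / n%:R))| <= K * x.
Proof.
have [s [K K0 hK]] := selberg_shifted; have [M M0 hM] := psi_le.
exists (K + `|s| * (1 + M)); first by rewrite addr_ge0 // mulr_ge0 // addr_ge0.
move=> x x1; have x0 : 0 < x by lra. have l0 := ln_ge0 x1.
set S := sumto x _.
have -> : (psi x - x) * ln x + S = (psi x - x + s) * ln x +
  sumto x (fun n => Lam n * (psi (x / n%:R) - x / n%:R + s)) - s * (ln x + psi x).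
  have -> : sumto x (fun n => Lam n * (psi (x / n%:R) - x / n%:R + s)) = S + s * psi x.
    by rewrite /S /psi -sumtoZ -sumtoD; apply: eq_bigr => n _; ring.
  ring.
apply: le_trans (ler_normB _ _) _; rewrite [leRHS]mulrDl lerD ?hK //.
rewrite normrM -mulrA ler_wpM2l // ger0_norm; last by rewrite addr_ge0 ?psi_ge0.
have := hM x x1; have := ln_sublinear x0; lra.
Qed.

Lemma sum_Lam_mul_le (K : R) (f : nat -> R) x : 0 <= K ->
  (forall x, 1 <= x -> psi x <= K * x) -> 1 <= x ->
  (forall n, (0 < n)%N -> n%:R <= x -> 0 <= f n) ->
  (forall n, (0 < n)%N -> n.+1%:R <= x -> f n.+1 <= f n) ->
  sumto x (fun n => Lam n * f n) <= K * sumto x f.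
Proof.
by move=> K0 hK x1 f0 fd; apply: sumto_mul_le => //; lra.
Qed.

(** The sum of Lam * r is evaluated twice. Through the sums of [r] it is c x times the sum of Lam(n)
    / n, up to C0 times the sum of Lam(n) sqrt(x / n), which is O(x) by Chebyshev; as the sum of r
    ln it is c x ln x + O(x). *)
Lemma mertens : exists2 K : R, 0 <= K & forall x, 1 <= x ->
  `|sumto x (fun n => Lam n / n%:R) - ln x| <= K.
Proof.
have [M M0 hM] := psi_le; have [L L0 hL] := sum_r_ln_div.
have c0 := c_gt0; have C00 := C0_ge0.
exists ((C0 * (2 * M) + (2 * C0 + c + L)) / c); first by rewrite divr_ge0 ?addr_ge0 ?mulr_ge0 // ltW.
move=> x x1; have x0 : 0 < x by lra. have l0 := ln_ge0 x1.
have s1 := sqrt_ge1 x1; have sx := sqrt_le_self x1.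
set S := sumto x _.
have h1 : `|sumto x (dconv Lam r) - c * x * S| <= C0 * (2 * M) * x.
  rewrite sumto_dconv /S -sumtoZ -sumtoB; apply: le_trans (ler_norm_sumto _ _) _.
  apply: le_trans (_ : C0 * sumto x (fun n => Lam n * Num.sqrt (x / n%:R)) <= _).
    rewrite -sumtoZ; apply: le_sumto => n n0 nx.
    have -> : Lam n * sumto (x / n%:R) r - c * x * (Lam n / n%:R) =
       Lam n * (sumto (x / n%:R) r - c * (x / n%:R)) by ring.
    rewrite normrM ger0_norm ?Lam_ge0 // [leRHS]mulrCA ler_wpM2l ?Lam_ge0 //.
    by apply: sum_r; apply: ge1_div.
  rewrite -[leRHS]mulrA ler_wpM2l //; have -> : 2 * M * x = M * (2 * x) by ring.
  apply: le_trans (ler_wpM2l M0 (sumto_sqrt_le (ltW x0))).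
  apply: sum_Lam_mul_le => // n n0 nx.
  by rewrite ler_wsqrtr // ler_wpM2l ?(ltW x0) // lef_pV2 ?posrE ?ltr0n // ler_nat.
have h2 : `|sumto x (dconv Lam r) - c * x * ln x| <= (2 * C0 + c + L) * x.
  have -> : sumto x (dconv Lam r) = sumto x r * ln x - sumto x (fun n => r n * ln (x / n%:R)).
    rewrite -sum_r_psi // -sumto_dconv; apply: eq_sumto => n n0 _; exact: dconvC.
  have -> : sumto x r * ln x - sumto x (fun n => r n * ln (x / n%:R)) - c * x * ln x =
     (sumto x r - c * x) * ln x - (sumto x (fun n => r n * ln (x / n%:R)) - c * x) - c * x by ring.
  have t1 : `|(sumto x r - c * x) * ln x| <= 2 * C0 * x.
    rewrite normrM (ger0_norm l0); apply: le_trans (ler_wpM2r l0 (sum_r x1)) _.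
    have -> : 2 * C0 * x = C0 * (Num.sqrt x * (2 * Num.sqrt x)).
      by rewrite -[X in _ * X = _](sqr_sqrtr (ltW x0)); ring.
    by rewrite -mulrA ler_wpM2l // ler_wpM2l ?sqrtr_ge0 //; have := log_le_sqrt x1; lra.
  have t2 : `|sumto x (fun n => r n * ln (x / n%:R)) - c * x| <= L * x.
    by apply: le_trans (hL x x1) _; rewrite ler_wpM2l.
  have cx : 0 <= c * x by rewrite mulr_ge0 // ltW.
  have tri (A B D e f g : R) : `|A| <= e -> `|B| <= f -> `|D| <= g -> `|A - B - D| <= e + g + f.
    by rewrite !ler_norml; lra.
  by rewrite [leRHS]mulrDl [X in _ <= X + _]mulrDl; apply: tri => //; rewrite ger0_norm.
rewrite ler_pdivlMr // -(ler_pM2r x0).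
have -> : `|S - ln x| * c * x = `|c * x * S - c * x * ln x|.
  by rewrite -mulrBr normrM (@gtr0_norm _ (c * x)) ?mulr_gt0 //; ring.
have -> : c * x * S - c * x * ln x =
  (sumto x (dconv Lam r) - c * x * ln x) - (sumto x (dconv Lam r) - c * x * S) by ring.
by apply: le_trans (ler_normB _ _) _; rewrite [leRHS]mulrDl [leRHS]addrC lerD.
Qed.

(** * Inequalities for the error term *)

Definition psi_error (x : R) : R := psi x - x.

(** Selberg's weight: the Dirichlet coefficients of Z'' / Z, where Z is the Dirichlet series of
    [r]. *)
Definition Lam2 (n : nat) : R := Lam n * ln n%:R + dconv Lam Lam n.

Lemma dconv_Lam_Lam_ge0 n : (0 < n)%N -> 0 <= dconv Lam Lam n.
Proof.
move=> n0; rewrite /dconv big_seq; apply: sumr_ge0 => d; rewrite -dvdn_divisors // => dn.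
have d0 := dvdn_gt0 n0 dn; have q0 : (0 < n %/ d)%N by rewrite divn_gt0 // dvdn_leq.
by rewrite mulr_ge0 // Lam_ge0.
Qed.

Lemma psi_error_le : exists2 K : R, 0 <= K & forall x, 1 <= x -> `|psi_error x| <= K * x.
Proof.
have [M M0 hM] := psi_le; exists (M + 1) => [|x x1]; first by rewrite addr_ge0.
have := hM x x1; have := psi_ge0 x; have : 0 <= M * x by rewrite mulr_ge0 //; lra.
by rewrite /psi_error ler_norml; lra.
Qed.

Lemma selberg_symmetric : exists2 K : R, 0 <= K & forall x, 1 <= x ->
  `|psi x * ln x + sumto x (fun n => Lam n * psi (x / n%:R)) - 2 * x * ln x| <= K * x.
Proof.
have [K K0 hK] := selberg; have [L L0 hL] := mertens.
exists (K + L); first by rewrite addr_ge0.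
move=> x x1; have x0 : 0 < x by lra.
have -> : psi x * ln x + sumto x (fun n => Lam n * psi (x / n%:R)) - 2 * x * ln x =
  ((psi x - x) * ln x + sumto x (fun n => Lam n * (psi (x / n%:R) - x / n%:R))) +
  x * (sumto x (fun n => Lam n / n%:R) - ln x).
  have -> : sumto x (fun n => Lam n * (psi (x / n%:R) - x / n%:R)) =
    sumto x (fun n => Lam n * psi (x / n%:R)) - x * sumto x (fun n => Lam n / n%:R).
    by rewrite -sumtoZ -sumtoB; apply: eq_bigr => n _; ring.
  ring.
apply: le_trans (ler_normD _ _) _; rewrite [leRHS]mulrDl lerD ?hK //.
by rewrite normrM gtr0_norm // mulrC ler_wpM2r ?hL // ltW.
Qed.

Lemma sum_Lam2 : exists2 K : R, 0 <= K & forall x, 1 <= x ->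
  `|sumto x Lam2 - 2 * x * ln x| <= K * x.
Proof.
have [K K0 hK] := selberg_symmetric; have [M M0 hM] := psi_le.
exists (K + 2 * M); first by rewrite addr_ge0 ?mulr_ge0.
move=> x x1; have x0 : 0 < x by lra.
have e : sumto x Lam2 - 2 * x * ln x =
  (psi x * ln x + sumto x (fun n => Lam n * psi (x / n%:R)) - 2 * x * ln x) -
  sumto x (fun n => Lam n * ln (x / n%:R)).
  have -> : sumto x (fun n => Lam n * ln (x / n%:R)) =
      psi x * ln x - sumto x (fun n => Lam n * ln n%:R).
    rewrite /psi -sumto_mulr -sumtoB; apply: eq_sumto => n n0 nx.
    by rewrite ln_div ?posrE ?ltr0n //; ring.
  rewrite /Lam2 sumtoD sumto_dconv; ring.
rewrite e; apply: le_trans (ler_normB _ _) _; rewrite [leRHS]mulrDl lerD ?hK //.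
have l0 n : (0 < n)%N -> n%:R <= x -> 0 <= ln (x / n%:R).
  by move=> n0 nx; rewrite ln_ge0 ?ge1_div.
rewrite ger0_norm; last first.
  by apply: sumto_ge0 => n n0 nx; rewrite mulr_ge0 ?Lam_ge0 ?l0.
apply: le_trans (_ : M * sumto x (fun n => ln (x / n%:R)) <= _).
  apply: sum_Lam_mul_le => // n n0 nx.
  by rewrite ler_ln ?posrE ?divr_gt0 ?ltr0n // ler_wpM2l ?(ltW x0) // lef_pV2 ?posrE ?ltr0n // ler_nat.
by rewrite (mulrC 2) -mulrA ler_wpM2l // sum_ln_div_le.
Qed.

Lemma sum_Lam2_sub_ln : exists2 K : R, 0 <= K & forall n : nat,
  `|\sum_(1 <= k < n.+1) (Lam2 k - 2 * ln k%:R)| <= K * n%:R.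
Proof.
(* 6 = 2 (1 + 2): the sum of ln n differs from x ln x by at most x + 1 + ln x <= x + 2 sqrt x <= 3
   x. *)
have [K K0 hK] := sum_Lam2; exists (K + 6) => [|n]; first by rewrite addr_ge0.
case: n => [|n]; first by rewrite big_geq // normr0 mulr_ge0 ?addr_ge0.
set x : R := n.+1%:R; have x1 : 1 <= x by rewrite ler1n.
rewrite sumrB -mulr_sumr -!sumto_nat -/x.
have := hK x x1; have /andP[h1 h2] := sum_ln_itv x1.
have := log_le_sqrt x1; have := sqrt_le_self x1.
rewrite !ler_norml mulrDl; lra.
Qed.

(** Take Selberg's formula at x times ln x, minus the formulas at x / n weighted by Lam(n): the
    terms ln x Lam(n) [psi_error](x / n) cancel. The weights Lam ln and Lam * Lam remain with
    opposite signs, and absolute values add them up to [Lam2]. *)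
Lemma error_le_sum_Lam2 : exists2 K : R, 0 <= K & forall x, 1 <= x ->
  `|psi_error x| * ln x ^+ 2 <=
  sumto x (fun n => Lam2 n * `|psi_error (x / n%:R)|) + K * (x * (1 + ln x)).
Proof.
have [K K0 hK] := selberg; have [L L0 hL] := mertens.
exists (K * (2 + L)); first by rewrite mulr_ge0 // addr_ge0.
move=> x x1; have x0 : 0 < x by lra. have l0 := ln_ge0 x1.
pose Sel y := psi_error y * ln y + sumto y (fun n => Lam n * psi_error (y / n%:R)).
have hSel y : 1 <= y -> `|Sel y| <= K * y := hK y.
have e : psi_error x * ln x ^+ 2 = ln x * Sel x - sumto x (fun n => Lam n * Sel (x / n%:R))
    - sumto x (fun n => Lam n * ln n%:R * psi_error (x / n%:R))
    + sumto x (fun n => dconv Lam Lam n * psi_error (x / n%:R)).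
  have -> : sumto x (fun n => Lam n * Sel (x / n%:R)) =
    ln x * sumto x (fun n => Lam n * psi_error (x / n%:R)) -
    sumto x (fun n => Lam n * ln n%:R * psi_error (x / n%:R)) +
    sumto x (fun n => dconv Lam Lam n * psi_error (x / n%:R)).
    rewrite -sumto_dconv_scaled -sumtoZ -sumtoB -sumtoD; apply: eq_sumto => n n0 nx.
    by rewrite /Sel ln_div ?posrE ?ltr0n //; ring.
  rewrite /Sel; ring.
have a1 : `|ln x * Sel x| <= K * (x * ln x).
  by rewrite normrM ger0_norm // mulrC mulrA ler_wpM2r // hSel.
have a2 : `|sumto x (fun n => Lam n * Sel (x / n%:R))| <= K * (x * (ln x + L)).
  apply: le_trans (ler_norm_sumto _ _) _.
  apply: le_trans (_ : K * (x * sumto x (fun n => Lam n / n%:R)) <= _).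
    rewrite -!sumtoZ; apply: le_sumto => n n0 nx.
    rewrite normrM ger0_norm ?Lam_ge0 //.
    have := ler_wpM2l (Lam_ge0 n0) (hSel _ (ge1_div n0 nx)).
    by move=> h; apply: le_trans h _; rewrite le_eqVlt; apply/orP; left; apply/eqP; ring.
  rewrite ler_wpM2l // ler_wpM2l ?(ltW x0) //.
  by have := hL x x1; rewrite ler_norml; lra.
have a3 : `|sumto x (fun n => Lam n * ln n%:R * psi_error (x / n%:R))| <=
   sumto x (fun n => Lam n * ln n%:R * `|psi_error (x / n%:R)|).
  apply: le_trans (ler_norm_sumto _ _) _; apply: le_sumto => n n0 nx.
  by rewrite normrM (@ger0_norm _ (_ * _)) // mulr_ge0 ?Lam_ge0 // ln_ge0 // ler1n.
have a4 : `|sumto x (fun n => dconv Lam Lam n * psi_error (x / n%:R))| <=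
   sumto x (fun n => dconv Lam Lam n * `|psi_error (x / n%:R)|).
  apply: le_trans (ler_norm_sumto _ _) _; apply: le_sumto => n n0 nx.
  by rewrite normrM (@ger0_norm _ (dconv _ _ _)) // dconv_Lam_Lam_ge0.
have -> : sumto x (fun n => Lam2 n * `|psi_error (x / n%:R)|) =
  sumto x (fun n => Lam n * ln n%:R * `|psi_error (x / n%:R)|) +
  sumto x (fun n => dconv Lam Lam n * `|psi_error (x / n%:R)|).
  by rewrite -sumtoD; apply: eq_sumto => n _ _; rewrite /Lam2 mulrDl.
have -> : `|psi_error x| * ln x ^+ 2 = `|psi_error x * ln x ^+ 2|.
  by rewrite normrM (@ger0_norm _ (_ ^+ 2)) ?sqr_ge0.
have cmb : K * (x * ln x) + K * (x * (ln x + L)) <= K * (2 + L) * (x * (1 + ln x)).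
  have -> : K * (2 + L) * (x * (1 + ln x)) =
     K * (x * ln x) + K * (x * (ln x + L)) + K * x * (2 + L * ln x) by ring.
  by rewrite lerDl !mulr_ge0 // ?(ltW x0) // addr_ge0 // mulr_ge0.
rewrite e; move: a1 a2 a3 a4 cmb.
have tri (A B C D a b' c' d k : R) : `|A| <= a -> `|B| <= b' -> `|C| <= c' -> `|D| <= d ->
  a + b' <= k -> `|A - B - C + D| <= c' + d + k by rewrite !ler_norml; lra.
exact: tri.
Qed.

(** Abel summation trades [Lam2] for its average 2 ln. The variation in n of the absolute error at x
    / n is at most that of the monotone function psi + id, whose weighted total is O(x (1 + ln
    x)). *)
Lemma sum_Lam2_error_le : exists2 K : R, 0 <= K & forall x, 1 <= x ->
  sumto x (fun n => Lam2 n * `|psi_error (x / n%:R)|) <=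
  2 * sumto x (fun n => ln n%:R * `|psi_error (x / n%:R)|) + K * (x * (1 + ln x)).
Proof.
have [K K0 hK] := sum_Lam2_sub_ln; have [M M0 hM] := psi_le.
exists (K * (M + 2)); first by rewrite mulr_ge0 // addr_ge0.
move=> x x1; have x0 : 0 < x by lra. have l0 := ln_ge0 x1.
have [n0 nx nx1 _] := natr_truncn x1; set N := Num.truncn x in n0 nx nx1.
pose g n := `|psi_error (x / n%:R)|.
pose T n := psi (x / n%:R) + x / n%:R.
have xS n : (0 < n)%N -> x / n.+1%:R <= x / n%:R.
  by move=> ?; rewrite ler_wpM2l ?(ltW x0) // lef_pV2 ?posrE ?ltr0n // ler_nat.
have gT n : (0 < n)%N -> `|g n - g n.+1| <= T n - T n.+1.
  move=> m0; apply: le_trans (ler_dist_dist _ _) _; rewrite /psi_error /T.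
  have := xS n m0; have := le_psi (xS n m0).
  move: (psi (x / n%:R)) (psi (x / n.+1%:R)) (x / n%:R) (x / n.+1%:R) => a1 a2 a3 a4.
  rewrite ler_norml; lra.
(* Boundary term: x / (N + 1) < 1, where [psi] vanishes. *)
have gN : g N.+1 <= 1.
  have lt1 : x / N.+1%:R < 1 by rewrite ltr_pdivrMr // mul1r -natr1.
  have p0 : psi (x / N.+1%:R) = 0.
    by rewrite /psi /sumto (_ : Num.truncn _ = 0%N) ?big_geq //; apply/truncn0Pn; rewrite -ltNge.
  rewrite /g /psi_error p0 sub0r normrN ger0_norm; first exact: ltW.
  by rewrite divr_ge0 // ltW.
have h1 : \sum_(1 <= n < N.+1) n%:R * (T n - T n.+1) <= (M + 1) * (x * (1 + ln x)).
  have TN : 0 <= T N.+1 by rewrite addr_ge0 ?psi_ge0 // divr_ge0 // ltW.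
  have := abel_sum (fun=> 1) T N.
  have e1 n : \sum_(1 <= k < n.+1) 1 = n%:R :> R by rewrite big_const_nat subn1 iter_addr_0.
  under [X in _ = _ + X]eq_bigr => n _ do rewrite e1.
  rewrite e1 => h; apply: le_trans (_ : \sum_(1 <= n < N.+1) 1 * T n <= _).
    by rewrite h lerDr mulr_ge0.
  apply: le_trans (_ : (M + 1) * (x * sumto x (fun n => n%:R^-1)) <= _); last first.
    by rewrite ler_wpM2l ?addr_ge0 // ler_wpM2l ?(ltW x0) // harmonic_le.
  rewrite -!sumtoZ; apply: le_sumto => n m0 mx; rewrite mul1r /T mulrDl mul1r lerD //.
  by apply: hM; apply: ge1_div.
have e2 : sumto x (fun n => Lam2 n * g n) = 2 * sumto x (fun n => ln n%:R * g n) +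
   \sum_(1 <= n < N.+1) (Lam2 n - 2 * ln n%:R) * g n.
  by rewrite -sumtoZ /sumto -/N -big_split; apply: eq_bigr => n _ /=; ring.
rewrite -/g e2 lerD2l abel_sum.
apply: le_trans (_ : K * x + K * ((M + 1) * (x * (1 + ln x))) <= _); last first.
  rewrite -mulrDr -mulrA ler_wpM2l //.
  have : 0 <= x * ln x by rewrite mulr_ge0 // ltW.
  rewrite !mulrDl; lra.
apply: lerD.
  apply: le_trans (ler_norm _) _; rewrite normrM -[leRHS]mulr1 ler_pM //.
    by apply: le_trans (hK N) _; rewrite ler_wpM2l.
  by rewrite ger0_norm // normr_ge0.
apply: le_trans (ler_wpM2l K0 h1); rewrite mulr_sumr !big_nat.
apply: ler_sum => n /andP[m0 _]; apply: le_trans (ler_norm _) _.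
by rewrite normrM mulrA ler_pM // gT.
Qed.

Lemma error_log_average : exists2 K : R, 0 <= K & forall x, 1 <= x ->
  `|psi_error x| * ln x ^+ 2 <=
  2 * sumto x (fun n => ln n%:R * `|psi_error (x / n%:R)|) + K * (x * (1 + ln x)).
Proof.
have [K K0 hK] := error_le_sum_Lam2; have [L L0 hL] := sum_Lam2_error_le.
exists (K + L) => [|x x1]; first by rewrite addr_ge0.
have := hK x x1; have := hL x x1; rewrite (mulrDl K L); lra.
Qed.

(** 1/n - 1/(n + 1) is the discrete form of dt / t^2. By parts the sum is the Mertens sum minus the
    harmonic sum, up to bounded terms, and the two logarithms cancel. *)
Lemma sum_error_bounded : exists2 K : R, 0 <= K & forall N : nat,
  `|\sum_(1 <= n < N.+1) psi_error n%:R * (n%:R^-1 - n.+1%:R^-1)| <= K.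
Proof.
have [L L0 hL] := mertens; have [M M0 hM] := psi_le.
exists (L + M + 2) => [|N]; first by rewrite !addr_ge0.
case: N => [|N]; first by rewrite big_geq // normr0 !addr_ge0.
set x : R := N.+1%:R; have x1 : 1 <= x by rewrite ler1n.
have x0 : 0 < x by lra.
have e1 n : \sum_(1 <= k < n.+1) 1 = n%:R :> R by rewrite big_const_nat subn1 iter_addr_0.
have h1 : sumto x (fun n => n%:R^-1) =
    x / N.+2%:R + \sum_(1 <= n < N.+2) n%:R * (n%:R^-1 - n.+1%:R^-1).
  rewrite sumto_nat; transitivity (\sum_(1 <= n < N.+2) 1 * n%:R^-1 : R).
    by apply: eq_bigr => n _; rewrite mul1r.
  by rewrite [LHS]abel_sum e1; congr (_ + _); apply: eq_bigr => n _; rewrite e1.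
have h2 : sumto x (fun n => Lam n / n%:R) =
    psi x / N.+2%:R + \sum_(1 <= n < N.+2) psi n%:R * (n%:R^-1 - n.+1%:R^-1).
  rewrite sumto_nat [LHS]abel_sum /psi sumto_nat; congr (_ + _).
  by apply: eq_bigr => n _; rewrite sumto_nat.
have -> : \sum_(1 <= n < N.+2) psi_error n%:R * (n%:R^-1 - n.+1%:R^-1) =
   (sumto x (fun n => Lam n / n%:R) - ln x) - (sumto x (fun n => n%:R^-1) - ln x)
   - psi x / N.+2%:R + x / N.+2%:R.
  rewrite h1 h2.
  have -> : \sum_(1 <= n < N.+2) psi_error n%:R * (n%:R^-1 - n.+1%:R^-1) =
    \sum_(1 <= n < N.+2) psi n%:R * (n%:R^-1 - n.+1%:R^-1) -
    \sum_(1 <= n < N.+2) n%:R * (n%:R^-1 - n.+1%:R^-1).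
    by rewrite -sumrB; apply: eq_bigr => n _; rewrite -mulrBl.
  ring.
have q1 : 0 <= x / N.+2%:R <= 1.
  rewrite divr_ge0 ?(ltW x0) //= ler_pdivrMr ?ltr0n // mul1r /x ler_nat //.
have q2 : 0 <= psi x / N.+2%:R <= M.
  rewrite divr_ge0 ?psi_ge0 //= ler_pdivrMr ?ltr0n //; apply: le_trans (hM x x1) _.
  by rewrite ler_wpM2l // /x ler_nat.
have := hL x x1; have := harmonic_le x1; have := harmonic_ge x1.
move: (sumto x (fun n => n%:R^-1)) (sumto x _) (psi x / _) (x / _) q1 q2 => u v w t q1 q2.
rewrite !ler_norml; lra.
Qed.

(** Subtract the symmetric formula at z from that at z'. Its second sum increases with x, so the
    increment of [psi] lies between 0 and about 2 (z' - z); centred at z' - z, this bounds the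
    increment of the error. *)
Lemma error_short_interval : exists2 K : R, 0 <= K & forall z z', 1 <= z <= z' ->
  `|psi_error z' - psi_error z| * ln z' <= (z' - z) * ln z' + K * z'.
Proof.
have [K K0 hK] := selberg_symmetric; exists (2 * K + 2) => [|z z' /andP[z1 zz]].
  by rewrite addr_ge0 ?mulr_ge0.
have z1' : 1 <= z' by lra.
have z0 : 0 < z by lra.
have z0' : 0 < z' by lra.
have l0 := ln_ge0 z1; have l0' := ln_ge0 z1'.
have ll : ln z <= ln z' by rewrite ler_ln ?posrE.
have S_le : sumto z (fun n => Lam n * psi (z / n%:R)) <= sumto z' (fun n => Lam n * psi (z' / n%:R)).
  apply: le_trans (_ : sumto z (fun n => Lam n * psi (z' / n%:R)) <= _).
    apply: le_sumto => n n0 _; rewrite ler_wpM2l ?Lam_ge0 //; apply: le_psi.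
    by rewrite ler_wpM2r.
  by apply: sumto_mono => // n n0; rewrite mulr_ge0 ?Lam_ge0 ?psi_ge0.
have pl := le_psi zz.
have p1 : psi z * ln z <= psi z * ln z' by rewrite ler_wpM2l ?psi_ge0.
have p2 : z * (ln z' - ln z) <= z' - z by rewrite mulrC -ler_pdivlMr //; apply: ln_sub_le.
have KK : K * z <= K * z' by rewrite ler_wpM2l.
have main : (psi z' - psi z) * ln z' <= 2 * (z' - z) * ln z' + (2 * K + 2) * z'.
  have := hK z z1; have := hK z' z1'; rewrite !ler_norml; lra.
have low : 0 <= (psi z' - psi z) * ln z' by rewrite mulr_ge0 // subr_ge0.
rewrite -[X in _ * X](ger0_norm l0') -normrM /psi_error ler_norml.
have : 0 <= (2 * K + 2) * z' by rewrite mulr_ge0 ?(ltW z0') // addr_ge0 ?mulr_ge0.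
have : 0 <= (z' - z) * ln z' by rewrite mulr_ge0 // subr_ge0.
lra.
Qed.

End SelbergFormula.

(** * From the symmetry formula to the prime ideal theorem *)

Section SelbergEndgame.
Context {R : realType}.
Implicit Types x y z : R.
Context (E : R -> R)
  (E_le : exists2 K : R, 0 <= K & forall x, 1 <= x -> `|E x| <= K * x)
  (E_log_average : exists2 K : R, 0 <= K & forall x, 1 <= x ->
    `|E x| * ln x ^+ 2 <=
    2 * sumto x (fun n => ln n%:R * `|E (x / n%:R)|) + K * (x * (1 + ln x)))
  (E_sum : exists2 K : R, 0 <= K & forall N : nat,
    `|\sum_(1 <= n < N.+1) E n%:R * (n%:R^-1 - n.+1%:R^-1)| <= K)
  (E_short : exists2 K : R, 0 <= K & forall z z', 1 <= z <= z' ->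
    `|E z' - E z| * ln z' <= (z' - z) * ln z' + K * z').

Lemma ln_ge_of_expR x y : expR y <= x -> y <= ln x.
Proof.
move=> h; rewrite -[leLHS]expRK ler_ln ?posrE ?expR_gt0 //.
exact: lt_le_trans (expR_gt0 y) h.
Qed.

Lemma expR_ge1 x : 0 <= x -> 1 <= expR x.
Proof. by move=> x0; rewrite -[leLHS]expR0 ler_expR. Qed.

Lemma error_oscillation e : 0 < e -> exists2 X : R, 1 <= X &
  forall z z', X <= z <= z' -> `|E z' - E z| <= (z' - z) + e * z'.
Proof.
move=> e0; have [K K0 hK] := E_short.
exists (expR (K / e + 1)); first by rewrite expR_ge1 // addr_ge0 // divr_ge0 // ltW.
move=> z z' /andP[Xz zz].
have X1 : 1 <= expR (K / e + 1) by rewrite expR_ge1 // addr_ge0 // divr_ge0 // ltW.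
have l : K / e + 1 <= ln z' by apply: ln_ge_of_expR; apply: le_trans zz.
have Ke : 0 <= K / e by rewrite divr_ge0 // ltW.
have l0 : 0 < ln z' by lra.
have z0 : 0 <= z' by lra.
rewrite -(ler_pM2r l0); apply: le_trans (hK z z' _) _; first by apply/andP; split; lra.
rewrite [leRHS]mulrDl lerD2l mulrAC ler_wpM2r // mulrC -ler_pdivrMr //; lra.
Qed.

(* If [E n / n] stayed away from 0 on a long interval it would keep a constant
   sign there, and the sum of [E n / n^2] would be too large. *)
Lemma small_error_interval d : 0 < d <= 1 -> exists2 Q : R, 1 < Q & exists2 X : R, 1 <= X &
  forall Y, X <= Y -> exists m, [/\ Y <= m, (1 + d / 8) * m <= Q * Y &
    forall z, m <= z <= (1 + d / 8) * m -> `|E z| <= d / 2 * z].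
Proof.
move=> /andP[d0 d1]; have [K K0 hK] := E_sum.
have [X0 X01 hX0] := @error_oscillation (d / 16) ltac:(lra).
(* ln L exceeds ln 2 + 8 K / d + 1. If |E n| > d n / 4 held on all of [a, L a), the sum would be at
   least d / 4 times 8 K / d + 1, more than the 2 K allowed; the ln 2 pays for a + 1 <= 2 a. *)
pose L := (Num.truncn (2 * expR (8 * K / d + 1))).+1.
have hL : 2 * expR (8 * K / d + 1) < L%:R by exact: truncnS_gt.
have eX : 1 <= expR (8 * K / d + 1).
  by rewrite expR_ge1 // addr_ge0 // divr_ge0 ?mulr_ge0 // ltW.
have L2 : 2 < L%:R :> R by lra.
have L0 : (0 < L)%N by [].
(* n < L a <= 2 L Y and 1 + d / 8 <= 2 give the factor 4. *)
exists (4 * L%:R); first by lra.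
(* Beyond 16 / d a sign change from n to n + 1 is impossible: it would be a jump of more than d (2 n
   + 1) / 4, while the oscillation is at most 1 + d (n + 1) / 16. *)
exists (X0 + 16 / d) => [|Y XY]; first by rewrite ler_wpDr // divr_ge0 // ltW.
have d16 : 16 <= 16 / d by rewrite ler_pdivlMr //; lra.
have Y1 : 1 <= Y by lra.
pose a := (Num.truncn Y).+1; pose b := (L * a)%N.
have [a0 aY] : (0 < a)%N /\ Y < a%:R <= Y + 1.
  have [n0 h1 h2 _] := natr_truncn Y1; split => //.
  by rewrite /a -natr1; apply/andP; split; lra.
have bE : b = (L * a)%N by []. clearbody b a L.
have [n /andP[an nb] hn] : exists2 n : nat, (a <= n < b)%N & `|E n%:R| <= d / 4 * n%:R.
  apply: contrapT => H.
  have big n : (a <= n < b)%N -> d / 4 * n%:R < `|E n%:R|.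
    by move=> nab; rewrite ltNge; apply/negP => h; apply: H; exists n.
  have ab : (a < b)%N by rewrite bE -[ltnLHS]mul1n ltn_pmul2r // -(ltr_nat R); lra.
  have [s s1 sa] : exists2 s : R, `|s| = 1 & 0 < s * E a%:R.
    have := big a; rewrite leqnn ab => /(_ isT).
    have : 0 <= d / 4 * a%:R by rewrite mulr_ge0 //; lra.
    have [h|h] := leP 0 (E a%:R).
      by rewrite ger0_norm //; exists 1; rewrite ?normr1 // mul1r; lra.
    by rewrite ltr0_norm //; exists (-1); rewrite ?normrN ?normr1 // mulN1r; lra.
  have sE n : `|s * E n%:R| = `|E n%:R| by rewrite normrM s1 mul1r.
  have sgn k : (a + k < b)%N -> 0 < s * E (a + k)%:R.
    elim: k => [|k IH] kb; first by rewrite addn0.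
    rewrite addnS in kb *; have kb' := ltnW kb; have {}IH := IH kb'.
    have nb : (a <= a + k < b)%N by rewrite leq_addr.
    have nb1 : (a <= (a + k).+1 < b)%N by rewrite leqW ?leq_addr.
    have an : a%:R <= (a + k)%:R :> R by rewrite ler_nat leq_addr.
    move: (a + k)%N IH nb nb1 an => n IH nb nb1 an {kb kb'}.
    rewrite ltNge; apply/negP => neg.
        have nX : X0 <= (n%:R : R) <= n%:R + 1 by rewrite lerDl ler01 andbT; lra.
    have osc := hX0 _ _ nX.
    have b1 := big n nb.
    have b2 : d / 4 * (n%:R + 1) < `|E (n%:R + 1)| by rewrite natr1; apply: big.
    have osc' : `|s * E (n%:R + 1) - s * E n%:R| <= 1 + d / 16 * (n%:R + 1).
      by rewrite -mulrBr normrM s1 mul1r (le_trans osc) // lerD2r addrAC subrr add0r.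
    rewrite -natr1 in neg.
    have b2' : d / 4 * (n%:R + 1) < - (s * E (n%:R + 1)).
      by rewrite -ler0_norm //; have := sE n.+1; rewrite -natr1 => ->.
    have n16 : 16 / d <= n%:R by move: X01 XY aY an; clear; lra.
    rewrite ler_pdivrMr // in n16.
    have dn : 0 <= d * n%:R by rewrite mulr_ge0 // ltW.
    move: osc' b2' n16 dn IH d0; rewrite ler_norml => /andP[].
    by move: (s * E n%:R) (s * E (n%:R + 1)); clear; do 7?[move=> ?]; lra.
  have lower : d / 4 * (ln b.+1%:R - ln a.+1%:R) <=
     \sum_(a <= n < b) s * E n%:R * (n%:R^-1 - n.+1%:R^-1).
    have t : ln b.+1%:R - ln a.+1%:R <= \sum_(a <= n < b) n.+1%:R^-1 :> R.
      apply: (@telescope_le_sum _ _ (fun n => ln n.+1%:R)); first exact: ltnW.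
      by move=> n _; apply: lnS_sub_le.
    apply: le_trans (_ : d / 4 * (\sum_(a <= n < b) n.+1%:R^-1) <= _).
      by rewrite ler_wpM2l //; lra.
    rewrite mulr_sumr !big_nat; apply: ler_sum => n /andP[an nb].
    have n0 : (0 : R) < n%:R by rewrite ltr0n (leq_trans a0).
    have sn : 0 < s * E n%:R by have := sgn (n - a)%N; rewrite subnKC //; apply.
    have bn : d / 4 * n%:R <= s * E n%:R.
      by rewrite -(gtr0_norm sn) sE ltW // big // an nb.
    have -> : n%:R^-1 - n.+1%:R^-1 = n%:R^-1 * n.+1%:R^-1 :> R.
      by rewrite -natr1; move: (n%:R : R) n0 => t' t'0; field; rewrite !gt_eqF // addr_gt0.
    rewrite mulrA ler_wpM2r ?invr_ge0 // ler_pdivlMr //.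
  have upper : \sum_(a <= n < b) s * E n%:R * (n%:R^-1 - n.+1%:R^-1) <= 2 * K.
    have -> : \sum_(a <= n < b) s * E n%:R * (n%:R^-1 - n.+1%:R^-1) =
      s * (\sum_(1 <= n < b.-1.+1) E n%:R * (n%:R^-1 - n.+1%:R^-1) -
           \sum_(1 <= n < a.-1.+1) E n%:R * (n%:R^-1 - n.+1%:R^-1)).
      rewrite !prednK //; last exact: leq_trans ab.
      rewrite (@big_cat_nat _ _ _ a 1 b) //=; last exact: ltnW.
      by rewrite [X in X - _]addrC addrK mulr_sumr; apply: eq_bigr => n _; rewrite mulrA.
    apply: le_trans (ler_norm _) _; rewrite normrM s1 mul1r.
    apply: le_trans (ler_normB _ _) _; by move: (hK b.-1) (hK a.-1); clear; lra.
  have lnlow : 8 * K / d + 1 <= ln b.+1%:R - ln a.+1%:R.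
    have h1 : ln a.+1%:R <= ln (2 * a%:R) :> R.
      rewrite ler_ln ?posrE ?mulr_gt0 ?ltr0n // -natr1.
      by rewrite mulr_natl mulr2n lerD2l ler1n.
    have h2 : ln (L%:R * a%:R) <= ln b.+1%:R :> R.
      by rewrite -natrM ler_ln ?posrE ?ltr0n ?ler_nat ?muln_gt0 ?L0 ?a0 // bE.
    rewrite !lnM ?posrE ?ltr0n // in h1 h2.
    have h3 : ln (2 * expR (8 * K / d + 1)) <= ln L%:R :> R.
      by rewrite ler_ln ?posrE ?ltr0n ?mulr_gt0 ?expR_gt0 // ltW.
    rewrite lnM ?posrE ?expR_gt0 // expRK in h3; move: h1 h2 h3; clear; lra.
  have : d / 4 * (8 * K / d + 1) <= 2 * K.
    by apply: le_trans upper; apply: le_trans lower; rewrite ler_wpM2l //; lra.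
  have -> : d / 4 * (8 * K / d + 1) = 2 * K + d / 4 by field; rewrite gt_eqF.
  by rewrite gerDl leNgt divr_gt0.
have an' : a%:R <= n%:R :> R by rewrite ler_nat.
have nb' : n%:R <= L%:R * a%:R :> R by rewrite -natrM ler_nat -bE ltnW.
exists n%:R; split; first by lra.
  apply: le_trans (_ : 2 * (L%:R * (2 * Y)) <= _); last by lra.
  apply: ler_pM => //; [lra|lra|].
  by apply: le_trans nb' _; rewrite ler_wpM2l //; lra.
(* z - n <= d n / 8, the oscillation term d z / 16 and |E n| <= d n / 4 add up to at most 7 d z /
   16. *)
move=> z /andP[nz zn].
have nX : X0 <= (n%:R : R) <= z by rewrite nz andbT; lra.
have osc := hX0 _ _ nX.
have z0 : 0 <= z by lra.
have dn : d * n%:R <= d * z by rewrite ler_wpM2l // ltW.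
have : `|E z| <= `|E z - E n%:R| + `|E n%:R|.
  by rewrite -{1}[E z](subrK (E n%:R)) ler_normD.
lra.
Qed.

Lemma sumto_sub (u v : R) (f : nat -> R) : u <= v ->
  sumto v f - sumto u f = \sum_((Num.truncn u).+1 <= n < (Num.truncn v).+1) f n.
Proof.
move=> uv; rewrite /sumto (@big_cat_nat _ _ _ (Num.truncn u).+1 1 (Num.truncn v).+1) //=.
  by rewrite [LHS]addrC addKr.
by rewrite ltnS le_truncn.
Qed.

Lemma sumto_sub_ge (u v : R) (f g : nat -> R) : 0 <= u <= v ->
  (forall n, (0 < n)%N -> u < n%:R <= v -> f n <= g n) ->
  sumto v f - sumto u f <= sumto v g - sumto u g.
Proof.
move=> /andP[u0 uv] h; rewrite !sumto_sub // !big_nat; apply: ler_sum => n /andP[un nv].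
have n0 : (0 < n)%N by apply: leq_ltn_trans un.
apply: h => //; rewrite -mem_sumto ?(le_trans u0) // nv andbT.
by rewrite -truncn_lt_nat.
Qed.

Lemma harmonic_sub_ge (u v : R) : 0 < u <= v -> ln v - ln u - u^-1 <=
  sumto v (fun n => n%:R^-1) - sumto u (fun n => n%:R^-1).
Proof.
move=> /andP[u0 uv]; have v0 : 0 < v by lra.
rewrite sumto_sub //.
have h : ln (Num.truncn v).+1%:R - ln (Num.truncn u).+1%:R <=
   \sum_((Num.truncn u).+1 <= n < (Num.truncn v).+1) n%:R^-1 :> R.
  apply: (@telescope_le_sum _ _ (fun n => ln n%:R)); first by rewrite ltnS le_truncn.
  by move=> n /andP[un _]; apply: lnS_sub_le; apply: leq_ltn_trans un.
apply: le_trans h; have vv : ln v <= ln (Num.truncn v).+1%:R.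
  by rewrite ler_ln ?posrE ?ltr0n // ltW // truncnS_gt.
have : ln (Num.truncn u).+1%:R <= ln u + u^-1.
  have u1 : 0 < u + 1 by lra.
  have := ln_sub_le u0 u1; rewrite addrAC subrr add0r div1r => uu.
  have : ln (Num.truncn u).+1%:R <= ln (u + 1).
    rewrite ler_ln ?posrE ?ltr0n // -natr1 lerD2r truncn_le ltW //.
  lra.
lra.
Qed.

(* With [z = x / n] this is [ln n / n * (a - |E z| / z)]. *)
Definition deficit (a x : R) (n : nat) : R := ln n%:R * (a / n%:R - `|E (x / n%:R)| / x).

(** For z = x / n in the block [Y, Q Y] no deficit is negative, and on the interval [m, mu m] of
    small error each is at least d / 2 times ln n / n. There n >= sqrt x, so ln n >= ln x / 2, and
    the harmonic sum is at least ln mu / 2 for large x; the product is (d / 8) ln mu ln x. The gain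
    is fixed before [a]. *)
Lemma deficit_block d : 0 < d <= 1 -> exists2 Q : R, 1 < Q & exists2 k : R, 0 < k &
  forall a X, d <= a -> (forall z, X <= z -> `|E z| <= a * z) ->
  exists2 X' : R, Num.max 1 X <= X' & exists2 x0 : R, 1 <= x0 & forall x Y, x0 <= x -> X' <= Y ->
    Q * Y <= Num.sqrt x ->
  k * ln x <= sumto (x / Y) (deficit a x) - sumto (x / (Q * Y)) (deficit a x).
Proof.
move=> d01; have /andP[d0 d1] := d01.
have [Q Q1 [X1 X11 hQ]] := small_error_interval d01.
pose mu := 1 + d / 8; have mu1 : 1 < mu by rewrite /mu; lra.
have lmu : 0 < ln mu by rewrite ln_gt0.
exists Q => //; exists (d / 8 * ln mu); first by rewrite mulr_gt0 // divr_gt0.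
move=> a X da hX; exists (Num.max (Num.max 1 X) X1); first by rewrite le_max lexx.
(* Beyond this point 1 / sqrt x <= ln mu / 2, which covers the loss in comparing the harmonic sum
   with ln mu. *)
exists (Num.max 1 ((2 / ln mu) ^+ 2)); first by rewrite le_max lexx.
move=> x Y; rewrite !ge_max => /andP[x1 xmu] /andP[/andP[Y1 YX] YX1] Qx.
have [m [Ym mQ hm]] := hQ Y YX1; rewrite -/mu in mQ hm.
have x0 : 0 < x by lra. have Y0 : 0 < Y by lra. have m0 : 0 < m by lra.
have a0 : 0 <= a by lra.
have s1 := sqrt_ge1 x1; have s2 := sqr_sqrtr (ltW x0); set s := Num.sqrt x in s1 s2 Qx.
have ss : s * s = x by rewrite -expr2.
have s0 : 0 < s := lt_le_trans ltr01 s1.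
have mu0 : 0 < mu := lt_trans ltr01 mu1.
have div_le u v : 0 < u -> u <= v -> x / v <= x / u.
  by move=> u0 uv; rewrite ler_wpM2l ?(ltW x0) // lef_pV2 ?posrE // (lt_le_trans u0).
have mum : 0 < mu * m by rewrite mulr_gt0.
have m_mum : m <= mu * m by rewrite ler_peMl ?ltW.
have QY0 : 0 < Q * Y by rewrite mulr_gt0 // (lt_trans ltr01).
have good n : (0 < n)%N -> n%:R <= x / Y -> 0 <= deficit a x n.
  move=> n0 nx; rewrite /deficit mulr_ge0 ?ln_ge0 ?ler1n // subr_ge0.
  have n0' : (0 : R) < n%:R by rewrite ltr0n.
  have Yn : Y <= x / n%:R by rewrite ler_pdivlMr // mulrC -ler_pdivlMr.
  have {}Yn := le_trans YX Yn.
  rewrite ler_pdivrMr //; apply: le_trans (hX _ Yn) _.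
  by rewrite mulrAC -mulrA.
have mono u v : 0 <= u <= v -> v <= x / Y -> 0 <= sumto v (deficit a x) - sumto u (deficit a x).
  move=> uv vY; have -> : 0 = sumto v (fun=> 0) - sumto u (fun=> 0) :> R.
    by rewrite /sumto !big1 ?subr0.
  apply: sumto_sub_ge => // n n0 /andP[un nv]; apply: good => //; lra.
have u1 : s <= x / (mu * m).
  by rewrite ler_pdivlMr // -ss ler_wpM2l // ?(ltW s0) // (le_trans mQ).
have q0 : 0 <= x / (Q * Y) by rewrite divr_ge0 // ltW.
have b1 := mono (x / m) (x / Y) _ (lexx _).
have b2 : 0 <= sumto (x / (mu * m)) (deficit a x) - sumto (x / (Q * Y)) (deficit a x).
  by apply: mono; rewrite ?q0 /= div_le //; lra.
have {}b1 : 0 <= sumto (x / Y) (deficit a x) - sumto (x / m) (deficit a x).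
  by apply: b1; rewrite div_le // divr_ge0 // ltW.
suff b3 : d / 8 * ln mu * ln x <=
   sumto (x / m) (deficit a x) - sumto (x / (mu * m)) (deficit a x) by lra.
have lsx : ln s = ln x / 2 by rewrite -ss lnM ?posrE //; field.
have lx0 : 0 <= ln x by exact: ln_ge0.
have umu : 0 <= x / (mu * m) <= x / m by rewrite divr_ge0 ?(ltW x0) ?(ltW mum) //= div_le.
apply: le_trans (_ : d / 2 * (ln x / 2) * (sumto (x / m) (fun n => n%:R^-1) -
   sumto (x / (mu * m)) (fun n => n%:R^-1)) <= _).
  apply: le_trans (_ : d / 2 * (ln x / 2) * (ln mu / 2) <= _); first by lra.
  rewrite ler_wpM2l ?mulr_ge0 ?divr_ge0 // ?(ltW d0) //.
  have := @harmonic_sub_ge (x / (mu * m)) (x / m).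
  have p0 : 0 < x / (mu * m) by rewrite divr_gt0.
  rewrite p0 div_le // => /(_ isT); apply: le_trans.
  rewrite !ln_div ?posrE // lnM ?posrE //.
  have iu : (x / (mu * m))^-1 <= s^-1 by rewrite lef_pV2 ?posrE // divr_gt0.
  have sinv : s^-1 <= ln mu / 2.
    rewrite -[leRHS]invrK lef_pV2 ?posrE ?invr_gt0 ?divr_gt0 //.
    rewrite invf_div -(@ler_pXn2r _ 2) ?nnegrE ?s2 ?(ltW s0) //.
    by rewrite divr_ge0 // ltW.
  by move: iu sinv; move: (x / (mu * m))^-1 => w; clear; lra.
rewrite mulrBr -!sumtoZ; apply: sumto_sub_ge => // n n0 /andP[un nv].
have n0' : (0 : R) < n%:R by rewrite ltr0n.
have sn : s <= n%:R := le_trans u1 (ltW un).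
have ln_n : ln x / 2 <= ln n%:R by rewrite -lsx ler_ln ?posrE.
have En : `|E (x / n%:R)| <= d / 2 * (x / n%:R).
  apply: hm; rewrite ler_pdivlMr // mulrC -ler_pdivlMr // nv /=.
  by rewrite ler_pdivrMr // mulrC -ler_pdivrMr // ltW.
have dn : d / 2 / n%:R <= a / n%:R - `|E (x / n%:R)| / x.
  have : `|E (x / n%:R)| / x <= d / 2 / n%:R.
    rewrite ler_pdivrMr //; apply: le_trans En _; rewrite le_eqVlt; apply/orP; left; apply/eqP; ring.
  have : d / n%:R <= a / n%:R by rewrite ler_wpM2r // invr_ge0.
  have -> : d / 2 / n%:R = d / n%:R / 2 by ring.
  clear; lra.
rewrite /deficit; have -> : d / 2 * (ln x / 2) / n%:R = ln x / 2 * (d / 2 / n%:R) by ring.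
by rewrite ler_pM // !divr_ge0 // ltW.
Qed.

(** About ln x / (2 ln Q) disjoint blocks fit below sqrt x, and together they lower the logarithmic
    average by order ln^2 x. The saving [k] depends on [d] but not on [a], which lets the iteration
    reach [d]. *)
Lemma error_step d : 0 < d <= 1 -> exists2 k : R, 0 < k & forall a, d <= a ->
  (exists X : R, forall z, X <= z -> `|E z| <= a * z) ->
  exists X : R, forall z, X <= z -> `|E z| <= (a - k) * z.
Proof.
move=> d01; have /andP[d0 d1] := d01.
have [Q Q1 [kb kb0 hblock]] := deficit_block d01.
have [K1 K10 hK1] := E_le; have [K K0 hK] := E_log_average.
have lQ : 0 < ln Q by rewrite ln_gt0.
have Q0 : 0 < Q := lt_trans ltr01 Q1.
pose k := kb / (4 * ln Q); have k0 : 0 < k by rewrite divr_gt0 ?mulr_gt0.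
exists k => // a da [X hX].
have [X' hX' [x0 x01 hb]] := hblock a X da hX.
move: hX'; rewrite ge_max => /andP[X'1 XX'].
have X'0 : 0 < X' by lra. have lX' : 0 <= ln X' by rewrite ln_ge0.
have a0 : 0 < a by lra.
(* [C] collects everything of order ln x. The average saves 2 k ln^2 x: half absorbs C ln x, half is
   kept. *)
pose C := 2 * a + 2 * K1 * (1 + ln X') + 2 * K.
have C0 : 0 <= C by rewrite !addr_ge0 ?mulr_ge0 ?addr_ge0 // ltW.
(* The exponent ensures C <= k ln x and ln x / 4 >= ln X' + ln Q, the latter so that at least ln x /
   (4 ln Q) blocks fit. *)
exists (x0 + X' + expR (1 + C / k + 4 * (ln X' + ln Q))) => x xbig.
have e0 := expR_gt0 (1 + C / k + 4 * (ln X' + ln Q)).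
have lx : 1 + C / k + 4 * (ln X' + ln Q) <= ln x by apply: ln_ge_of_expR; lra.
have Ck : 0 <= C / k by rewrite divr_ge0 // ltW.
have [x0x X'x] : x0 <= x /\ X' <= x by move: xbig e0 X'1 x01; clear; lra.
have x1 := le_trans x01 x0x; have x_gt0 := lt_le_trans ltr01 x1.
set l := ln x in lx; have l1 : 1 <= l by lra.
have l0 : 0 < l := lt_le_trans ltr01 l1.
have Cl : C <= k * l by rewrite mulrC -ler_pdivrMr //; lra.
have s0 : 0 < Num.sqrt x by rewrite sqrtr_gt0.
have ls : ln (Num.sqrt x) = l / 2.
  by rewrite /l -[x in RHS](sqr_sqrtr (ltW x_gt0)) lnXn // -mulr_natl; field.
pose D := deficit a x.
have good n : (0 < n)%N -> n%:R <= x / X' -> 0 <= D n.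
  move=> n0 nx; rewrite /D /deficit mulr_ge0 ?ln_ge0 ?ler1n // subr_ge0.
  have n0' : (0 : R) < n%:R by rewrite ltr0n.
  have Xn : X <= x / n%:R.
    by apply: le_trans XX' _; rewrite ler_pdivlMr // mulrC -ler_pdivlMr.
  rewrite ler_pdivrMr //; apply: le_trans (hX _ Xn) _.
  by rewrite mulrAC -mulrA.
have blocks j : X' * Q ^+ j <= Num.sqrt x ->
    j%:R * (kb * l) <= sumto (x / X') D - sumto (x / (X' * Q ^+ j)) D.
  elim: j => [|j IH] h; first by rewrite mul0r mulr1 subrr.
  have Qj : 1 <= Q ^+ j by rewrite exprn_ege1 // ltW.
  have XQ : X' <= X' * Q ^+ j by rewrite ler_peMr // ltW.
  have h' : Q * (X' * Q ^+ j) <= Num.sqrt x by rewrite mulrCA -exprS.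
  have h0 : X' * Q ^+ j <= Num.sqrt x.
    by apply: le_trans h'; apply: ler_peMl; [exact: le_trans (ltW X'0) XQ|exact: ltW].
  have b := hb x (X' * Q ^+ j) x0x XQ h'.
  have := IH h0; rewrite -natr1 mulrDl mul1r exprS [X' * (_ * _)]mulrCA.
  by move: b; rewrite -/l -/D; clear; lra.
pose t := (l / 2 - ln X') / ln Q.
have t0 : 0 <= t by rewrite divr_ge0 ?(ltW lQ) //; move: lx Ck lQ lX'; clear; lra.
have [j jt tj] : exists2 j : nat, j%:R <= t & t < j%:R + 1.
  by exists (Num.truncn t); rewrite ?truncn_le // natr1 truncnS_gt.
have jX : X' * Q ^+ j <= Num.sqrt x.
  rewrite -ler_ln ?posrE ?mulr_gt0 ?exprn_gt0 // lnM ?posrE ?exprn_gt0 // lnXn // ls -mulr_natl.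
  have : j%:R * ln Q <= t * ln Q by rewrite ler_wpM2r ?(ltW lQ).
  by rewrite /t divfK ?gt_eqF //; lra.
have jl : k * l ^+ 2 <= j%:R * (kb * l).
  rewrite /t ltr_pdivrMr // in tj.
  have -> : k * l ^+ 2 = (l / (4 * ln Q)) * (kb * l) by rewrite /k; field; rewrite gt_eqF.
  have kl0 : 0 <= kb * l := mulr_ge0 (ltW kb0) (ltW l0).
  apply: (ler_wpM2r kl0).
  have lQ4 : 0 < 4 * ln Q by rewrite mulr_gt0.
  by rewrite (ler_pdivrMr _ _ lQ4); move: tj lx Ck lX'; clear; lra.
have main : k * l ^+ 2 <= sumto (x / X') D.
  have : 0 <= sumto (x / (X' * Q ^+ j)) D.
    apply: sumto_ge0 => n n0 nx; apply: good => //; apply: le_trans nx _.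
    rewrite ler_wpM2l ?(ltW x_gt0) // lef_pV2 ?posrE ?mulr_gt0 ?exprn_gt0 //.
    by rewrite ler_peMr ?(ltW X'0) // exprn_ege1 // ltW.
  by move: (blocks j jX) jl; clear; lra.
have xX' : 0 <= x / X' <= x.
  by rewrite divr_ge0 ?(ltW x_gt0) ?(ltW X'0) //= ler_pdivrMr // ler_peMr // ltW.
have tail : - (K1 * l) * (1 + ln X') <= sumto x D - sumto (x / X') D.
  apply: le_trans (_ : sumto x (fun n => - (K1 * l) * n%:R^-1) -
      sumto (x / X') (fun n => - (K1 * l) * n%:R^-1) <= _).
    rewrite !sumtoZ -mulrBr !mulNr lerN2 ler_wpM2l ?mulr_ge0 ?(ltW l0) //.
    have h1 := harmonic_le x1.
    have xX1 : 1 <= x / X' by rewrite ler_pdivlMr // mul1r.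
    have := harmonic_ge xX1; rewrite ln_div ?posrE //.
    by move: h1; rewrite -/l; lra.
  apply: sumto_sub_ge => // n n0 /andP[_ nx].
  have n0' : (0 : R) < n%:R by rewrite ltr0n.
  have i0 : 0 < (n%:R^-1 : R) by rewrite invr_gt0.
  have En : `|E (x / n%:R)| / x <= K1 * n%:R^-1.
    rewrite ler_pdivrMr //; apply: le_trans (hK1 _ _) _.
      by rewrite ler_pdivlMr // mul1r.
    by rewrite le_eqVlt; apply/orP; left; apply/eqP; ring.
  have lnn : ln n%:R <= l by rewrite /l ler_ln ?posrE.
  have lnn0 : 0 <= ln n%:R :> R by rewrite ln_ge0 // ler1n.
  have KE : 0 <= K1 * n%:R^-1 by rewrite mulr_ge0 // ltW.
  apply: le_trans (_ : ln n%:R * (- (K1 * n%:R^-1)) <= _).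
    rewrite mulrN mulNr lerN2 [K1 * l]mulrC -mulrA; exact: ler_wpM2r.
  rewrite /D /deficit ler_wpM2l //.
  by rewrite -[leLHS]add0r lerB // divr_ge0 // ltW.
have eqS : sumto x (fun n => ln n%:R * `|E (x / n%:R)|) =
    x * (a * sumto x (fun n => ln n%:R / n%:R) - sumto x D).
  rewrite -[a * _]sumtoZ -sumtoB -sumtoZ; apply: eq_sumto => n n0 _.
  by rewrite /D /deficit; field; rewrite gt_eqF // gt_eqF // ltr0n.
have hl := sum_ln_over_n_le x1; rewrite -/l in hl.
have := hK x x1; rewrite eqS -/l => fin.
have l2 : 0 < l ^+ 2 by rewrite exprn_gt0.
rewrite -(ler_pM2r l2); apply: le_trans fin _.
have -> : 2 * (x * (a * sumto x (fun n => ln n%:R / n%:R) - sumto x D)) + K * (x * (1 + l)) =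
  x * (2 * (a * sumto x (fun n => ln n%:R / n%:R) - sumto x D) + K * (1 + l)) by ring.
rewrite [(a - k) * x]mulrC -mulrA ler_wpM2l ?(ltW x_gt0) //.
have h1 : a * sumto x (fun n => ln n%:R / n%:R) <= a * (l ^+ 2 / 2 + 1) by rewrite ler_wpM2l // ltW.
have h2 : C * l <= k * l * l by rewrite ler_wpM2r // ltW.
have h3 : K <= K * l by rewrite ler_peMr.
have h4 : a <= a * l by rewrite ler_peMr // ltW.
have e2 : l ^+ 2 = l * l by rewrite expr2.
move: h2; rewrite /C; move: main tail h1 h3 h4; rewrite e2; set S1 := sumto x _; set S2 := sumto x D.
set S3 := sumto _ D; set u := ln X'; clear; lra.
Qed.

(** Each round lowers the bound by the same [k] until it reaches [d], so finitely many rounds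
    suffice. *)
Lemma error_small : forall d, 0 < d -> exists X : R, forall z, X <= z -> `|E z| <= d * z.
Proof.
move=> d' d'0; pose d := Num.min d' 1.
have d01 : 0 < d <= 1 by rewrite /d lt_min d'0 ltr01 ge_min lexx orbT.
have /andP[d0 d1] := d01.
have [k k0 hk] := error_step d01; have [K K0 hK] := E_le.
have iter n : exists X : R, forall z, X <= z -> `|E z| <= Num.max d (K - k * n%:R) * z.
  elim: n => [|n [X hX]].
    exists 1 => z z1; apply: le_trans (hK z z1) _.
    by rewrite ler_wpM2r ?(le_trans ler01) // mulr0 subr0 le_max lexx orbT.
  have [h|h] := leP (K - k * n%:R) d.
    exists (Num.max X 0) => z; rewrite ge_max => /andP[Xz z0].
    apply: le_trans (hX z Xz) _; rewrite ler_wpM2r // ge_max !le_max lexx /=.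
    by rewrite h.
  have [|X1 hX1] := hk _ (ltW h).
    by exists X => z Xz; have := hX z Xz; rewrite max_r // ltW.
  exists (Num.max X1 0) => z; rewrite ge_max => /andP[Xz z0].
  apply: le_trans (hX1 z Xz) _; rewrite ler_wpM2r // le_max; apply/orP; right.
  by rewrite -natr1; lra.
have [X hX] := iter (Num.truncn (K / k)).+1.
exists (Num.max X 0) => z; rewrite ge_max => /andP[Xz z0].
apply: le_trans (hX z Xz) _; rewrite ler_wpM2r // ge_max; apply/andP; split.
  by rewrite /d ge_min lexx.
have := truncnS_gt (K / k); rewrite ltr_pdivrMr // => h.
have : (Num.truncn (K / k)).+1%:R * k = k * (Num.truncn (K / k)).+1%:R by ring.
lra.
Qed.

End SelbergEndgame.

(** * Split primes *)

Section SplitPrimes.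
Context {R : realType}.
Implicit Types x : R.

Lemma prime_ideal_theorem (d : R) : 0 < d ->
  exists X : R, forall x, X <= x -> `|sumto x ideal_mangoldt - x| <= d * x.
Proof.
move: d; have [c c0 hc] := @ideal_count_sum R.
have C9 : 0 <= 9 :> R by [].
have r1 : @ideal_count R 1%N = 1 by case: (@ideal_count_multiplicative R).
have dL n : (0 < n)%N -> dconv ideal_mobius (fun k => ideal_count k * ln k%:R) n = ideal_mangoldt n :> R.
  by [].
apply: (@error_small R (psi_error ideal_mangoldt)).
- by apply: (@psi_error_le _ ideal_count ideal_mobius _ c 9) => //;
    [exact: ideal_count_ge0|exact: norm_ideal_mobius_le|exact: dconv_mobius_count
    |exact: mangoldt_ge0|exact: dconv_mangoldt_count].
- by apply: (@error_log_average _ ideal_count ideal_mobius _ c 9) => //;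
    [exact: ideal_count_ge0|exact: norm_ideal_mobius_le|exact: dconv_mobius_count
    |exact: mangoldt_ge0|exact: dconv_mangoldt_count].
- by apply: (@sum_error_bounded _ ideal_count ideal_mobius _ c 9) => //;
    [exact: ideal_count_ge0|exact: norm_ideal_mobius_le|exact: dconv_mobius_count
    |exact: mangoldt_ge0|exact: dconv_mangoldt_count].
- by apply: (@error_short_interval _ ideal_count ideal_mobius _ c 9) => //;
    [exact: ideal_count_ge0|exact: norm_ideal_mobius_le|exact: dconv_mobius_count
    |exact: mangoldt_ge0|exact: dconv_mangoldt_count].
Qed.

Definition split_prime (p : nat) : bool := prime p && (chi8 p == 1).

Definition split_theta x : R := sumto x (fun n => (split_prime n)%:R * ln n%:R).

Definition split_pi x : R := sumto x (fun n => (split_prime n)%:R).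

Lemma chi8_prime_eq0 p : prime p -> chi8 p = 0 -> p = 2%N.
Proof.
move=> pp; case: (even_prime pp) => // op.
have chk : all (fun a => odd a ==> (chi8 a != 0)) (iota 0 8) by [].
have mi : (p %% 8)%N \in iota 0 8 by rewrite mem_iota ltn_mod.
have := allP chk _ mi; rewrite /chi8 modn_mod odd_mod // op /=.
by move=> /negP h /eqP.
Qed.

Lemma prime_mul_false m n : (1 < m)%N -> (1 < n)%N -> prime (m * n) = false.
Proof.
move=> m1 n1; apply/negP => pmn.
have /(prime_nt_dvdP pmn) : (m %| m * n)%N by apply: dvdn_mulr.
by move=> /(_ _)-E; have := E ltac:(lia); nia.
Qed.

Lemma mangoldt_prime p : prime p -> ideal_mangoldt p = (1 + chi p) * ln p%:R :> R.
Proof. by move=> pp; rewrite -{1}(expn1 p) mangoldt_prime_power // expr1. Qed.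

(* The double sum majorizes the contribution of the prime 2 and of the proper
   prime powers. *)
Lemma mangoldt_sub_split (N Y n : nat) : (2 <= Y)%N -> (N < Y.+1 ^ 2)%N -> (0 < n <= N)%N ->
  0 <= (ideal_mangoldt n : R) - 2 * ((split_prime n)%:R * ln n%:R) <=
  \sum_(1 <= p < Y.+1) \sum_(1 <= k < (trunc_log p N).+1)
     (if n == (p ^ k)%N then 2 * ln p%:R else 0).
Proof.
move=> Y2 NY /andP[n0]; move: n n0.
have B0 m : 0 <= \sum_(1 <= p < Y.+1) \sum_(1 <= k < (trunc_log p N).+1)
     (if m == (p ^ k)%N then 2 * ln p%:R else 0) :> R.
  rewrite big_nat; apply: sumr_ge0 => p /andP[p1 _]; apply: sumr_ge0 => k _.
  by case: ifP => // _; rewrite mulr_ge0 // ln_ge0 // ler1n.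
have Bge p k : prime p -> (0 < k)%N -> (p ^ k <= N)%N -> (p <= Y)%N ->
    2 * ln p%:R <= \sum_(1 <= q < Y.+1) \sum_(1 <= j < (trunc_log q N).+1)
     (if (p ^ k)%N == (q ^ j)%N then 2 * ln q%:R else 0) :> R.
  move=> pp k0 pkN pY; have p0 := prime_gt0 pp.
  have k_le : (k <= trunc_log p N)%N by apply: trunc_log_max => //; exact: prime_gt1.
  have t0 (q j : nat) : (0 < q)%N -> 0 <= (if (p ^ k)%N == (q ^ j)%N then 2 * ln q%:R else 0) :> R.
    by move=> q0; case: ifP => // _; rewrite mulr_ge0 // ln_ge0 // ler1n.
  rewrite (bigD1_seq p) /= ?iota_uniq ?mem_index_iota ?p0 ?ltnS //.
  rewrite (bigD1_seq k) /= ?iota_uniq ?mem_index_iota ?k0 ?ltnS // eqxx -addrA lerDl addr_ge0 //.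
    by apply: sumr_ge0 => j _; apply: t0.
  rewrite big_seq_cond; apply: sumr_ge0 => q; rewrite mem_index_iota => /andP[/andP[q0 _] _].
  by apply: sumr_ge0 => j _; apply: t0.
apply: coprime_ind => [_|p k pp k0 pkN|m n m1 n1 mn _ _ _] /=.
- by rewrite mangoldt1 /split_prime /= mul0r mulr0 subrr lexx B0.
- have l0 : 0 <= ln p%:R :> R by rewrite ln_ge0 // ler1n prime_gt0.
  have [k1|k2] : k = 1%N \/ (2 <= k)%N by lia.
    move: pkN; rewrite k1 expn1 => pN; rewrite mangoldt_prime // /split_prime pp /=.
    have := B0 p; case: (chi8_cases p) => cp; rewrite /chi cp /=.
    + have p2 := chi8_prime_eq0 pp cp; move=> _.
      have pY : (p <= Y)%N by rewrite p2.
      have := @Bge p 1%N pp isT; rewrite expn1 => /(_ pN pY).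
      by rewrite mulr0z addr0 mul0r mulr0 subr0 mul1r l0 /=; apply: le_trans; lra.
    + have -> : (1 + 1%:~R) * ln p%:R - 2 * (1 * ln p%:R) = 0 :> R by rewrite mulr1z; ring.
      by move=> ->; rewrite lexx.
    + by move=> h; rewrite mulrNz mulr1z subrr !mul0r mulr0 subrr lexx.
  have nsp : split_prime (p ^ k) = false.
    rewrite /split_prime; case: k k2 {k0 pkN} => [|[|k]] // _; have p1 := prime_gt1 pp.
    by rewrite expnS prime_mul_false // -(expn0 p) ltn_exp2l.
  rewrite nsp mul0r mulr0 subr0 mangoldt_ge0 ?expn_gt0 ?prime_gt0 //=.
  apply: le_trans (Bge p k pp k0 pkN _).
    rewrite mangoldt_prime_power // ler_wpM2r //.
    have : `|chi p ^+ k| <= 1 :> R by rewrite normrX exprn_ile1 ?chi_norm_le1.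
    rewrite ler_norml; lra.
  rewrite -ltnS -(@ltn_exp2r _ _ 2) //; apply: leq_ltn_trans NY; apply: leq_trans pkN.
  by rewrite leq_exp2l // prime_gt1.
- have nsp : split_prime (m * n) = false.
    by rewrite /split_prime prime_mul_false.
  by rewrite nsp mul0r mulr0 subr0 mangoldt_coprime // lexx B0.
Qed.

Lemma mangoldt_sum_le : exists2 K : R, 0 <= K &
  forall x, 1 <= x -> sumto x ideal_mangoldt <= K * x.
Proof.
have [c c0 hc] := @ideal_count_sum R.
by apply: (@psi_le _ ideal_count ideal_mobius _ c 9) => //;
    [by case: (@ideal_count_multiplicative R)
    |exact: ideal_count_ge0|exact: norm_ideal_mobius_le|exact: dconv_mobius_count
    |exact: mangoldt_ge0|exact: dconv_mangoldt_count].
Qed.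

(** For fixed p there are at most log_p N exponents, each worth 2 ln p: together at most 2 ln N. *)
Lemma prime_powers_sum_le (N Y : nat) : (0 < N)%N ->
  \sum_(1 <= n < N.+1) \sum_(1 <= p < Y.+1) \sum_(1 <= k < (trunc_log p N).+1)
     (if n == (p ^ k)%N then 2 * ln p%:R else 0) <= Y%:R * (2 * ln N%:R) :> R.
Proof.
move=> N0; rewrite exchange_big /=.
apply: le_trans (_ : \sum_(1 <= p < Y.+1) 2 * ln N%:R <= _); last first.
  by rewrite big_const_nat subn1 iter_addr_0 -[leLHS]mulr_natl.
rewrite !big_nat; apply: ler_sum => p /andP[p0 _]; rewrite exchange_big /=.
have l0 : 0 <= ln p%:R :> R by rewrite ln_ge0 // ler1n.
apply: le_trans (_ : \sum_(1 <= k < (trunc_log p N).+1) 2 * ln p%:R <= _).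
  apply: ler_sum => k _; rewrite -big_mkcond big_nat1_eq; case: ifP => // _.
  by rewrite mulr_ge0.
rewrite big_const_nat subn1 iter_addr_0 -[leLHS]mulr_natl mulrCA ler_pM2l //.
have [p1|p1] : p = 1%N \/ (1 < p)%N by lia.
  by rewrite p1 ln1 mulr0 ln_ge0 // ler1n.
rewrite mulr_natl -lnXn ?ltr0n // -natrX ler_ln ?posrE ?ltr0n ?expn_gt0 ?p0 //.
by rewrite ler_nat trunc_logP.
Qed.

Lemma psi_sub_split_theta x : 4 <= x ->
  0 <= sumto x ideal_mangoldt - 2 * split_theta x <= 2 * (Num.sqrt x * ln x).
Proof.
move=> x4; have x1 : 1 <= x by lra. have x0 : 0 < x by lra.
have s2 : 2 <= Num.sqrt x.
  rewrite -(@ler_pXn2r _ 2) ?nnegrE ?sqrtr_ge0 // sqr_sqrtr ?(ltW x0) //; lra.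
have [N0 Nx _ _] := natr_truncn x1; set N := Num.truncn x in N0 Nx.
set Y := Num.truncn (Num.sqrt x).
have Ys : Y%:R <= Num.sqrt x by rewrite truncn_le.
have Y2 : (2 <= Y)%N by rewrite truncn_ge_nat ?sqrtr_ge0.
have NY : (N < Y.+1 ^ 2)%N.
  rewrite -(ltr_nat R); apply: le_lt_trans Nx _; rewrite natrX.
  rewrite -{1}(sqr_sqrtr (ltW x0)) ltr_pXn2r ?nnegrE ?sqrtr_ge0 //; exact: truncnS_gt.
have E : sumto x ideal_mangoldt - 2 * split_theta x =
  \sum_(1 <= n < N.+1) (ideal_mangoldt n - 2 * ((split_prime n)%:R * ln n%:R)).
  by rewrite /split_theta -sumtoZ -sumtoB.
have pw n : (1 <= n < N.+1)%N -> _ := fun h => @mangoldt_sub_split N Y n Y2 NY h.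
rewrite E; apply/andP; split.
  by rewrite big_nat; apply: sumr_ge0 => n /pw /andP[].
apply: le_trans (_ : Y%:R * (2 * ln N%:R) <= _).
  apply: le_trans (prime_powers_sum_le Y N0).
  by rewrite !big_nat; apply: ler_sum => n /pw /andP[].
rewrite mulrCA ler_pM2l //; apply: ler_pM => //; first by rewrite ln_ge0 // ler1n.
by rewrite ler_ln ?posrE // ltr0n.
Qed.

(** With s = x^(1/4), ln x <= 4 s, and 4 <= d s once x >= (4 / d)^4. *)
Lemma sqrt_ln_small (d : R) : 0 < d -> exists X : R, forall x, X <= x ->
  Num.sqrt x * ln x <= d * x.
Proof.
move=> d0; exists ((4 / d) ^+ 4 + 1) => x hx.
have d4 : 0 < 4 / d by rewrite divr_gt0.
have x0 : 0 < x by apply: lt_le_trans hx; rewrite addr_gt0 // exprn_gt0.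
set s := Num.sqrt (Num.sqrt x).
have s0 : 0 < s by rewrite !sqrtr_gt0.
have e2 : Num.sqrt x = s ^+ 2 by rewrite sqr_sqrtr // sqrtr_ge0.
have e4 : x = s ^+ 4 by rewrite (exprM s 2 2) -e2 sqr_sqrtr // ltW.
have l4 : ln x <= 4 * s.
  by rewrite e4 lnXn // -[leLHS]mulr_natl ler_pM2l // ltW // ln_sublinear.
have ds : 4 / d <= s.
  rewrite -(@ler_pXn2r _ 4) ?nnegrE ?(ltW d4) ?(ltW s0) // -e4; lra.
rewrite ler_pdivrMr // in ds.
rewrite e2; apply: le_trans (_ : s ^+ 2 * (4 * s) <= _).
  by rewrite ler_wpM2l // exprn_ge0 // ltW.
rewrite [in leRHS]e4 (_ : s ^+ 2 * (4 * s) = 4 * s ^+ 3); last by ring.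
rewrite (_ : d * s ^+ 4 = (s * d) * s ^+ 3); last by ring.
by rewrite ler_wpM2r // exprn_ge0 // ltW.
Qed.

Lemma split_theta_asymp (d : R) : 0 < d -> exists X : R, forall x, X <= x ->
  `|split_theta x - x / 2| <= d * x.
Proof.
move=> d0; have [X1 h1] := prime_ideal_theorem d0.
have [X2 h2] := @sqrt_ln_small (d / 2) ltac:(lra).
exists (Num.max (Num.max X1 X2) 4) => x; rewrite !ge_max => /andP[/andP[x1 x2] x4].
have := psi_sub_split_theta x4; have := h1 x x1; have := h2 x x2.
rewrite !ler_norml; lra.
Qed.

Lemma split_theta_le : exists2 K : R, 0 <= K & forall x, 1 <= x -> split_theta x <= K * x.
Proof.
have [K K0 hK] := mangoldt_sum_le; exists K => // x x1.
apply: le_trans (hK x x1); apply: le_sumto => n n0 nx.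
have := @mangoldt_sub_split n.+4 n.+2 n isT.
have -> : (n.+4 < n.+3 ^ 2)%N by nia.
rewrite n0 leqW ?leqW ?leqW // => /(_ isT isT) /andP[h _].
have : 0 <= (split_prime n)%:R * ln n%:R :> R by rewrite mulr_ge0 // ln_ge0 // ler1n.
lra.
Qed.

Lemma sum_nat_leq (M N : nat) : \sum_(1 <= n < N.+1) (n <= M)%N%:R = (minn N M)%:R :> R.
Proof.
elim: N => [|N IH]; first by rewrite big_geq // min0n.
rewrite big_nat_recr //= IH -natrD; congr (_%:R); case: leqP; lia.
Qed.

(** The difference is the sum of ln(x / p) over split p. Primes up to [M] cost at most ln x each;
    for p > M a factor ln p / ln M >= 1 is inserted, and the linear bound on [split_theta] gives O(x
    / ln M). [M] stays free so that this can be made small. *)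
Lemma split_pi_sub_theta : exists2 K : R, 0 <= K & forall (M : nat) x, (1 < M)%N -> 1 <= x ->
  0 <= split_pi x * ln x - split_theta x <= M%:R * ln x + K * x / ln M%:R.
Proof.
have [K K0 hK] := split_theta_le; exists (K * 2) => [|M x M1 x1]; first by rewrite mulr_ge0.
have lM : 0 < ln M%:R :> R by rewrite ln_gt0 // ltr1n.
have x0 : 0 < x by lra. have lx := ln_ge0 x1.
have -> : split_pi x * ln x - split_theta x = sumto x (fun n => (split_prime n)%:R * ln (x / n%:R)).
  rewrite -sumto_mulr -sumtoB; apply: eq_sumto => n n0 nx.
  by rewrite ln_div ?posrE ?ltr0n //; ring.
have ld n : (0 < n)%N -> n%:R <= x -> 0 <= ln (x / n%:R).
  by move=> n0 nx; rewrite ln_ge0 // ge1_div.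
apply/andP; split; first by apply: sumto_ge0 => n n0 nx; rewrite mulr_ge0 ?ld.
have h1 : sumto x (fun n => (split_prime n)%:R * ln n%:R * ln (x / n%:R)) <= K * (2 * x).
  apply: le_trans (_ : K * sumto x (fun n => ln (x / n%:R)) <= _); last first.
    by rewrite ler_wpM2l // sum_ln_div_le.
  apply: sumto_mul_le => //; first exact: ltW.
  move=> n n0 nx; rewrite ler_ln ?posrE ?divr_gt0 ?ltr0n //.
  by rewrite ler_wpM2l ?(ltW x0) // lef_pV2 ?posrE ?ltr0n // ler_nat.
apply: le_trans (_ : sumto x (fun n => (n <= M)%N%:R * ln x +
    (split_prime n)%:R * ln n%:R * ln (x / n%:R) / ln M%:R) <= _).
  apply: le_sumto => n n0 nx; have l := ld n n0 nx.
  have sl : 0 <= ln n%:R :> R by rewrite ln_ge0 // ler1n.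
  have t0 : 0 <= (split_prime n)%:R * ln n%:R * ln (x / n%:R) / ln M%:R.
    by rewrite !mulr_ge0 // invr_ge0 ltW.
  have [nM|Mn] := leqP n M.
    rewrite mul1r; apply: le_trans (_ : ln x <= _); last by rewrite lerDl.
    apply: le_trans (_ : ln (x / n%:R) <= _); first by case: split_prime; rewrite ?mul1r ?mul0r.
    rewrite ler_ln ?posrE ?divr_gt0 ?ltr0n // ler_pdivrMr ?ltr0n // ler_peMr ?(ltW x0) //.
    by rewrite ler1n.
  rewrite mul0r add0r.
  have -> : (split_prime n)%:R * ln n%:R * ln (x / n%:R) / ln M%:R =
    ((split_prime n)%:R * ln (x / n%:R)) * (ln n%:R / ln M%:R) by ring.
  rewrite ler_peMr ?mulr_ge0 //.
  have M0 : (0 < M)%N by exact: ltnW.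
  by rewrite ler_pdivlMr // mul1r ler_ln ?posrE ?ltr0n // ler_nat ltnW.
rewrite sumtoD !sumto_mulr lerD //.
  by rewrite ler_wpM2r // /sumto sum_nat_leq ler_nat geq_minr.
by rewrite ler_wpM2r ?invr_ge0 ?(ltW lM) // -mulrA.
Qed.

Lemma split_pi_asymp (d : R) : 0 < d -> exists X : R, forall x, X <= x ->
  `|split_pi x * ln x - x / 2| <= d * x.
Proof.
move=> d0; have [K K0 hK] := split_pi_sub_theta.
have [X1 h1] := @split_theta_asymp (d / 2) ltac:(lra).
(* ln M >= 4 K / d makes K x / ln M at most d x / 4. *)
pose M := (Num.truncn (expR (4 * K / d + 1))).+2.
have M1 : (1 < M)%N by [].
have e0 : 0 <= 4 * K / d by rewrite divr_ge0 ?mulr_ge0 // ltW.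
have lM : 4 * K / d + 1 <= ln M%:R.
  apply: ln_ge_of_expR; apply: ltW; apply: lt_trans (truncnS_gt _) _.
  by rewrite ltr_nat.
clearbody M.
have M0 : (0 : R) < M%:R by rewrite ltr0n; lia.
have [X2 h2] := @sqrt_ln_small (d / (4 * M%:R)) ltac:(by rewrite divr_gt0 ?mulr_gt0).
exists (Num.max (Num.max X1 X2) 1) => x; rewrite !ge_max => /andP[/andP[x1 x2] x3].
have := hK M x M1 x3; have := h1 x x1; have x0 : 0 < x by lra.
have a1 : M%:R * ln x <= d / 4 * x.
  have h : ln x <= d / (4 * M%:R) * x.
    apply: le_trans (h2 x x2); rewrite ler_peMl ?ln_ge0 //; exact: sqrt_ge1.
  apply: le_trans (ler_wpM2l (ltW M0) h) _; rewrite le_eqVlt; apply/orP; left; apply/eqP.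
  by field; rewrite gt_eqF.
have a2 : K * x / ln M%:R <= d / 4 * x.
  rewrite mulrAC ler_wpM2r ?(ltW x0) // ler_pdivrMr; last by lra.
  have : d / 4 * (4 * K / d) <= d / 4 * ln M%:R by rewrite ler_wpM2l; lra.
  by have -> : d / 4 * (4 * K / d) = K; first by field; rewrite gt_eqF.
rewrite !ler_norml; lra.
Qed.

End SplitPrimes.

(** * Prime elements and split primes *)

Lemma split_prime_odd p : split_prime p -> odd p.
Proof.
case/andP => pp /eqP h; case: (even_prime pp) => // p2.
by move: h; rewrite p2.
Qed.

Lemma prod_sign_leq (m n : nat) (F : comNzRingType) :
  \prod_(1 <= k < n.+1) (if (k <= m)%N then 1 else -1) = (-1) ^+ (n - m) :> F.
Proof.
elim: n => [|n IH]; first by rewrite big_geq // sub0n.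
rewrite big_nat_recr //= IH; have [h|h] := leqP n.+1 m.
  by rewrite mulr1; congr (_ ^+ _); lia.
by rewrite subSn // exprSr.
Qed.

(* Gauss's lemma for the residue 2: multiplication by 2 permutes [1..h] up to sign. *)
Lemma expr2_half p : prime p -> odd p ->
  (2%:R : 'F_p) ^+ p./2 = (-1) ^+ (p./2 - p./2./2).
Proof.
move=> pp op; set h := p./2.
have ph : p = (h.*2).+1 by rewrite -[LHS]odd_double_half op.
have p1 := prime_gt1 pp.
have nz k : (0 < k < p)%N -> (k%:R : 'F_p) != 0.
  move=> /andP[k0 kp]; rewrite -(dvdn_pcharf (pchar_Fp pp)).
  by apply/negP => /(dvdn_leq k0); lia.
pose f k := if (k <= h./2)%N then k.*2 else (p - k.*2)%N.
have fP k : (0 < k <= h)%N -> (0 < f k <= h)%N.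
  by rewrite /f ph; case: (leqP k h./2); lia.
have f_inj : {in index_iota 1 h.+1 &, injective f}.
  move=> i j; rewrite !mem_index_iota /f ph; case: (leqP i h./2); case: (leqP j h./2); lia.
have perm : perm_eq (index_iota 1 h.+1) [seq f k | k <- index_iota 1 h.+1].
  apply: uniq_perm; first exact: iota_uniq.
    by rewrite map_inj_in_uniq ?iota_uniq.
  have U : uniq [seq f k | k <- index_iota 1 h.+1] by rewrite map_inj_in_uniq ?iota_uniq.
  have Sub : {subset [seq f k | k <- index_iota 1 h.+1] <= index_iota 1 h.+1}.
    by move=> _ /mapP[k kh ->]; move: kh; rewrite !mem_index_iota; have := fP k; lia.
  have [|_ E] := uniq_min_size U Sub; first by rewrite size_map.
  by move=> z; rewrite E.
have H0 : \prod_(1 <= k < h.+1) (k%:R : 'F_p) != 0.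
  rewrite prodf_seq_neq0; apply/allP => k; rewrite mem_index_iota /= => kh.
  by apply: nz; rewrite ph; lia.
apply: (mulIf H0).
have -> : 2%:R ^+ h * \prod_(1 <= k < h.+1) k%:R = \prod_(1 <= k < h.+1) ((k.*2)%:R : 'F_p).
  have -> : 2%:R ^+ h = \prod_(1 <= k < h.+1) (2%:R : 'F_p) by rewrite prodr_const_nat subn1.
  by rewrite -big_split; apply: eq_bigr => k _ /=; rewrite -natrM mul2n.
rewrite [in RHS](perm_big _ perm) big_map -prod_sign_leq -big_split /=.
apply: eq_big_nat => k /andP[k0 kh]; rewrite /f; case: ifP => kk; first by rewrite mul1r.
rewrite mulN1r natrB; last by rewrite ph; lia.
by rewrite pchar_Fp_0 // sub0r opprK.
Qed.

(** With h = (p - 1) / 2, Gauss's lemma turns (-2)^h into a sign, which is + for p = 1, 3 modulo 8.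
    In the cyclic unit group, of order 2 h, an element whose h-th power is 1 is an even power of a
    generator, hence a square. *)
Lemma split_prime_sqr p : split_prime p -> exists s : nat, (p %| s ^ 2 + 2)%N.
Proof.
move=> sp; have op := split_prime_odd sp; case/andP: sp => pp /eqP chi1.
have p1 := prime_gt1 pp; have p0 := prime_gt0 pp.
pose h := p./2; have ph : p = (h.*2).+1 by rewrite -[LHS]odd_double_half op.
pose a : 'F_p := - 2%:R.
have ah : a ^+ h = 1.
  rewrite /a exprNn expr2_half // -exprD -signr_odd -/h.
  suff -> : odd (h + (h - h./2)) = false by [].
  have : (p %% 8 == 1)%N || (p %% 8 == 3)%N.
    have chk : all (fun b => (chi8 b == 1) ==> ((b == 1)%N || (b == 3)%N)) (iota 0 8) by [].
    have mi : (p %% 8)%N \in iota 0 8 by rewrite mem_iota ltn_mod.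
    by have := allP chk _ mi; rewrite {1}/chi8 modn_mod -/(chi8 p) chi1.
  by rewrite ph; lia.
have F2 : (2%:R : 'F_p) != 0.
  rewrite -(dvdn_pcharf (pchar_Fp pp)); apply/negP => /dvdn_leq-/(_ isT).
  by move: op p1; case: (p) => [|[|[|]]].
have ua : a \is a GRing.unit by rewrite unitfE oppr_eq0.
pose u : {unit 'F_p} := FinRing.unit 'F_p ua.
have uh : (u ^+ h)%g = 1%g by apply: val_inj; rewrite FinRing.val_unitX /= ah.
have /cyclicP[g gE] : cyclic [set: {unit 'F_p}]%G by apply: field_unit_group_cyclic.
have og : #[g]%g = h.*2.
  by rewrite orderE -gE card_finField_unit card_Fp // ph.
have /cycleP[k uk] : u \in <[g]>%g by rewrite -gE inE.
have : (#[g]%g %| k * h)%N by rewrite order_dvdn expgM -uk uh.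
rewrite og -mul2n dvdn_pmul2r; last by move: p1; rewrite ph; lia.
move=> /dvdnP[j kj].
pose t : 'F_p := FinRing.uval (g ^+ j)%g.
have tt : t ^+ 2 = - 2%:R.
  by rewrite /t -FinRing.val_unitX -expgM -kj -uk.
exists (t : nat); rewrite (dvdn_pcharf (pchar_Fp pp)) natrD natrX.
by rewrite natr_Zp tt addNr.
Qed.

(** * Representation of split primes by the norm form *)

Lemma sqr_sub_le (i j k : nat) : (i <= k)%N -> (j <= k)%N ->
  (i%:Z - j%:Z) ^+ 2 <= k%:Z ^+ 2.
Proof.
move=> ik jk; rewrite -[leLHS]real_normK ?num_real // ler_pXn2r ?nnegrE //; lia.
Qed.

(* Thue's pigeonhole argument. *)
Lemma thue_norm_form p (s : nat) : prime p -> odd p -> (p %| s ^ 2 + 2)%N ->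
  exists x y : int, p%:Z = x ^+ 2 + 2 * y ^+ 2.
Proof.
move=> pp op ps; have p1 := prime_gt1 pp; have p0 := prime_gt0 pp.
have [k [k1 k2]] : exists k, (k ^ 2 < p)%N /\ (p < k.+1 ^ 2)%N.
  have ex : exists k, (p < k.+1 ^ 2)%N by exists p; nia.
  case: (ex_minnP ex) => k hk kmin; exists k; split => //.
  case: k hk kmin => [|k] hk kmin //.
  rewrite ltn_neqAle; apply/andP; split.
    apply/negP => /eqP kp; move: pp; rewrite -kp expnS expn1.
    case: k {hk kmin} kp => [|k] kp; first by [].
    by rewrite prime_mul_false.
  by rewrite leqNgt; apply/negP => /kmin; rewrite ltnn.
pose f (ij : 'I_k.+1 * 'I_k.+1) : 'I_p := Ordinal (ltn_pmod (ij.1 + s * ij.2) p0).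
(* There are (k + 1)^2 > p pairs (i, j) for the p residues of i + s j. *)
have : ~~ injectiveb f.
  apply/negP => /injectiveP /leq_card; rewrite card_prod !card_ord; nia.
move/injectivePn => [[i j] [[i' j'] ne /(congr1 val) /= eq]].
pose X : int := i%:Z - i'%:Z; pose Y : int := j'%:Z - j%:Z.
have : (p%:Z %| X - s%:Z * Y)%Z.
  have -> : X - s%:Z * Y = (i + s * j)%N%:Z - (i' + s * j')%N%:Z.
    by rewrite /X /Y !PoszD !PoszM; ring.
  by rewrite -eqz_mod_dvd !modz_nat eq.
move=> /dvdzP[q qE].
move: ps => /dvdnP[m mE].
have mE' : s%:Z ^+ 2 + 2 = m%:Z * p%:Z by rewrite -PoszM -mE PoszD; congr (_ + _); rewrite -rmorphXn.
have N : X ^+ 2 + 2 * Y ^+ 2 = p%:Z * (q * (q * p%:Z + 2 * s%:Z * Y) + m%:Z * Y ^+ 2).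
  have -> : X = s%:Z * Y + q * p%:Z by rewrite -qE; ring.
  have -> : p%:Z * (q * (q * p%:Z + 2 * s%:Z * Y) + m%:Z * Y ^+ 2) =
     p%:Z * (q * (q * p%:Z + 2 * s%:Z * Y)) + (m%:Z * p%:Z) * Y ^+ 2 by ring.
  rewrite -mE'; ring.
set t := (q * _ + _) in N.
have Xk : X ^+ 2 <= k%:Z ^+ 2.
  by apply: sqr_sub_le; rewrite -ltnS.
have Yk : Y ^+ 2 <= k%:Z ^+ 2.
  by apply: sqr_sub_le; rewrite -ltnS.
have kp : k%:Z ^+ 2 < p%:Z by rewrite -rmorphXn /= ltz_nat.
have pos : 0 < X ^+ 2 + 2 * Y ^+ 2.
  have [X0|X0] := eqVneq X 0; last first.
    by rewrite ltr_pwDl ?exprn_even_gt0 // mulr_ge0 ?sqr_ge0.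
  have [Y0|Y0] := eqVneq Y 0; last first.
    by rewrite ltr_wpDl ?sqr_ge0 // mulr_gt0 ?exprn_even_gt0.
  case/eqP: ne; congr (_, _); apply: val_inj => /=; apply/eqP; rewrite -eqz_nat.
    by rewrite -subr_eq0 -/X X0.
  by rewrite eq_sym -subr_eq0 -/Y Y0.
have p0' : 0 < p%:Z by [].
clearbody X Y t.
(* The norm of X + Y sqrt(-2) is t p, and 0 < t < 3 because X^2 and Y^2 are below p. *)
have [t1|t2] : t = 1 \/ t = 2.
  have : 0 < t by rewrite -(pmulr_rgt0 _ p0') -N.
  have : t < 3 by rewrite -(ltr_pM2l p0') -N; lia.
  lia.
  by exists X, Y; rewrite N t1 mulr1.
(* If the norm is 2 p, then X = 2 X' is even and Y^2 + 2 X'^2 = p. *)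
have [X' XE] : exists X' : int, X = 2 * X'.
  have : ~~ odd `|X|.
    have : ~~ odd (`|X| ^ 2) .
      have : (`|X| ^ 2)%N%:Z = 2 * (p%:Z - Y ^+ 2).
        rewrite -abszX gez0_abs ?sqr_ge0 //; move: N; rewrite t2; lia.
      move: (`|X| ^ 2)%N => w; lia.
    by rewrite oddX.
  by move=> h; exists (X %/ 2)%Z; clear -h; lia.
rewrite t2 in N; exists Y, X'; apply: (@mulfI _ 2) => //; rewrite [LHS]mulrC -N XE; ring.
Qed.

Lemma split_prime_norm p : split_prime p ->
  exists x y : int, [/\ 0 < x, 0 < y & znorm (ZSqrtm2 x y) = p].
Proof.
move=> sp; have op := split_prime_odd sp; have [s hs] := split_prime_sqr sp.
case/andP: sp => pp _; have [x [y xy]] := thue_norm_form pp op hs.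
exists `|x|, `|y|; split.
- rewrite normr_gt0; apply/eqP => x0; move: op; rewrite -[p]/(`|p%:Z|%N) xy x0 expr0n add0r abszM oddM //.
- rewrite normr_gt0; apply/eqP => y0; move: pp.
  rewrite -[p]/(`|p%:Z|%N) xy y0 expr0n mulr0 addr0 abszX expnS expn1.
  case: (leqP `|x|%N 1) => [|x1]; last by rewrite prime_mul_false.
  by case: (absz x) => [|[|]].
- by rewrite znormE /= !real_normK ?num_real // -xy.
Qed.

(** * Prime elements and their norms *)

Lemma Euclid_dvdzM (p : nat) (a b : int) : prime p ->
  (p %| a * b)%Z = (p %| a)%Z || (p %| b)%Z.
Proof. by move=> pp; rewrite !dvdzE abszM Euclid_dvdM. Qed.

(* Modulo [x + y sqrt(-2)] of prime norm [p], the residue of [u + v sqrt(-2)] is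
   determined by the integer [x v - y u] modulo [p]. *)
Lemma rdivides_prime_norm (p : nat) (x y u v : int) : prime p -> ~~ (p %| y)%Z ->
  znorm (ZSqrtm2 x y) = p -> (p %| x * v - y * u)%Z ->
  rdivides (ZSqrtm2 x y) (ZSqrtm2 u v).
Proof.
move=> pp py; rewrite znormE /= => N /dvdzP[q qE].
have : (p %| y * (x * u + 2 * y * v))%Z.
  apply/dvdzP; exists (v - x * q).
  have -> : y * (x * u + 2 * y * v) = v * (x ^+ 2 + 2 * y ^+ 2) - x * (x * v - y * u) by ring.
  by rewrite N qE; ring.
rewrite Euclid_dvdzM // (negbTE py) => /dvdzP[t tE].
have p0 : p%:Z != 0 by rewrite -lt0n prime_gt0.
exists (ZSqrtm2 t q); congr ZSqrtm2 => /=.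
  apply: (mulIf p0); rewrite -{1}N.
  have -> : (t * x - 2 * (q * y)) * p = x * (t * p) - 2 * y * (q * p) by ring.
  by rewrite -tE -qE; ring.
apply: (mulIf p0); rewrite -{1}N.
have -> : (t * y + q * x) * p = y * (t * p) + x * (q * p) by ring.
by rewrite -tE -qE; ring.
Qed.

(** The residue of u + v sqrt(-2) is tracked by the integer x v - y u. Multiplying two such integers
    gives, modulo p, -y times the one of the product, so Euclid's lemma for p transfers to the
    element. *)
Lemma prime_element_of_norm (p : nat) (x y : int) : prime p ->
  znorm (ZSqrtm2 x y) = p -> prime_element (ZSqrtm2 x y).
Proof.
move=> pp N; have p1 := prime_gt1 pp.
have py : ~~ (p %| y)%Z.
  apply/negP => py; have : (p %| x * x)%Z.
    have -> : x * x = p%:Z - 2 * y * y by rewrite -N znormE /=; ring.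
    by rewrite rpredB ?dvdz_mull // dvdzz.
  rewrite Euclid_dvdzM // orbb => /dvdzP[a xE]; have /dvdzP[b yE] := py.
  move: N; rewrite znormE /= xE yE => N.
  have : (a ^+ 2 + 2 * b ^+ 2) * p = 1.
    have p0 : p%:Z != 0 by rewrite -lt0n prime_gt0.
    by apply: (mulIf p0); rewrite mul1r -{3}N; ring.
  move=> /(congr1 absz); rewrite abszM absz1 => /eqP; rewrite muln_eq1 => /andP[_ /eqP p1'].
  by move: p1; rewrite -[p]/(`|p%:Z|%N) p1'.
split.
- by rewrite -znorm_eq0 N -lt0n prime_gt0.
- apply/negP; rewrite -topredE /= => u.
  have : znorm (ZSqrtm2 x y) == 1 by [].
  by rewrite N => /eqP[]; move: p1; case: (p) => [|[|]].
- move=> [u1 v1] [u2 v2] [[e f] abE].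
  have d : (p %| (x * v1 - y * u1) * (x * v2 - y * u2))%Z.
    move: abE => [] /= h1 h2.
    have -> : (x * v1 - y * u1) * (x * v2 - y * u2) =
      - y * (x * (u1 * v2 + v1 * u2) - y * (u1 * u2 - 2 * (v1 * v2))) +
      v1 * v2 * (x ^+ 2 + 2 * y ^+ 2) by ring.
    rewrite h1 h2.
    have -> : x * (e * y + f * x) - y * (e * x - 2 * (f * y)) = f * (x ^+ 2 + 2 * y ^+ 2) by ring.
    by move: N; rewrite znormE /= => ->; rewrite rpredD // ?dvdz_mull // dvdz_mull.
  by move: d; rewrite Euclid_dvdzM // => /orP[h|h]; [left|right]; apply: rdivides_prime_norm h.
Qed.

(** p^2 = (x u - 2 y v)^2 + 2 (x v + y u)^2 = (x u + 2 y v)^2 + 2 (x v - y u)^2, and p divides x v +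
    y u or x v - y u. A nonzero multiple of p would give 2 p^2 <= p^2, so x v = y u and the two
    representations are proportional. *)
Lemma norm_form_unique (p : nat) (x y u v : int) : prime p ->
  0 < x -> 0 < y -> 0 < u -> 0 < v ->
  x ^+ 2 + 2 * y ^+ 2 = p -> u ^+ 2 + 2 * v ^+ 2 = p -> x = u /\ y = v.
Proof.
move=> pp x0 y0 u0 v0 N1 N2; have p0 : 0 < p%:Z by rewrite ltz_nat prime_gt0.
have : (p %| (x * v - y * u) * (x * v + y * u))%Z.
  have -> : (x * v - y * u) * (x * v + y * u) =
    (x ^+ 2 + 2 * y ^+ 2) * v ^+ 2 - y ^+ 2 * (u ^+ 2 + 2 * v ^+ 2) by ring.
  by rewrite N1 N2; apply/dvdzP; exists (v ^+ 2 - y ^+ 2); ring.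
rewrite Euclid_dvdzM // => /orP[] /dvdzP[q qE]; last first.
  have e : p%:Z ^+ 2 = (x * u - 2 * y * v) ^+ 2 + 2 * (x * v + y * u) ^+ 2.
    by rewrite expr2 -{1}N1 -N2; ring.
  have q0 : 0 < q by rewrite -(pmulr_lgt0 _ p0) -qE addr_gt0 // mulr_gt0.
  have : p%:Z ^+ 2 <= (q * p) ^+ 2.
    by rewrite exprMn ler_peMl ?sqr_ge0 // exprn_ege1.
  have : 0 < p%:Z ^+ 2 by rewrite exprn_gt0.
  by have := sqr_ge0 (x * u - 2 * y * v); rewrite qE in e; lia.
have e : p%:Z ^+ 2 = (x * u + 2 * y * v) ^+ 2 + 2 * (x * v - y * u) ^+ 2.
  by rewrite expr2 -{1}N1 -N2; ring.
have q0 : q = 0.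
  apply/eqP/contraT => q0; have : 1 <= q ^+ 2 by rewrite -gtz0_ge1 exprn_even_gt0.
  move=> q1; have : p%:Z ^+ 2 <= (q * p) ^+ 2 by rewrite exprMn ler_peMl ?sqr_ge0.
  have : 0 < p%:Z ^+ 2 by rewrite exprn_gt0.
  by have := sqr_ge0 (x * u + 2 * y * v); rewrite qE in e; lia.
have xv : x * v = y * u by apply/eqP; rewrite -subr_eq0 qE q0 mul0r.
have yv : y ^+ 2 = v ^+ 2.
  apply: (mulfI (lt0r_neq0 p0)); rewrite -{1}N2 -N1 !mulrDl -!exprMn mulrC.
  by rewrite xv; ring.
have yv' : y = v by apply/eqP; rewrite -(@eqrXn2 _ 2) ?yv // ltW.
split=> //; apply/eqP; rewrite -(@eqrXn2 _ 2) ?ltW //; apply/eqP.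
by apply: (addIr (2 * y ^+ 2)); rewrite N1 yv' N2.
Qed.

(** The element divides its norm, a positive integer, and primality pushes it into one prime factor
    of that integer. *)
Lemma prime_element_dvd_prime (a : zsqrtm2) : prime_element a ->
  exists2 q : nat, prime q & rdivides a (ZSqrtm2 q 0).
Proof.
move=> [a0 aU aP].
have H n : (0 < n)%N -> rdivides a (ZSqrtm2 n 0) -> exists2 q : nat, prime q & rdivides a (ZSqrtm2 q 0).
  elim/ltn_ind: n => n IH n0 an.
  have [n1|n1] : n = 1%N \/ (1 < n)%N by lia.
    exfalso; move/negP: aU; apply; move: an => [c]; rewrite n1 => /(congr1 znorm).
    rewrite znormM (_ : znorm (ZSqrtm2 1 0) = 1) // => h.
    have /eqP : (`|znorm c| * `|znorm a|)%N = 1%N by rewrite -abszM -h.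
    rewrite muln_eq1 => /andP[_ /eqP na].
    by rewrite -topredE /= /zunit -(gez0_abs (znorm_ge0 a)) na.
  have pq := pdiv_prime n1; have nE := divnK (pdiv_dvd n).
  have E : ZSqrtm2 n 0 = ZSqrtm2 (n %/ pdiv n)%N 0 * ZSqrtm2 (pdiv n) 0.
    by rewrite -{1}nE PoszM; congr ZSqrtm2 => /=; ring.
  rewrite E in an; case: (aP _ _ an) => h; last by exists (pdiv n).
  apply: (IH (n %/ pdiv n)%N) => //; first by rewrite ltn_Pdiv // prime_gt1.
  by rewrite divn_gt0 ?pdiv_gt0 // dvdn_leq // pdiv_dvd.
apply: (H `|znorm a|%N); first by rewrite absz_gt0 znorm_eq0.
exists (zconj a); rewrite mulrC mul_zconj zsqrtm2_intr; congr ZSqrtm2.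
by rewrite gez0_abs // znorm_ge0.
Qed.

(** The norm divides q^2 for a rational prime q. Norm 1 means a unit. Norm q^2 makes the cofactor of
    q a unit, hence rational, which forces y = 0. For norm q, x is odd and x^2 + 2 y^2 is 1 or 3
    modulo 8. *)
Lemma prime_element_cases (x y : int) : prime_element (ZSqrtm2 x y) -> 0 < x -> 0 <= y ->
  y = 0 \/ [/\ 0 < y & exists2 p : nat, split_prime p & znorm (ZSqrtm2 x y) = p].
Proof.
move=> pa x0 y0; have [q pq [[e f] cE]] := prime_element_dvd_prime pa.
have [a0 aU _] := pa.
have [->|yn0] := eqVneq y 0; [by left|right].
have {}y0 : 0 < y by rewrite lt_neqAle eq_sym yn0.
split=> //; set a := ZSqrtm2 x y in a0 aU cE *.
have Nc := znormM (ZSqrtm2 e f) a; rewrite -cE in Nc.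
have Nq : znorm (ZSqrtm2 q 0) = (q ^ 2)%N :> int by rewrite znormE /= expr0n mulr0 addr0 -rmorphXn.
have Na := gez0_abs (znorm_ge0 a).
have : (`|znorm a| %| q ^ 2)%N.
  by rewrite -[(q ^ 2)%N]/(`|(q ^ 2)%N%:Z|%N) -Nq Nc abszM dvdn_mull.
move=> /(dvdn_pfactor _ _ pq)[i i2 aE].
have q0 : 0 < q%:Z by rewrite ltz_nat prime_gt0.
case: i i2 aE => [|[|[|]]] // _ aE.
- exfalso; move/negP: aU; apply; rewrite -topredE /= /zunit -Na aE //.
- rewrite expn1 in aE; exists q; last by rewrite -Na aE.
  have N : x ^+ 2 + 2 * y ^+ 2 = q by rewrite -aE Na znormE.
  have oq : odd q.
    case: (even_prime pq) => // q2; exfalso; move: N; rewrite q2; nia.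
  rewrite /split_prime pq /=.
  have Nn : (`|x| ^ 2 + 2 * `|y| ^ 2)%N = q.
    apply/eqP; rewrite -eqz_nat PoszD PoszM; apply/eqP; rewrite -N.
    by rewrite -!abszX !gez0_abs ?sqr_ge0.
  have ox : odd `|x| by move: oq; rewrite -Nn oddD oddM oddX /=; rewrite addbF.
  have chk : all (fun b => all (fun c => odd b ==> (chi8 (b ^ 2 + 2 * c ^ 2) == 1)) (iota 0 8)) (iota 0 8) by [].
  have mi b : (b %% 8)%N \in iota 0 8 by rewrite mem_iota ltn_mod.
  have := allP (allP chk _ (mi `|x|%N)) _ (mi `|y|%N); rewrite odd_mod // ox /=.
  by rewrite /chi8 -modnDm modnXm -modnMmr modnXm modnMmr modnDm Nn.
- exfalso; have : znorm (ZSqrtm2 e f) = 1.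
    apply: (mulIf (lt0r_neq0 (_ : 0 < znorm a))); first by rewrite -Na aE ltz_nat expn_gt0 prime_gt0.
    by rewrite -Nc Nq mul1r -Na aE.
  rewrite znormE /= => ef.
  have f0 : f = 0 by apply/eqP; rewrite -sqrf_eq0; apply/eqP; have := sqr_ge0 e; have := sqr_ge0 f; lia.
  have e0 : e != 0 by apply/eqP => e0; move: ef; rewrite e0 f0.
  move: cE => [_]; rewrite f0 mul0r addr0 => /esym/eqP; rewrite mulf_eq0 (negbTE e0) /=.
  by rewrite (negbTE yn0).
Qed.

Lemma split_pi_size {R : realType} (x : R) :
  split_pi x = (size [seq n <- index_iota 1 (Num.truncn x).+1 | split_prime n])%:R.
Proof.
rewrite /split_pi /sumto -natr_sum; congr (_%:R); rewrite size_filter -sum1_count.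
by rewrite [RHS]big_mkcond; apply: eq_bigr => n _; case: split_prime.
Qed.

(** The norm maps the elements with y nonzero bijectively onto the split primes up to r^2; those
    with y = 0 satisfy x <= r and account for the error r. *)
Lemma prime_count_bounds {R : realType} (r : R) : 1 <= r ->
  split_pi (r ^+ 2) <= (prime_count r)%:R <= split_pi (r ^+ 2) + r.
Proof.
move=> r1; have r0 : 0 <= r by lra.
rewrite split_pi_size; set t := [seq n <- _ | _].
pose s := enum_fset (fset_set (quadrant_primes r)).
have us : uniq s by exact: fset_uniq.
have sP a : reflect (quadrant_primes r a) (a \in s).
  have -> : (a \in s) = (a \in quadrant_primes r) := in_fset_set (finite_quadrant_primes r) a.
  by apply: (iffP idP); rewrite in_setE.
have -> : prime_count r = size s by [].
have ut : uniq t by rewrite filter_uniq // iota_uniq.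
have tP p : (p \in t) = split_prime p && (p%:R <= r ^+ 2).
  rewrite mem_filter mem_index_iota mem_sumto ?sqr_ge0 //.
  by case: (boolP (split_prime p)) => // /andP[/prime_gt0 -> _].
have normE a (n : nat) : znorm a = n -> (znorm a)%:~R = n%:R :> R.
  by move=> ->; rewrite -pmulrn.
apply/andP; split.
  rewrite ler_nat -(size_map (fun a => `|znorm a|%N) s); apply: uniq_leq_size => // p.
  rewrite tP => /andP[sp pr]; have [x [y [x0 y0 N]]] := split_prime_norm sp.
  apply/mapP; exists (ZSqrtm2 x y); last by rewrite N.
  apply/sP; split; last by split => //=; [exact: ltW|rewrite (normE _ p)].
  by case/andP: sp => pp _; exact: (prime_element_of_norm pp N).
pose s1 := [seq a <- s | ypart a != 0]; pose s0 := [seq a <- s | ypart a == 0].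
have -> : size s = (size s1 + size s0)%N.
  by rewrite !size_filter addnC -(count_predC (fun a : zsqrtm2 => ypart a == 0)).
have h1 : (size s1 <= size t)%N.
  have sub a : a \in s1 -> [/\ 0 < xpart a, 0 < ypart a & exists2 p, split_prime p &
     znorm a = p /\ p%:R <= r ^+ 2].
    rewrite mem_filter => /andP[y0 /sP [pa [xa ya na]]].
    case: a y0 pa xa ya na => x y /= y0 pa xa ya na.
    have [yE|[ya' [p sp N]]] := prime_element_cases pa xa ya; first by rewrite yE in y0.
    by split => //; exists p => //; split => //; rewrite -(normE _ p N).
  rewrite -(size_map (fun a => `|znorm a|%N) s1); apply: uniq_leq_size.
    rewrite map_inj_in_uniq ?filter_uniq // => a b /sub[xa ya [p sp [Na _]]] /sub[xb yb [q _ [Nb _]]].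
    rewrite Na Nb /= => pq; case/andP: sp => pp _.
    move: xa ya xb yb Na Nb; rewrite -pq !znormE; case: a b => [x y] [u v] /= x0 y0 u0 v0 N1 N2.
    by have [-> ->] := norm_form_unique pp x0 y0 u0 v0 N1 N2.
  by move=> _ /mapP[a /sub[_ _ [p sp [Na pr]]] ->]; rewrite Na tP sp.
have h0 : (size s0 <= Num.truncn r)%N.
  rewrite -(size_map (fun a => `|xpart a|%N) s0) -[leqRHS](size_iota 1); apply: uniq_leq_size.
    rewrite map_inj_in_uniq ?filter_uniq // => a b.
    rewrite !mem_filter => /andP[/eqP ya /sP[_ [xa _ _]]] /andP[/eqP yb /sP[_ [xb _ _]]].
    case: a b ya yb xa xb => [x y] [u v] /= -> -> x0 u0 E.
    by congr ZSqrtm2; rewrite -[x]gtz0_abs // -[u]gtz0_abs // E.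
  move=> _ /mapP[a + ->]; rewrite mem_filter => /andP[/eqP ya /sP[_ [xa _ na]]].
  rewrite mem_iota add1n ltnS absz_gt0 gt_eqF //= truncn_ge_nat //.
  have -> : `|xpart a|%N%:R = (xpart a)%:~R :> R by rewrite natr_absz gtr0_norm.
  rewrite -(@ler_pXn2r _ 2) ?nnegrE ?ler0z ?(ltW xa) // -rmorphXn /=.
  by move: na; rewrite znormE ya expr0n mulr0 addr0.
have h2 : (Num.truncn r)%:R <= r by rewrite truncn_le.
rewrite natrD; apply: lerD; first by rewrite ler_nat.
by apply: le_trans h2; rewrite ler_nat.
Qed.

(** * The area of the region *)

Section QuadrantArea.
Context {R : realType}.
Implicit Types r x : R.

Definition circle_height r x : R := Num.sqrt (r ^+ 2 - x ^+ 2).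

(* A primitive of [2 * circle_height r]; writing the angle [asin (x / r)] as
   [2 * atan (x / (r + circle_height r x))] keeps it continuous up to [x = r]. *)
Definition circle_primitive r x : R :=
  x * circle_height r x + 2 * r ^+ 2 * atan (x / (r + circle_height r x)).

Lemma continuous_circle_height r : continuous (circle_height r).
Proof.
move=> x; apply: (@continuous_comp _ _ _ (fun x => r ^+ 2 - x ^+ 2) Num.sqrt); last first.
  exact: sqrt_continuous.
apply: continuousB; first exact: cst_continuous.
exact: exprn_continuous.
Qed.

Lemma continuous_circle_primitive r : 0 < r -> continuous (circle_primitive r).
Proof.
move=> r0 x; have h0 : 0 < r + circle_height r x by rewrite ltr_wpDr ?sqrtr_ge0.
have -> : circle_primitive r = (id * circle_height r) +
    (cst (2 * r ^+ 2) * (atan \o (fun y => y * (r + circle_height r y)^-1))) by [].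
apply: (@continuousD _ _ _ _ _ x).
  apply: (@continuousM _ _ _ _ x); [exact: cvg_id|exact: continuous_circle_height].
apply: (@continuousM _ _ _ _ x); first exact: cst_continuous.
apply: (@continuous_comp _ _ _ _ atan); last exact: continuous_atan.
apply: (@continuousM _ _ id _ x); first exact: cvg_id.
apply: (@continuousV _ _ _ x); first by rewrite gt_eqF.
apply: (@continuousD _ _ _ (cst r) _ x); [exact: cst_continuous|exact: continuous_circle_height].
Qed.

Lemma is_derive_circle_height r x : 0 < r -> -r < x < r ->
  is_derive x 1 (circle_height r) (- x / circle_height r x).
Proof.
move=> r0 /andP[xr1 xr2]; have p0 : 0 < r ^+ 2 - x ^+ 2 by nra.
have d1 : is_derive x 1 (fun y : R => r ^+ 2 - y ^+ 2) (- (2 * x)).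
  apply: is_derive_eq; rewrite ?scaler0 ?add0r.
  rewrite /GRing.scale /=; ring.
have h0 : 0 < circle_height r x by rewrite sqrtr_gt0.
have := @is_derive1_comp _ Num.sqrt _ x _ _ (is_derive1_sqrt p0) d1.
have -> : (2 * Num.sqrt (r ^+ 2 - x ^+ 2))^-1 * - (2 * x) = - x / circle_height r x.
  rewrite /circle_height in h0 *; field; rewrite gt_eqF //.
by [].
Qed.

Lemma is_derive_circle_primitive r x : 0 < r -> -r < x < r ->
  is_derive x 1 (circle_primitive r) (2 * circle_height r x).
Proof.
move=> r0 xr; have dh := is_derive_circle_height r0 xr; case/andP: xr => xr1 xr2.
have p0 : 0 < r ^+ 2 - x ^+ 2 by nra.
have h0 : 0 < circle_height r x by rewrite sqrtr_gt0.
have h2 : circle_height r x ^+ 2 = r ^+ 2 - x ^+ 2 by rewrite sqr_sqrtr // ltW.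
have rh : r + circle_height r x != 0 by rewrite gt_eqF // addr_gt0.
have du : is_derive x 1 (fun y => y / (r + circle_height r y))
    (r / (circle_height r x * (r + circle_height r x))).
  have dV : is_derive x 1 (fun y => (r + circle_height r y)^-1)
     (x / (circle_height r x * (r + circle_height r x) ^+ 2)).
    have d1 : is_derive x 1 (fun y => r + circle_height r y) (- x / circle_height r x).
      by have := is_deriveD (is_derive_cst r x 1) dh; rewrite add0r.
    have <- : - (r + circle_height r x) ^- 2 *: (- x / circle_height r x) =
        x / (circle_height r x * (r + circle_height r x) ^+ 2).
      by rewrite /GRing.scale /=; field; rewrite rh gt_eqF.
    exact: (@is_deriveV R (fun y => r + circle_height r y) x _ 1 rh d1).
  have <- : x *: (x / (circle_height r x * (r + circle_height r x) ^+ 2)) +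
      (r + circle_height r x)^-1 *: 1 = r / (circle_height r x * (r + circle_height r x)).
    rewrite /GRing.scale /=; move: h0 h2 rh; move: (circle_height r x) => h h0 h2 rh.
    have -> : r / (h * (r + h)) = (r ^+ 2 + r * h) / (h * (r + h) ^+ 2).
      by field; rewrite rh gt_eqF.
    have -> : r ^+ 2 = h ^+ 2 + x ^+ 2 by rewrite h2; ring.
    by field; rewrite rh gt_eqF.
  exact: (is_deriveM (is_derive_id x 1) dV).
have da := is_derive1_comp (is_derive1_atan _) du.
have d1 := is_deriveM (is_derive_id x 1) dh.
have d2 := is_deriveM (is_derive_cst (2 * r ^+ 2) x 1) da.
have d3 := is_deriveD d1 d2.
move: d3; rewrite /GRing.scale /=; move: (atan _) => at_; move: h0 h2 rh.
set h := circle_height r x; move=> h0 h2 rh.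
have x2 : x ^+ 2 = r ^+ 2 - h ^+ 2 by rewrite h2; ring.
(* Since x^2 = r^2 - h^2, (r + h)^2 + x^2 = 2 r (r + h). *)
have -> : (1 + (x / (r + h)) ^+ 2)^-1 = (r + h) / (2 * r).
  rewrite -[RHS]invf_div; congr (_^-1); rewrite expr_div_n x2; field.
  exact: rh.
have -> : x * (- x / h) + h * 1 + (2 * r ^+ 2 * ((r + h) / (2 * r) * (r / (h * (r + h)))) + at_ * 0) =
    2 * h.
  have -> : x * (- x / h) = - (x ^+ 2 / h) by ring.
  by rewrite x2; field; rewrite rh !gt_eqF.
by [].
Qed.

Lemma integral_circle_height r : 0 < r ->
  (\int[lebesgue_measure]_(x in `[0%R, r]) (2 * circle_height r x)%R%:E)%E = (r ^+ 2 * (pi / 2))%R%:E.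
Proof.
move=> r0; have cp := continuous_circle_primitive r0.
rewrite (@continuous_FTC2 _ _ (circle_primitive r)) //.
- have s0 : circle_height r 0 = r by rewrite /circle_height expr0n subr0 sqrtr_sqr gtr0_norm.
  have sr : circle_height r r = 0 by rewrite /circle_height subrr sqrtr0.
  rewrite /circle_primitive s0 sr mulr0 addr0 divff ?gt_eqF // atan1 !mul0r atan0 mulr0 addr0.
  rewrite -EFinD subr0 add0r; congr (_%:E); field.
- by [].
- apply: continuous_subspaceT => x; apply: (@continuousM _ _ (cst 2) _ x); first exact: cst_continuous.
  exact: continuous_circle_height.
- split.
  + move=> x; rewrite in_itv /= => /andP[x0 xr].
    by have [] := @is_derive_circle_primitive r x r0 ltac:(by apply/andP; split; lra).
  + by apply: cvg_at_right_filter; exact: cp.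
  + by apply: cvg_at_left_filter; exact: cp.
- move=> x; rewrite in_itv /= => /andP[x0 xr]; rewrite derive1E.
  have d := @is_derive_circle_primitive r x r0 ltac:(by apply/andP; split; lra).
  exact: derive_val.
Qed.

Lemma measurable_circle_height (k r : R) (D : set R) : measurable D ->
  measurable_fun D (fun x : R => (k * circle_height r x)%R%:E).
Proof.
move=> mD; apply: measurable_funTS; apply/measurable_EFinP.
apply: continuous_measurable_fun => x; apply: (@continuousM _ _ (cst k) _ x).
  exact: cst_continuous.
exact: continuous_circle_height.
Qed.

(** The product measure integrates the lengths of vertical sections, and these are the heights of
    the circle of radius r scaled by 1 / sqrt 2. *)
Lemma quadrant_areaE r : 0 < r -> quadrant_area r = pi * r ^+ 2 / (4 * Num.sqrt 2).
Proof.
move=> r0; rewrite /quadrant_area; set k := (Num.sqrt 2)^-1 : R.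
have s2 : 0 < Num.sqrt 2 :> R by rewrite sqrtr_gt0.
have k0 : 0 < k by rewrite invr_gt0.
have k2 : k ^+ 2 * 2 = 1 by rewrite exprVn sqr_sqrtr // mulVf.
have -> : (lebesgue_measure \x lebesgue_measure)%E (quadrant_region r) =
   (\int[lebesgue_measure]_(x in `[0%R, r]) (k * circle_height r x)%R%:E)%E.
  (* The region excludes x = 0; dropping this null point from the range makes section length and
     integrand agree everywhere. *)
  rewrite -integral_itv_obnd_cbnd; last exact: measurable_circle_height.
  rewrite [RHS]integral_mkcond /=; apply: eq_integral => x _ /=.
  rewrite patchE; case: ifPn => [|/negP nx].
    rewrite inE /= in_itv /= => /andP[x0 xr].
    have h0 : 0 <= k * circle_height r x by rewrite mulr_ge0 ?sqrtr_ge0 // ltW.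
    have rx : 0 <= r ^+ 2 - x ^+ 2 by nra.
    have -> : xsection (quadrant_region r) x = [set` `[0, k * circle_height r x]].
      apply/seteqP; split=> y; rewrite /xsection /= in_itv /= inE /quadrant_region /=.
        move=> [_ y0 hy]; rewrite y0 /= -(@ler_pXn2r _ 2) ?nnegrE // exprMn sqr_sqrtr //; nra.
      move=> /andP[y0 yh]; split=> //.
      move: yh; rewrite -(@ler_pXn2r _ 2) ?nnegrE // exprMn sqr_sqrtr //; nra.
    rewrite lebesgue_measure_itv /= lte_fin; case: ltP => [_|h]; first by rewrite sube0.
    by congr (_%:E); lra.
  have -> : xsection (quadrant_region r) x = set0.
    apply/seteqP; split=> y //; rewrite /xsection /= inE /quadrant_region /= => -[x0 y0 hy].
    by apply: nx; rewrite inE /= in_itv /= x0 /= -(@ler_pXn2r _ 2) ?nnegrE ?(ltW x0) ?(ltW r0) //; nra.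
  by rewrite measure0.
have -> : (\int[lebesgue_measure]_(x in `[0%R, r]) (k * circle_height r x)%R%:E)%E =
  (\int[lebesgue_measure]_(x in `[0%R, r]) ((k / 2)%R%:E * (2 * circle_height r x)%R%:E))%E.
  by apply: eq_integral => x _; rewrite -EFinM; congr (_%:E); field.
rewrite ge0_integralZl_EFin //.
- rewrite integral_circle_height // -EFinM /= /k; field.
  by rewrite gt_eqF.
- by move=> x _; rewrite lee_fin mulr_ge0 // sqrtr_ge0.
- exact: measurable_circle_height.
- by rewrite divr_ge0 // ltW.
Qed.

End QuadrantArea.

Theorem corollary4p4 (R : realType) :
  asymp_equiv_pinfty
    (fun r : R => (prime_count r)%:R / quadrant_area r)
    (fun r : R => Num.sqrt 2 / (pi * ln r)).
Proof.
apply/cvgrPdist_le => e e0.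
(* The estimate at r^2 involves ln(r^2) = 2 ln r and gets doubled, which contributes e / 2; the
   elements with y = 0 contribute at most 4 r ln r / r^2, the other e / 2. *)
have d0 : 0 < e / 4 by rewrite divr_gt0.
have [X1 h1] := split_pi_asymp d0; have [X2 h2] := sqrt_ln_small d0.
near=> r.
have r2 : 2 <= r by near: r; apply: nbhs_pinfty_ge; rewrite num_real.
have rX1 : X1 <= r by near: r; apply: nbhs_pinfty_ge; rewrite num_real.
have rX2 : X2 <= r by near: r; apply: nbhs_pinfty_ge; rewrite num_real.
have r0 : 0 < r by lra.
have r1 : 1 <= r by lra.
have rr : r <= r ^+ 2 by rewrite expr2 ler_peMr // ltW.
have l0 : 0 < ln r by rewrite ln_gt0 //; lra.
have s2 : 0 < Num.sqrt 2 :> R by rewrite sqrtr_gt0.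
have -> : (prime_count r)%:R / quadrant_area r / (Num.sqrt 2 / (pi * ln r)) =
   4 * (prime_count r)%:R * ln r / r ^+ 2.
  rewrite quadrant_areaE //; move: pi (pi_gt0 R) => q q0; field.
  by rewrite !gt_eqF.
have l2 : ln (r ^+ 2) = 2 * ln r by rewrite lnXn // mulr_natl.
have rr2 : 0 < r ^+ 2 by rewrite exprn_gt0.
have := h1 (r ^+ 2) (le_trans rX1 rr); have := h2 (r ^+ 2) (le_trans rX2 rr).
rewrite sqrtr_sqr gtr0_norm // l2.
have /andP[b1 b2] := prime_count_bounds r1.
have c1 := ler_wpM2r (ltW l0) b1; have c2 := ler_wpM2r (ltW l0) b2.
have -> : 1 - 4 * (prime_count r)%:R * ln r / r ^+ 2 =
    (r ^+ 2 - 4 * (prime_count r)%:R * ln r) / r ^+ 2 by field; rewrite gt_eqF.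
rewrite normrM (@gtr0_norm _ (r ^+ 2)^-1) ?invr_gt0 // ler_pdivrMr // !ler_norml.
lra.
Unshelve. all: by end_near.
Qed.
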